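(* Let $\mu>0$, $\alpha\in(1,\tfrac52]$ and let $B_0\in H^{\frac52-\alpha}(\mathbb{S}^1)$ be real-valued with zero mean. There exists a time $T>0$, depending on $\|B_0\|_{H^{\frac52-\alpha}(\mathbb S^1)}$, such that there exists a unique solution $B(t,x)$ on $[0,T)$ to $$B_t+JB_x+\mu\Lambda^\alpha B=0,\qquad B_x=\mathcal{H}J,\qquad x\in\mathbb{S}^1,$$ with initial data $B(0,x)=B_0(x)$, satisfying $$B\in C\left([0,T);H^{\frac52-\alpha}(\mathbb{S}^1)\right)\cap L^2\left([0,T);H^{\frac52-\frac{\alpha}{2}}(\mathbb{S}^1)\right)$$ together with $$\sup_{0<t<T}t^{\frac{\beta}{\alpha}}\|B(t)\|_{H^{\frac52-\alpha+\beta}(\mathbb{S}^1)}<\infty\quad\text{for all }\beta\ge 0,$$ $$\lim_{t\to0}t^{\frac{\beta}{\alpha}}\|B(t)\|_{H^{\frac52-\alpha+\beta}(\mathbb{S}^1)}=0\quad\text{for all }\beta>0.$$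
   Context: $\mathbb{S}^1=[-\pi,\pi]$ is the periodic interval. $\mathcal{H}$ is the periodic Hilbert transform $\mathcal{H}f(x)=\frac{1}{2\pi}\,\mathrm{P.V.}\int_{-\pi}^{\pi}f(y)\cot\left(\frac{x-y}{2}\right)dy$, and $\Lambda=(-\partial_{xx})^{1/2}=\mathcal{H}\partial_x$, i.e. $\Lambda^\alpha$ is the Fourier multiplier with symbol $|k|^\alpha$. The unknown is the real-valued function $B$. The relation $B_x=\mathcal{H}J$ is understood with $J=-\Lambda B$ (so $J$ has zero mean), and $B$ is normalized by $\int_{\mathbb{S}^1}B(t,x)\,dx=0$, a condition formally preserved by the equation. $H^s(\mathbb{S}^1)$ denotes the (inhomogeneous) $L^2$-based Sobolev space.
   Formalization: The existence time T is allowed to depend on the initial datum B_0 itself, not only on its norm in H^{5/2-α}; a T depending on the norm alone is impossible in general (for α=2, concentrating data of bounded norm blow up in arbitrarily short time). *)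

(* Defs.v *)
From HB Require Import structures.
From mathcomp Require Import all_boot all_order all_algebra.
From mathcomp Require Import all_classical all_reals all_analysis.
From mathcomp Require Import complex.

Set Implicit Arguments.
Unset Strict Implicit.
Unset Printing Implicit Defensive.

Import Order.TTheory GRing.Theory Num.Theory.
Import numFieldNormedType.Exports.
Local Open Scope classical_set_scope.
Local Open Scope ring_scope.

Section Circle.
Variable R : realType.
Implicit Types (f g phi psi : R -> R) (a s : R).

Local Notation leb := (@lebesgue_measure R).

(* Functions on the circle are represented by 2pi-periodic functions on R;
   elements of L^2 and H^s are identified when they agree almost everywhere. *)
Definition periodic f := forall x, f (x + 2 * pi) = f x.

Definition circle_integral f : R := \int[leb]_(x in `[- pi, pi]) f x.

Definition L2 f := [/\ periodic f, measurable_fun [set: R] f &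
  leb.-integrable `[- pi, pi] (fun x => (f x ^+ 2)%:E)].

Definition zero_mean f := circle_integral f = 0.

(* (2 pi)^-1 \int f(x) e^{-ikx} dx *)
Definition fourier_coef f (k : int) : R[i] :=
  ((2 * pi)^-1 * circle_integral (fun x => f x * cos (k%:~R * x)) +i*
   - ((2 * pi)^-1 * circle_integral (fun x => f x * sin (k%:~R * x))))%C.

Definition sobolev_norm s f : \bar R :=
  ((\esum_(k in [set: int])
     ((1 + k%:~R ^+ 2) `^ s *
      ComplexField.Normc.normc (fourier_coef f k) ^+ 2)%:E) `^ 2^-1)%E.

(* Membership in H^s; only used for s >= 0, where H^s is a subspace of L^2. *)
Definition sobolev s f := L2 f /\ (sobolev_norm s f < +oo)%E.

(* g = Lambda^a f for f, g in L^2; used with a > 0, where 0 `^ a = 0. *)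
Definition is_Lambda a f g := forall k : int,
  fourier_coef g k = ((`|k|%:~R `^ a)%:C)%C * fourier_coef f k.

Definition smooth_periodic phi :=
  periodic phi /\ forall (n : nat) (x : R), derivable (derive1n n phi) x 1.

Definition is_weak_derivative f g := forall phi, smooth_periodic phi ->
  circle_integral (fun x => g x * phi x) =
  - circle_integral (fun x => f x * derive1 phi x).

(* By periodicity of the integrand, the integral over [-pi, pi] with the
   singularity y = x removed is taken over the window of length 2 pi centred
   at x. *)
Definition hilbert_trunc f (e x : R) : R :=
  (2 * pi)^-1 * \int[leb]_(y in [set y | e < `|x - y| <= pi])
    (f y * (cos ((x - y) / 2) / sin ((x - y) / 2))).

Definition is_hilbert f g :=
  {ae leb, forall x, hilbert_trunc f e x @[e --> 0^'+] --> g x}.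

(* Weak solution on [0, T).  For almost every t, J(t) = - Lambda B(t) and
   B_x(t) = H J(t) are functions in L^2, hence J B_x is in L^1; on the other
   hand Lambda^alpha B(t) is in general only a distribution, so Lambda^alpha is
   moved onto the test function. *)
Definition weak_solution (mu alpha T : R) (B0 : R -> R) (B : R -> R -> R) :=
  [/\ forall t, 0 <= t < T -> L2 (B t) /\ zero_mean (B t),
      {ae leb, forall x, B 0 x = B0 x} &
      exists J Bx : R -> R -> R,
      [/\ {ae leb, forall t, 0 < t < T ->
            [/\ L2 (J t), L2 (Bx t),
                is_Lambda 1 (B t) (fun x => - J t x),
                is_weak_derivative (B t) (Bx t) &
                is_hilbert (J t) (Bx t)]} &
          forall phi psi, smooth_periodic phi -> L2 psi ->
            is_Lambda alpha phi psi ->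
          let F r := circle_integral (fun x => J r x * Bx r x * phi x)
                     + mu * circle_integral (fun x => B r x * psi x) in
          forall t, 0 <= t < T ->
            leb.-integrable `[0, t] (EFin \o F) /\
            circle_integral (fun x => B t x * phi x) =
            circle_integral (fun x => B0 x * phi x)
              - \int[leb]_(r in `[0, t]) F r]].

Definition continuous_sobolev (T s : R) (B : R -> R -> R) :=
  forall t0, 0 <= t0 < T ->
    sobolev s (B t0) /\
    sobolev_norm s (fun x => B t x - B t0 x)
      @[t --> within `[0, T[ (nbhs t0)] --> 0%E.

Definition square_integrable_sobolev (T s : R) (B : R -> R -> R) :=
  (\int[leb]_(t in `[0%R, T[) (sobolev_norm s (B t) `^ 2) < +oo)%E.

End Circle.

(* Main.v *)
(* Write b_k = p_k + i q_k for the Fourier coefficients of B, k > 0.  Those of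
   J and B_x are - k b_k and i k b_k, and in the product J B_x all interactions
   between frequencies of opposite signs cancel, so the equation becomes the
   triangular system
     p_k' = - mu k^alpha p_k - sum_(l < k) l (k - l) (p_l q_(k-l) + q_l p_(k-l)),
     q_k' = - mu k^alpha q_k + sum_(l < k) l (k - l) (p_l p_(k-l) - q_l q_(k-l)),
   solved mode by mode by Duhamel's formula.  Since exp(- k tau) is multiplicative
   along l + (k - l) = k, induction on k gives
     |p_k(t)| + |q_k(t)| <= A_k exp(- mu k t^(1/alpha) / 2)   for t <= T = K^(-alpha),
   where A solves A_k = C y_k + M (k + K)^(-alpha) sum_l l (k - l) A_l A_(k-l) and y
   are the initial amplitudes.  In a norm of l^2 type with Kato's weight the sum
   of the A_k is controlled by a Cauchy-Schwarz (Schur) estimate once the norm of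
   y is small, and it is small when K is large.  All the regularity claims
   follow from this Gevrey bound mode by mode, with dominated convergence for
   the series.
   For uniqueness, the weak formulation tested with cos and sin shows that the
   coefficients of any solution in the class satisfy the integrated triangular
   system, hence by strong induction on k the difference of two solutions
   satisfies a linear homogeneous Volterra equation in each mode. *)

(* The space H^(5/2 - alpha) is scaling critical: the equation keeps its form under lambda^(alpha -
   2) B(lambda^alpha t, lambda x), which on the line preserves the homogeneous norm. No positive
   power of T is thus available to make the nonlinearity small. Smallness comes from the factor (k /
   (k + K))^(alpha - 1) between the square of Kato's weight and that of the H^s weight: for fixed k
   it tends to 0 as K grows, so K, and with it T, is chosen from the distribution of the energy of
   the data over frequencies. Triangularity replaces a fixed point argument: the modes exist for all
   times and only their size is at stake. As A does not depend on time, the nonlinear analysis is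
   one discrete quadratic inequality, closed by induction on the truncation of the sums, since a
   convolution at level k involves only indices below k. The product J B_x is read through its
   coefficients, which asks for summability of k b_k at each t > 0. The Gevrey bound supplies it for
   the solution constructed, and the bound with beta = 3 for an arbitrary one. *)
Require Import Defs.
From HB Require Import structures.
From mathcomp Require Import all_boot all_order all_algebra.
From mathcomp Require Import all_classical all_reals all_analysis.
From mathcomp Require Import measurable_realfun.
From mathcomp Require Import complex ring lra zify.

Set Implicit Arguments.
Unset Strict Implicit.
Unset Printing Implicit Defensive.

Import Order.TTheory GRing.Theory Num.Theory.
Import numFieldNormedType.Exports.
Local Open Scope classical_set_scope.
Local Open Scope ring_scope.

(** * Calculus and dominated series *)

Section Calculus.
Context {R : realType}.
Local Notation mu := (@lebesgue_measure R).
Implicit Types (f g F G : R -> R) (a b x : R).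

Lemma is_derive_continuous F f : (forall x, is_derive x (1 : R) F (f x)) ->
  continuous F.
Proof.
move=> dF x; apply: differentiable_continuous.
by apply/derivable1_diffP; case: (dF x).
Qed.

Lemma continuous_mulf f g : continuous f -> continuous g ->
  continuous (fun x => f x * g x).
Proof. by move=> cf cg x; exact: cvgM (cf x) (cg x). Qed.

Lemma continuous_addf f g : continuous f -> continuous g ->
  continuous (fun x => f x + g x).
Proof. by move=> cf cg x; exact: cvgD (cf x) (cg x). Qed.

Lemma continuous_oppf f : continuous f -> continuous (fun x => - f x).
Proof. by move=> cf x; exact: cvgN (cf x). Qed.

Lemma continuous_cmulf a f : continuous f -> continuous (fun x => a * f x).
Proof. by apply: continuous_mulf => x; exact: cvg_cst. Qed.

Lemma continuous_sum_nat (m n : nat) (h : nat -> R -> R) :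
  (forall l, (m <= l < n)%N -> continuous (h l)) ->
  continuous (fun x => \sum_(m <= l < n) h l x).
Proof.
elim: n => [|n IH] ch.
  by under eq_fun do rewrite big_geq//; move=> x; exact: cvg_cst.
have [mn|mn] := leqP m n; last first.
  by under eq_fun do rewrite big_geq//; move=> x; exact: cvg_cst.
under eq_fun do rewrite big_nat_recr//=.
apply: continuous_addf; last by apply: ch; rewrite mn leqnn.
by apply: IH => l /andP[ml ln]; apply: ch; rewrite ml ltnS ltnW.
Qed.

Lemma continuous_itv_integrable f a b :
  continuous f -> mu.-integrable `[a, b] (EFin \o f).
Proof.
move=> cf; apply: continuous_compact_integrable; first exact: segment_compact.
exact: continuous_subspaceT.
Qed.

Lemma Rintegral_FTC F f a b : a <= b ->
  (forall x, is_derive x (1 : R) F (f x)) -> continuous f ->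
  \int[mu]_(x in `[a, b]) f x = F b - F a.
Proof.
rewrite le_eqVlt => /predU1P[->|ab] dF cf.
  by rewrite set_itv1 Rintegral_set1 subrr.
rewrite /Rintegral (@continuous_FTC2 _ _ F)//.
- exact: continuous_subspaceT.
- have cF := is_derive_continuous dF; split.
  + by move=> x _; case: (dF x).
  + exact/cvg_at_right_filter/cF.
  + exact/cvg_at_left_filter/cF.
- by move=> x _; rewrite derive1E; case: (dF x).
Qed.

(** The signed primitive [I 0 t - I t 0] makes sense on both sides of 0. Near a given point it
    differs by a constant from the integral over [a, t], with [a] to the left of the point and of 0,
    and there the one-sided fundamental theorem applies. *)
Lemma continuous_antiderivative f : continuous f ->
  exists F, forall x, is_derive x (1 : R) F (f x).
Proof.
move=> cf.
pose I a b : R := \int[mu]_(t in `[a, b]) f t.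
have IC a b c : a <= b -> b <= c -> I a c - I a b = I b c.
  move=> ab bc; rewrite /I Rintegral_itvB ?bnd_simp//.
    rewrite Rintegral_itv_obnd_cbnd//; apply: integrableS (continuous_itv_integrable b c cf) => //.
    exact: subset_itv_oc_cc.
  exact: continuous_itv_integrable.
pose F t : R := I 0 t - I t 0.
have I1 a : I a a = 0 by rewrite /I set_itv1 Rintegral_set1.
have I0 a b : b < a -> I a b = 0.
  by move=> ba; rewrite /I set_itv_ge ?Rintegral_set0// bnd_simp -ltNge.
have FE a t : a <= 0 -> a <= t -> F t = I a t - I a 0.
  move=> a0 at_; rewrite /F; have [t0|t0] := leP 0 t.
    rewrite -(IC a 0 t)//; move: t0; rewrite le_eqVlt => /predU1P[<-|t0].
      by rewrite I1 subr0.
    by rewrite (I0 t 0)// subr0.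
  by rewrite -(IC a t 0)//?(ltW t0)// (I0 0 t)// sub0r opprB.
exists F => x.
pose a := Num.min x 0 - 1.
have a0 : a < 0 by rewrite /a ltrBlDr (@le_lt_trans _ _ 0) ?ltr01// ge_min lexx orbT//.
have ax : a < x.
  by rewrite /a ltrBlDr (@le_lt_trans _ _ x) ?ltrDl// ge_min lexx.
apply: (@near_eq_is_derive _ _ _ (fun t => I a t - I a 0)).
  near=> t; apply/esym/FE; first exact: ltW.
  by apply/ltW; near: t; exact: lt_nbhsr.
have [dI dIE] := @continuous_FTC1 R f (BLeft a) x (x + 1) (ltr_pwDr ltr01 (lexx x))
  (continuous_itv_integrable a (x + 1) cf) ax (cf x).
rewrite -[f x]subr0; apply: is_deriveB => //.
by apply: DeriveDef => //; rewrite -derive1E.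
Unshelve. all: by end_near. Qed.

Lemma derive_ge0_le F f a b : a <= b ->
  (forall x, is_derive x (1 : R) F (f x)) ->
  (forall x, a < x < b -> 0 <= f x) -> F a <= F b.
Proof.
move=> ab dF f0; apply: (@ger0_derive1_le_cc _ F a b) => //.
- move=> x; rewrite in_itv/= => xab; rewrite derive1E.
  by have [_ ->] := dF x; exact: f0.
- exact/continuous_subspaceT/(is_derive_continuous dF).
- by rewrite in_itv/= lexx.
- by rewrite in_itv/= lexx ab.
Qed.

(** Both G + F and G - F are nondecreasing. This plays the part of the triangle inequality for
    integrals in the Duhamel estimates. *)
Lemma derive_norm_le F f G g a b : a <= b ->
  (forall x, is_derive x (1 : R) F (f x)) ->
  (forall x, is_derive x (1 : R) G (g x)) ->
  (forall x, a < x < b -> `|f x| <= g x) -> `|F b - F a| <= G b - G a.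
Proof.
move=> ab dF dG fg; rewrite ler_norml; apply/andP; split.
  have : (F + G) a <= (F + G) b.
    apply: (@derive_ge0_le _ (f + g)) => // x.
    by move/fg; rewrite ler_norml => /andP[h _]; rewrite -[_ x]/(f x + g x); lra.
  by rewrite -[_ a]/(F a + G a) -[_ b]/(F b + G b); lra.
have : (G - F) a <= (G - F) b.
  apply: (@derive_ge0_le _ (g - f)) => // x.
  by move/fg; rewrite ler_norml => /andP[_ h]; rewrite -[_ x]/(g x - f x); lra.
by rewrite -[_ a]/(G a - F a) -[_ b]/(G b - F b); lra.
Qed.

End Calculus.

Section DominatedSeries.
Context d (T : measurableType d) {R : realType}.
Variable mu : {measure set T -> \bar R}.

Lemma normal_series_cvg (u a : R^nat) : (forall n, `|u n| <= a n) ->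
  cvgn (series a) -> cvgn (series u).
Proof.
move=> ua ca; apply: normed_cvg; apply: series_le_cvg ca => //= n.
by rewrite (le_trans _ (ua n)).
Qed.

Lemma normal_series_le (u a : R^nat) : (forall n, `|u n| <= a n) ->
  cvgn (series a) -> `|limn (series u)| <= limn (series a).
Proof.
move=> ua ca.
have cu : cvgn [normed series u].
  by apply: series_le_cvg ca => //= n; rewrite (le_trans _ (ua n)).
by rewrite (le_trans (lim_series_norm cu))// lim_series_le.
Qed.

Lemma partial_sum_le_series (a : R^nat) n : (forall n, 0 <= a n) ->
  cvgn (series a) -> series a n <= limn (series a).
Proof.
move=> a0 ca; apply: nondecreasing_cvgn_le => //.
by apply/nondecreasing_seqP => k; rewrite /series/= big_nat_recr//= lerDl.
Qed.

(** The majorant separates: every partial sum is dominated by [limn (series a) * g], so dominated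
    convergence exchanges series and integral. All termwise integrations below, in space and in
    time, go through this form. *)
Lemma Rintegral_series (D : set T) (f : (T -> R)^nat) (a : R^nat) (g : T -> R) :
  measurable D -> (forall n, measurable_fun D (f n)) ->
  mu.-integrable D (EFin \o g) ->
  (forall n x, D x -> `|f n x| <= a n * g x) ->
  cvgn (series a) ->
  mu.-integrable D (EFin \o (fun x => limn (series (f ^~ x)))) /\
  series (fun n => \int[mu]_(x in D) f n x) @ \oo -->
    \int[mu]_(x in D) limn (series (f ^~ x)).
Proof.
move=> mD mf ig fag ca.
have cf x : D x -> cvgn (series (f ^~ x)).
  move=> Dx; apply: (@normal_series_cvg _ (fun n => a n * g x)) => [n|].
    exact: fag.
  have -> : (fun n => a n * g x) = (g x *: a).
    by apply/funext => n; rewrite mulrC.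
  exact: is_cvg_seriesZ.
have msf n : measurable_fun D (fun x => series (f ^~ x) n).
  exact: measurable_sum.
have mlim : measurable_fun D (fun x => limn (series (f ^~ x))).
  by apply: (measurable_fun_cvg (h := fun n x => series (f ^~ x) n)) => // x /cf.
have agi n : mu.-integrable D (EFin \o (fun x => a n * g x)).
  exact: (integrableZl mD (a n) ig).
have gi n : mu.-integrable D (EFin \o f n).
  apply: (le_integrable mD _ _ (agi n)); first exact/measurable_EFinP.
  by move=> x Dx /=; rewrite lee_fin (le_trans (fag n x Dx))// ler_norm.
have ag0 n x : D x -> 0 <= a n * g x by move=> Dx; rewrite (le_trans _ (fag n x Dx)).
have cag x : cvgn (series (fun n => a n * g x)) /\
    limn (series (fun n => a n * g x)) = limn (series a) * g x.
  have -> : (fun n => a n * g x) = (g x *: a).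
    by apply/funext => n; rewrite mulrC.
  split; first exact: is_cvg_seriesZ.
  by rewrite lim_seriesZ// -[LHS]/(g x * _) mulrC.
have [] := @dominated_convergence _ _ _ mu D mD
  (fun n => EFin \o (fun x => series (f ^~ x) n))
  (EFin \o (fun x => limn (series (f ^~ x))))
  (fun x => (limn (series a) * g x)%:E).
- by move=> n; exact/measurable_EFinP.
- exact/measurable_EFinP.
- by apply: aeW => x Dx; apply: cvg_EFin; [exact: nearW|exact: cf].
- by have := integrableZl mD (limn (series a)) ig.
- apply: aeW => x n Dx; rewrite lee_fin -(cag x).2.
  rewrite (@le_trans _ _ (series (fun n => a n * g x) n))//.
    by rewrite (le_trans (ler_norm_sum _ _ _))// ler_sum// => i _; exact: fag.
  by apply: partial_sum_le_series => [k|]; [exact: ag0|exact: (cag x).1].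
move=> iL _ cI; split => //.
have -> : series (fun n => \int[mu]_(x in D) f n x) =
    fine \o (fun n => \int[mu]_(x in D) (series (f ^~ x) n)%:E)%E.
  apply/funext => n /=; rewrite /series/=.
  under eq_integral do rewrite -sumEFin.
  rewrite integral_sum// sum_fine// => i _.
  exact: (integrable_fin_num mD (gi i)).
apply: fine_cvg; rewrite fineK//; exact: integrable_fin_num.
Qed.
End DominatedSeries.

(** * The triangular system for the Fourier modes *)

Section Powers.
Context {R : realType}.
Implicit Types (x y a r s : R).

Lemma powRDp x r s : 0 < x -> x `^ (r + s) = x `^ r * x `^ s.
Proof. by move=> x0; rewrite powRD// (gt_eqF x0) implybT. Qed.

Lemma le_powR_gt0 a x y : 0 <= a -> 0 < x -> x <= y -> x `^ a <= y `^ a.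
Proof.
move=> a0 x0 xy; apply: ge0_ler_powR => //; rewrite nnegrE ltW//.
exact: lt_le_trans xy.
Qed.

Lemma le_powRN_gt0 a x y : a <= 0 -> 0 < x -> x <= y -> y `^ a <= x `^ a.
Proof.
move=> a0 x0 xy; rewrite -[a]opprK !(powRN _ (- a)) lef_pV2 ?posrE ?powR_gt0//.
  by apply: le_powR_gt0; rewrite ?oppr_ge0.
exact: lt_le_trans xy.
Qed.

(** Each term is compared with an increment of k^a, and the increments telescope. *)
Lemma sum_powR_le a : 0 < a -> exists2 C : R, 0 < C & forall k : nat,
  \sum_(1 <= l < k) (l%:R : R) `^ (a - 1) <= C * k%:R `^ a.
Proof.
move=> a0.
have [C C0 HC] : exists2 C : R, 0 < C & forall k : nat,
    (k.+1%:R : R) `^ (a - 1) <= C * (k.+1%:R `^ a - k%:R `^ a).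
  have [a1|a1] := leP 1 a.
    exists 1 => // k; rewrite mul1r.
    have e x : 0 <= x -> x `^ a = x * x `^ (a - 1).
      by move=> x0; rewrite mulr_powRB1.
    rewrite !e//; have : (k%:R : R) `^ (a - 1) <= k.+1%:R `^ (a - 1).
      apply: ge0_ler_powR; rewrite ?nnegrE ?subr_ge0//.
      by rewrite ler_nat.
    have := ler0n R k; rewrite -natr1.
    set p := _ `^ _; set q := _ `^ _; nra.
  (* With u = 1/(k + 1), (1 - u)^a <= exp(- a u) <= 1 - a u / 2, the last bound because 0 < a u <=
     1. The increment is therefore at least a/2 times the term. *)
  exists (2 / a); first by rewrite divr_gt0.
  move=> k; set u : R := (k.+1%:R)^-1.
  have u0 : 0 < u by rewrite invr_gt0.
  have u1 : u <= 1 by rewrite invf_le1// ler1n.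
  have au1 : a * u <= 1.
    by rewrite (le_trans _ u1)// ler_piMl// ltW.
  have ku : k%:R = k.+1%:R * (1 - u) :> R.
    by rewrite mulrBr mulr1 divff// -natr1 addrK.
  have -> : k%:R `^ a = k.+1%:R `^ a * (1 - u) `^ a :> R.
    by rewrite ku powRM// subr_ge0.
  have -> : (k.+1%:R : R) `^ (a - 1) = k.+1%:R `^ a * u.
    by rewrite powRDp// powR_inv1.
  have h1 : (1 - u) `^ a <= expR (- (a * u)).
    rewrite (@le_trans _ _ (expR (- u) `^ a))//.
      apply: ge0_ler_powR; rewrite ?nnegrE ?subr_ge0// ?expR_ge0 ?(ltW a0)//.
      exact: expR_ge1Dx.
    by rewrite -expRM -mulNr mulrC mulrN mulNr.
  have h2 : expR (- (a * u)) <= 1 - a * u / 2.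
    have h3 := expR_ge1Dx (a * u).
    rewrite expRN -div1r ler_pdivrMr ?expR_gt0//.
    have : 0 < a * u by rewrite mulr_gt0.
    move: au1 h3; set z := a * u; set E := expR z => *.
    have : (1 - z / 2) * (1 + z) <= (1 - z / 2) * E by apply: ler_wpM2l; lra.
    by nra.
  have h4 : u <= 2 / a * (1 - (1 - u) `^ a).
    rewrite -ler_pdivrMl ?divr_gt0// invf_div.
    by move: (le_trans h1 h2); nra.
  rewrite -[X in _ * (X - _)]mulr1 -mulrBr mulrCA ler_wpM2l ?powR_ge0//.
exists C => // k.
suff H n : \sum_(1 <= l < n.+1) (l%:R : R) `^ (a - 1) <= C * n%:R `^ a.
  case: k => [|k]; first by rewrite big_geq// mulr_ge0 ?powR_ge0// ltW.
  rewrite (le_trans (H k))// ler_wpM2l ?(ltW C0)//.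
  by apply: ge0_ler_powR; rewrite ?nnegrE ?(ltW a0)// ler_nat.
elim: n => [|n IH]; first by rewrite big_geq// mulr_ge0 ?powR_ge0// ltW.
by rewrite big_nat_recr//=; have := HC n; rewrite mulrBr; lra.
Qed.
End Powers.

(** * The majorant sequence in Kato's weighted norm *)

Section Majorant.
Context {R : realType}.
Implicit Types (x y a r s alpha K : R) (u A : nat -> R).

Lemma ler_sqr_ge0 x y : 0 <= x -> x <= y -> x ^+ 2 <= y ^+ 2.
Proof. by move=> x0 xy; nra. Qed.

Lemma sum_CauchySchwarz (I : Type) (r : seq I) (a b : I -> R) :
  (\sum_(i <- r) a i * b i) ^+ 2 <=
  (\sum_(i <- r) a i ^+ 2) * (\sum_(i <- r) b i ^+ 2).
Proof.
set S := \sum_(i <- r) a i * b i; set A := \sum_(i <- r) a i ^+ 2.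
set B := \sum_(i <- r) b i ^+ 2.
have H t : 0 <= A - 2 * t * S + t ^+ 2 * B.
  have -> : A - 2 * t * S + t ^+ 2 * B = \sum_(i <- r) (a i - t * b i) ^+ 2.
    rewrite !mulr_sumr -sumrB -big_split/=; apply: eq_bigr => i _; ring.
  by apply: sumr_ge0 => i _; exact: sqr_ge0.
have B0 : 0 <= B by apply: sumr_ge0 => i _; exact: sqr_ge0.
move: B0; rewrite le_eqVlt => /predU1P[B0|B0].
  have [S0|S0] := eqVneq S 0.
    by rewrite S0 expr0n -B0 mulr0.
  (* For [B = 0] the quadratic is affine in t, and this choice of t would make it equal to -1. *)
  have := H ((A + 1) / (2 * S)); rewrite -B0 mulr0 addr0.
  by have -> : 2 * ((A + 1) / (2 * S)) * S = A + 1; [field; rewrite ?S0 ?pnatr_eq0 | lra].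
have := H (S / B).
have -> : A - 2 * (S / B) * S + (S / B) ^+ 2 * B = (A * B - S ^+ 2) / B.
  by field; rewrite gt_eqF.
by rewrite pmulr_lge0 ?invr_gt0// subr_ge0.
Qed.

(** The pairs (l, k - l) with k <= N form a triangle inside the square [1, N)^2. The range drops
    from k <= N on the left to k < N on the right, which is what lets [majorant_bound] proceed by
    induction on the truncation. *)
Lemma sum_conv_le u N : (forall k, 0 <= u k) ->
  \sum_(1 <= k < N.+1) \sum_(1 <= l < k) u l * u (k - l)%N <=
  (\sum_(1 <= k < N) u k) ^+ 2.
Proof.
move=> u0.
have -> : \sum_(1 <= k < N.+1) \sum_(1 <= l < k) u l * u (k - l)%N =
  \sum_(1 <= k < N.+1) \sum_(1 <= l < N | (l < k)%N) u l * u (k - l)%N.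
  apply: eq_big_nat => k /andP[k1 kN].
  by rewrite (big_nat_widen _ _ N)//; apply: eq_bigl.
rewrite (exchange_big_dep_nat predT)//= expr2 mulr_suml ler_sum_nat// => l /andP[l1 lN].
rewrite -mulr_sumr ler_wpM2l//.
have -> : \sum_(1 <= k < N.+1 | (l < k)%N) u (k - l)%N =
    \sum_(1 + l <= k < N.+1) u (k - l)%N.
  by rewrite [RHS](@big_nat_widenl _ _ _ _ 1)//; apply: eq_bigl.
rewrite big_addn; under eq_bigr do rewrite addnK.
rewrite [leRHS](@big_cat_nat _ _ _ (N.+1 - l))/=; last 2 first.
- by rewrite subn_gt0 ltnS ltnW.
- by rewrite leq_subLR; lia.
by rewrite lerDl sumr_ge0.
Qed.

(** A discrete Beta integral. The larger of l and k - l lies between k/2 and k, so its power is at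
    most 2 k^(a - 1) whatever the sign of a - 1, as 2^(1 - a) <= 2. What remains is a single sum, up
    to the reflection of l into k - l. *)
Lemma conv_powR_le a : 0 < a -> exists2 C : R, 0 < C & forall k : nat,
  \sum_(1 <= l < k) ((l%:R : R) * (k - l)%:R) `^ (a - 1) <= C * k%:R `^ (2 * a - 1).
Proof.
move=> a0; have [C C0 HC] := sum_powR_le a0.
exists (4 * C); first by rewrite mulr_gt0.
move=> k; have [k0|k0] := leqP k 0.
  by rewrite big_geq ?(leq_trans k0)// mulr_ge0 ?powR_ge0// mulr_ge0 ?ltW.
have half x y : 0 < y -> y <= x -> x `^ (a - 1) <= 2 * (x + y) `^ (a - 1).
  move=> y0 yx; have x0 := lt_le_trans y0 yx.
  have [a1|a1] := leP 1 a.
    have : x `^ (a - 1) <= (x + y) `^ (a - 1).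
      by apply: le_powR_gt0; lra.
    by have := powR_ge0 (x + y) (a - 1); lra.
  have : x `^ (a - 1) <= ((x + y) / 2) `^ (a - 1).
    by apply: le_powRN_gt0; lra.
  rewrite powRM//; last by lra.
  move=> /le_trans; apply; rewrite mulrC ler_wpM2r ?powR_ge0//.
  rewrite -[2^-1]powR_inv1// -powRrM mulN1r -[leRHS]powRr1//.
  by apply: ler_powR; lra.
have sym (l : nat) : (1 <= l < k)%N -> ((l%:R : R) * (k - l)%:R) `^ (a - 1) <=
    2 * k%:R `^ (a - 1) * (l%:R `^ (a - 1) + (k - l)%:R `^ (a - 1)).
  move=> /andP[l1 lk]; rewrite powRM//.
  have kE : k%:R = l%:R + (k - l)%:R :> R by rewrite -natrD subnKC// ltnW.
  have l0 : 0 < (l%:R : R) by rewrite ltr0n.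
  have m0 : 0 < ((k - l)%:R : R) by rewrite ltr0n subn_gt0.
  have [lm|/ltW ml] := leP (l%:R : R) (k - l)%:R.
    have := half _ _ l0 lm; rewrite [_ + l%:R]addrC -kE.
    have := powR_gt0 (a - 1) l0; have := powR_gt0 (a - 1) m0.
    have := powR_ge0 (k%:R : R) (a - 1).
    set p := _ `^ _; set q := _ `^ _; set r := _ `^ _; nra.
  have := half _ _ m0 ml; rewrite -kE.
  have := powR_gt0 (a - 1) l0; have := powR_gt0 (a - 1) m0.
  have := powR_ge0 (k%:R : R) (a - 1).
  set p := _ `^ _; set q := _ `^ _; set r := _ `^ _; nra.
rewrite (le_trans (ler_sum_nat sym))// -mulr_sumr big_split/=.
have -> : \sum_(1 <= l < k) ((k - l)%:R : R) `^ (a - 1) =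
    \sum_(1 <= l < k) (l%:R : R) `^ (a - 1).
  rewrite [RHS]big_nat_rev/=; apply: eq_big_nat => l /andP[l1 lk].
  by rewrite add1n subSS.
have -> : 2 * a - 1 = (a - 1) + a by ring.
rewrite (powRDp (a - 1) a) ?ltr0n//.
have := HC k; have := powR_ge0 (k%:R : R) (a - 1).
set p := _ `^ _; set q := k%:R `^ a; set S := \sum_(_ <= _ < _) _.
by move=> p0 h; have := ler_wpM2l p0 h; lra.
Qed.

(* The weight is that of Kato's norm: with [K = T^(-1/alpha)] it compares with
   [T^((alpha-1)/(2 alpha)) k^(s + (alpha-1)/2)] below frequency [K] and with
   [k^s], [s = 5/2 - alpha], above. *)
Definition kato_weight alpha K (k : nat) : R :=
  k%:R `^ (2 - alpha / 2) * (k%:R + K) `^ (- ((alpha - 1) / 2)).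

Definition mode_conv A (k : nat) : R :=
  \sum_(1 <= l < k) l%:R * (k - l)%:R * (A l * A (k - l)%N).

Lemma kato_weight_ge0 alpha K k : 0 <= kato_weight alpha K k.
Proof. by rewrite mulr_ge0 ?powR_ge0. Qed.

(** The split l (k - l) = (l (k - l))^(alpha/2 - 1) (l (k - l))^(2 - alpha/2) supplies the
    polynomial parts of the two weights on the right. As l and k - l are at most k, their decreasing
    factors dominate the one at k. The excess k^((alpha + 1)/2) is absorbed by the gain (k + K)^(-
    alpha). *)
Lemma kato_weight_kernel alpha K (k l : nat) : 1 < alpha -> 0 <= K ->
  (1 <= l < k)%N ->
  kato_weight alpha K k * (k%:R + K) `^ (- alpha) * (l%:R * (k - l)%:R) <=
  k%:R `^ (3 / 2 - alpha) * (l%:R * (k - l)%:R) `^ (alpha / 2 - 1) *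
  (kato_weight alpha K l * kato_weight alpha K (k - l)).
Proof.
move=> a1 K0 /andP[l1 lk]; rewrite /kato_weight.
have : k%:R = l%:R + (k - l)%:R :> R by rewrite -natrD subnKC// ltnW.
have : 0 < (l%:R : R) by rewrite ltr0n.
have : 0 < ((k - l)%:R : R) by rewrite ltr0n subn_gt0.
move: (k%:R : R) ((k - l)%:R : R) (l%:R : R) => k' m' l' m0 l0 kE.
have k0 : 0 < k' by rewrite kE addr_gt0.
set g := (alpha - 1) / 2.
rewrite powRM ?(ltW l0) ?(ltW m0)//.
have split1 x : 0 < x -> x = x `^ (alpha / 2 - 1) * x `^ (2 - alpha / 2).
  move=> x0; rewrite -powRDp//.
  have -> : alpha / 2 - 1 + (2 - alpha / 2) = 1 by ring.
  by rewrite powRr1 ?ltW.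
set P := l' `^ _; set P' := l' `^ _; set Q := m' `^ _; set Q' := m' `^ _.
set L := (l' + K) `^ _; set M := (m' + K) `^ _.
have -> : l' * m' = P * P' * (Q * Q').
  by rewrite [in LHS](split1 _ l0) [in LHS](split1 _ m0).
have P0 : 0 < P by exact: powR_gt0.
have P'0 : 0 < P' by exact: powR_gt0.
have Q0 : 0 < Q by exact: powR_gt0.
have Q'0 : 0 < Q' by exact: powR_gt0.
have L0 : (k' + K) `^ (- g) <= L.
  by apply: le_powRN_gt0; rewrite /g; lra.
have M0 : (k' + K) `^ (- g) <= M.
  by apply: le_powRN_gt0; rewrite /g; lra.
suff H : k' `^ (2 - alpha / 2) * (k' + K) `^ (- g) * (k' + K) `^ (- alpha) <=
    k' `^ (3 / 2 - alpha) * (L * M).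
  have PQ : 0 <= P * P' * (Q * Q') by rewrite !mulr_ge0 ?ltW.
  by have := ler_wpM2r PQ H; lra.
have kK : 0 < k' + K by lra.
apply: (@le_trans _ _ (k' `^ (3 / 2 - alpha) *
    ((k' + K) `^ (- g) * (k' + K) `^ (- g)))); last first.
  by rewrite ler_wpM2l ?powR_ge0// ler_pM ?powR_ge0.
rewrite -mulrA -!powRDp//.
have -> : 2 - alpha / 2 = (3 / 2 - alpha) + (alpha - g) by rewrite /g; field.
rewrite (powRDp (3 / 2 - alpha) (alpha - g))// -mulrA ler_wpM2l ?powR_ge0//.
have -> : - g - g = (alpha - g) + (- g - alpha) by ring.
rewrite (powRDp (alpha - g) (- g - alpha))// ler_wpM2r ?powR_ge0//.
by apply: le_powR_gt0; rewrite /g; lra.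
Qed.

(** Put x_k = W_k A_k. Cauchy-Schwarz against the kernel (l (k - l))^(alpha/2 - 1) bounds the square
    of the weighted convolution by C times the convolution of x^2 with itself. The partial sums S_N
    of x_k^2 then satisfy S_(N+1) <= 2 Y + 2 C M^2 S_N^2, and S_N <= 4 Y is stable as soon as 32 C
    M^2 Y^2 <= 2 Y; hence the constants 16 and 4. *)
Lemma majorant_bound alpha : 1 < alpha -> exists2 C : R, 0 < C &
  forall K A (y : nat -> R) (M Y : R), 0 <= K -> (forall k, 0 <= A k) ->
  0 <= M -> (forall k, (0 < k)%N ->
    A k <= y k + M * (k%:R + K) `^ (- alpha) * mode_conv A k) ->
  (forall N, \sum_(1 <= k < N) (kato_weight alpha K k * y k) ^+ 2 <= Y) ->
  16 * C * M ^+ 2 * Y <= 1 ->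
  forall N, \sum_(1 <= k < N) (kato_weight alpha K k * A k) ^+ 2 <= 4 * Y.
Proof.
move=> a1; have am1 : 0 < alpha - 1 by rewrite subr_gt0.
have [C C0 HC] := conv_powR_le am1.
exists C => // K A y M Y K0 A0 M0 Ay yY small.
set W := kato_weight alpha K; pose x k := W k * A k.
have x0 k : 0 <= x k by rewrite mulr_ge0 ?kato_weight_ge0.
have Y0 : 0 <= Y by have := yY 0%N; rewrite big_geq.
pose G k := W k * (k%:R + K) `^ (- alpha) * mode_conv A k.
have G0 k : 0 <= G k.
  rewrite !mulr_ge0 ?kato_weight_ge0 ?powR_ge0// /mode_conv sumr_ge0// => l _.
  by rewrite !mulr_ge0.
have HG k : (0 < k)%N ->
    G k ^+ 2 <= C * \sum_(1 <= l < k) x l ^+ 2 * x (k - l)%N ^+ 2.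
  move=> k0; have k0' : 0 < (k%:R : R) by rewrite ltr0n.
  pose c l : R := (l%:R * (k - l)%:R) `^ (alpha / 2 - 1).
  have h1 : G k <= k%:R `^ (3 / 2 - alpha) *
      \sum_(1 <= l < k) c l * (x l * x (k - l)%N).
    rewrite /G /mode_conv !mulr_sumr ler_sum_nat// => l lk.
    have := ler_wpM2r (mulr_ge0 (A0 l) (A0 (k - l)%N)) (kato_weight_kernel a1 K0 lk).
    by rewrite -/W /x /c; lra.
  have h2 : G k ^+ 2 <= (k%:R `^ (3 / 2 - alpha)) ^+ 2 *
      (\sum_(1 <= l < k) c l * (x l * x (k - l)%N)) ^+ 2.
    by rewrite -exprMn; exact: ler_sqr_ge0.
  apply: (le_trans h2).
  apply: (le_trans (ler_wpM2l (sqr_ge0 _) (sum_CauchySchwarz _ _ _))).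
  rewrite mulrA.
  under [X in _ * X <= _]eq_bigr do rewrite exprMn.
  apply: ler_wpM2r.
    by apply: sumr_ge0 => l _; rewrite mulr_ge0 ?sqr_ge0.
  have -> : \sum_(1 <= l < k) c l ^+ 2 =
      \sum_(1 <= l < k) ((l%:R : R) * (k - l)%:R) `^ ((alpha - 1) - 1).
    apply: eq_big_nat => l /andP[l1 lk].
    rewrite /c expr2 -powRDp ?mulr_gt0 ?ltr0n ?subn_gt0//.
    by congr (_ `^ _); field.
  rewrite expr2 -powRDp//.
  apply: (le_trans (ler_wpM2l (powR_ge0 _ _) (HC k))).
  rewrite mulrCA -powRDp//.
  (* The total power of k is exactly 0. This is criticality: the estimate has no exponent to
     spare. *)
  have -> : 3 / 2 - alpha + (3 / 2 - alpha) + (2 * (alpha - 1) - 1) = 0.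
    by field.
  by rewrite powRr0 mulr1.
elim=> [|N IH]; first by rewrite big_geq// mulr_ge0.
have h3 : \sum_(1 <= k < N.+1) x k ^+ 2 <=
    2 * \sum_(1 <= k < N.+1) (W k * y k) ^+ 2 +
    2 * M ^+ 2 * C * (\sum_(1 <= k < N) x k ^+ 2) ^+ 2.
  have cv := sum_conv_le N (fun k => sqr_ge0 (x k)).
  rewrite -(ler_pM2l C0) mulr_sumr in cv.
  apply: (@le_trans _ _ (2 * \sum_(1 <= k < N.+1) (W k * y k) ^+ 2 +
     2 * M ^+ 2 * \sum_(1 <= k < N.+1) G k ^+ 2)).
    rewrite !mulr_sumr -big_split/= ler_sum_nat// => k /andP[k1 kN].
    have : x k <= W k * y k + M * G k.
      rewrite /x (le_trans (ler_wpM2l (kato_weight_ge0 _ _ _) (Ay k k1)))//.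
      rewrite le_eqVlt; apply/orP; left; apply/eqP; rewrite /G /W; ring.
    move: (x0 k); move: (x k) (W k * y k) (G k) => p q r p0 pq.
    have : p ^+ 2 <= (q + M * r) ^+ 2.
      exact: ler_sqr_ge0.
    by have := sqr_ge0 (q - M * r); lra.
  rewrite lerD2l -[leRHS]mulrA ler_wpM2l ?mulr_ge0 ?sqr_ge0//.
  apply: le_trans cv; rewrite ler_sum_nat// => k /andP[k1 kN].
  exact: HG.
apply: (le_trans h3).
have := yY N.+1; rewrite -/W => hy.
have S0 : 0 <= \sum_(1 <= k < N) x k ^+ 2 by apply: sumr_ge0 => k _; exact: sqr_ge0.
have hS : (\sum_(1 <= k < N) x k ^+ 2) ^+ 2 <= (4 * Y) ^+ 2.
  exact: ler_sqr_ge0.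
have MC : 0 <= 2 * M ^+ 2 * C by rewrite !mulr_ge0 ?sqr_ge0// ltW.
have := ler_wpM2l MC hS.
by have := ler_wpM2r Y0 small; lra.
Qed.

End Majorant.

(** * Smallness of the weighted data, and solvability of the triangular system *)

Section Modes.
Context {R : realType}.
Local Notation mu := (@lebesgue_measure R).
Implicit Types (x y t nu alpha K : R) (u A : nat -> R).

(** A ratio in (0, 1] is at most its power theta; the two ratios x / (x + y) and y / (x + y) add up
    to 1. *)
Lemma powR_subadd (theta : R) x y : 0 < theta <= 1 -> 0 <= x -> 0 <= y ->
  (x + y) `^ theta <= x `^ theta + y `^ theta.
Proof.
move=> /andP[th0 th1]; rewrite le_eqVlt => /predU1P[<-|x0].
  by rewrite add0r lerDr powR_ge0.
rewrite le_eqVlt => /predU1P[<-|y0].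
  by rewrite addr0 lerDl powR_ge0.
have z0 : 0 < x + y by rewrite addr_gt0.
have H w : 0 < w -> w <= x + y -> (x + y) `^ theta * (w / (x + y)) <= w `^ theta.
  move=> w0 wz; have -> : w `^ theta = (x + y) `^ theta * (w / (x + y)) `^ theta.
    rewrite -powRM ?divr_ge0 ?(ltW z0) ?(ltW w0)//.
    by rewrite mulrCA divff ?gt_eqF// mulr1.
  rewrite ler_wpM2l ?powR_ge0//; apply: ger1_powR => //.
  by rewrite divr_gt0//= ler_pdivrMr// mul1r.
have hx := H x x0; have hy := H y y0.
have -> : (x + y) `^ theta = (x + y) `^ theta * (x / (x + y)) + (x + y) `^ theta * (y / (x + y)).
  by field; rewrite gt_eqF.
by rewrite lerD ?hx ?hy ?lerDl ?lerDr ?ltW.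
Qed.

(** The terms are (k / (k + K))^(2 g) u_k, with u_k the summable H^s energies: the factor is at most
    1 and small for bounded k when K is large. The tail beyond [N0] costs e/2 by summability, the
    head costs e/2 by the choice of K. This is the only source of smallness in the proof. *)
Lemma kato_weight_tendsto0 alpha (y : nat -> R) (Z : R) : 1 < alpha ->
  (forall N, \sum_(1 <= k < N) (k%:R `^ (5 / 2 - alpha) * y k) ^+ 2 <= Z) ->
  forall e, 0 < e -> exists2 K : R, 0 < K &
    forall N, \sum_(1 <= k < N) (kato_weight alpha K k * y k) ^+ 2 <= e.
Proof.
move=> a1 yZ e e0; pose g := (alpha - 1) / 2.
have g0 : 0 < g by rewrite /g; lra.
pose u k := if k is 0%N then 0 else (k%:R `^ (5 / 2 - alpha) * y k) ^+ 2 : R.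
have u0 k : 0 <= u k by case: k => [|k]//=; exact: sqr_ge0.
have usum N : series u N <= Z.
  case: N => [|N]; first by rewrite /series/= big_geq//; have := yZ 0%N; rewrite big_geq.
  rewrite /series/= big_nat_recl//= add0r.
  by have := yZ N.+1; rewrite big_add1.
have Z0 : 0 <= Z by have := yZ 0%N; rewrite big_geq.
have nd : nondecreasing_seq (series u).
  by apply/nondecreasing_seqP => k; rewrite /series/= big_nat_recr//= lerDl.
have cu : cvgn (series u).
  by apply: nondecreasing_is_cvgn => //; exists Z => _ [n _ <-].
have e2 : 0 < e / 2 by rewrite divr_gt0.
have /cvgrPdist_le/(_ _ e2)[N0 _ HN0] : series u @ \oo --> limn (series u) := cu.
pose d := Num.min 1 (e / (2 * (Z + 1))).
have d0 : 0 < d by rewrite lt_min ltr01 divr_gt0// mulr_gt0// ltr_wpDl.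
(* For k <= N0 this gives k / (k + K) <= d^(1/(2 g)), hence a factor at most [d], and [d] times the
   total energy is at most e/2. *)
pose K := (N0.+1%:R : R) * d `^ (- (2 * g)^-1).
have K0 : 0 < K by rewrite mulr_gt0 ?powR_gt0.
exists K => // N.
have WE k : (0 < k)%N -> (kato_weight alpha K k * y k) ^+ 2 =
    (k%:R / (k%:R + K)) `^ (2 * g) * u k.
  case: k => // k _; have k0 : 0 < (k.+1%:R : R) by rewrite ltr0n.
  rewrite /u /kato_weight -/g; move: (k.+1%:R : R) k0 => x x0.
  have xK : 0 < x + K by rewrite addr_gt0.
  have -> : 2 - alpha / 2 = (5 / 2 - alpha) + g by rewrite /g; field.
  rewrite (powRDp _ g)// [2 * g]mulrDl !mul1r (powRDp g g) ?divr_gt0//.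
  rewrite powRM ?invr_ge0 ?(ltW x0) ?(ltW xK)//.
  by rewrite -(powR_inv1 (ltW xK)) -powRrM mulN1r; ring.
have ratio k : 0 <= (k%:R : R) / (k%:R + K) <= 1.
  have k0 : 0 <= (k%:R : R) by rewrite ler0n.
  rewrite divr_ge0 ?addr_ge0 ?(ltW K0)//= ler_pdivrMr ?ltr_wpDl//.
  by rewrite mul1r lerDl ltW.
have b1 k : (k%:R / (k%:R + K)) `^ (2 * g) <= 1 :> R.
  have /andP[r0 r1] := ratio k; rewrite [leRHS](_ : 1 = 1 `^ (2 * g)); last by rewrite powR1.
  by apply: ge0_ler_powR; rewrite ?nnegrE//; rewrite mulr_ge0 ?(ltW g0).
have b2 k : (k <= N0)%N -> (k%:R / (k%:R + K)) `^ (2 * g) <= d :> R.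
  move=> kN; have /andP[r0 r1] := ratio k.
  have -> : d = (d `^ ((2 * g)^-1)) `^ (2 * g).
    by rewrite -powRrM mulVf ?powRr1 ?(ltW d0)// mulf_neq0// gt_eqF.
  apply: ge0_ler_powR; rewrite ?nnegrE ?powR_ge0//.
    by rewrite mulr_ge0 ?(ltW g0).
  rewrite ler_pdivrMr ?ltr_wpDl//.
  apply: (@le_trans _ _ (d `^ ((2 * g)^-1) * K)); last first.
    by rewrite ler_wpM2l ?powR_ge0// lerDr.
  rewrite /K mulrCA -powRDp// subrr powRr0 mulr1 ler_nat.
  exact: leqW.
apply: (@le_trans _ _ (\sum_(1 <= k < maxn N N0.+1) (kato_weight alpha K k * y k) ^+ 2)).
  rewrite [leRHS](@big_cat_nat _ _ _ (maxn N 1))/=; last 2 first.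
  - by rewrite leq_max leqnn orbT.
  - by rewrite geq_max leq_maxl/= leq_max orbT.
  case: N => [|N]; first by rewrite big_geq// addr_ge0// sumr_ge0// => k _; exact: sqr_ge0.
  rewrite (maxn_idPl _)// lerDl sumr_ge0// => k _; exact: sqr_ge0.
set N' := maxn N N0.+1.
rewrite (@big_cat_nat _ _ _ N0.+1)//=; last by rewrite leq_max leqnn orbT.
have -> : e = e / 2 + e / 2 by field.
apply: lerD.
  apply: (@le_trans _ _ (d * series u N0.+1)).
    rewrite /series/= [X in _ <= _ * X]big_nat_recl//= add0r mulr_sumr big_add1/= ler_sum_nat// => k /andP[_ kN].
    by rewrite WE// ler_wpM2r//; exact: b2.
  apply: (@le_trans _ _ (d * (Z + 1))).
    by rewrite ler_wpM2l ?(ltW d0)// (le_trans (usum _))// lerDl.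
  rewrite -ler_pdivlMr ?ltr_wpDl// /d ge_min; apply/orP; right.
  by rewrite le_eqVlt; apply/orP; left; apply/eqP; field; lra.
apply: (@le_trans _ _ (\sum_(N0.+1 <= k < N') u k)).
  rewrite ler_sum_nat// => k /andP[kN _]; rewrite WE ?(leq_trans _ kN)//.
  by rewrite ler_piMl.
have NN' : (N0.+1 <= N')%N by rewrite leq_max leqnn orbT.
have -> : \sum_(N0.+1 <= k < N') u k = series u N' - series u N0.+1.
  by rewrite sub_series_geq.
have := HN0 N0.+1 (leqnSn _); rewrite ler_norml => /andP[_].
have := nondecreasing_cvgn_le nd cu N'; lra.
Qed.

(** For k >= 1, k + K <= (1 + K) k. This is the way back from Kato's norm to the H^s norm, at the
    price of a constant depending on K. *)
Lemma powR_le_kato_weight alpha K (k : nat) : 1 < alpha -> 0 <= K ->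
  (0 < k)%N ->
  k%:R `^ (5 / 2 - alpha) <= (1 + K) `^ ((alpha - 1) / 2) * kato_weight alpha K k.
Proof.
move=> a1 K0 k0; rewrite /kato_weight; set g := (alpha - 1) / 2.
have k1 : 1 <= (k%:R : R) by rewrite ler1n.
have kp : 0 < (k%:R : R) by rewrite ltr0n.
move: (k%:R : R) k1 kp => x x1 x0.
have xK : 0 < x + K by lra.
have -> : 2 - alpha / 2 = (5 / 2 - alpha) + g by rewrite /g; field.
rewrite (powRDp _ g)// -mulrA mulrCA -[leLHS]mulr1 ler_wpM2l ?powR_ge0//.
have : (x + K) `^ g <= (1 + K) `^ g * x `^ g.
  rewrite -powRM//; [|lra|lra].
  by apply: le_powR_gt0; rewrite /g; nra.
rewrite powRN mulrA ler_pdivlMr ?powR_gt0// mul1r mulrC; lra.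
Qed.

(** The value of [iter n F] at k no longer depends on n once n > k, so the diagonal is a fixed
    point. It produces both the modes and the majorant [A]. *)
Lemma strong_recursion (X : Type) (x0 : X) (F : (nat -> X) -> nat -> X) :
  (forall f g k, (forall l, (l < k)%N -> f l = g l) -> F f k = F g k) ->
  exists f, forall k, f k = F f k.
Proof.
move=> Fext; pose it n := iter n F (fun=> x0).
have H n m k : (k < n)%N -> (k < m)%N -> it n k = it m k.
  elim: n m k => // n IH [//|m] k kn km /=.
  by apply: Fext => l lk; apply: IH; exact: leq_trans lk _.
exists (fun k => it k.+1 k) => k /=.
by apply: Fext => l lk; exact: (H k l.+1 l lk (ltnSn l)).
Qed.

Lemma is_derive_cmul (c t : R) : is_derive t (1 : R) (fun t => c * t) c.
Proof.
by apply: is_derive_eq; rewrite ?scaler0 /GRing.scale/= ?mulr1 ?mulr0 ?addr0 ?add0r.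
Qed.

Lemma is_derive_expR_cmul (c t : R) :
  is_derive t (1 : R) (fun t => expR (c * t)) (c * expR (c * t)).
Proof.
rewrite mulrC.
exact: (is_derive1_comp (is_derive_expR (c * t)) (is_derive_cmul c t)).
Qed.

(** Variation of constants on the whole line, so that the derivative at t = 0 is two-sided like all
    the others. *)
Lemma linear_ode nu (g : R -> R) y0 : continuous g ->
  exists2 y : R -> R, y 0 = y0 &
    forall t, is_derive t (1 : R) y (- nu * y t + g t).
Proof.
move=> cg.
have ceg : continuous (fun t => expR (nu * t) * g t).
  apply: continuous_mulf cg.
  exact: (is_derive_continuous (is_derive_expR_cmul nu)).
have [G dG] := continuous_antiderivative ceg.
pose y := (fun t => expR (- nu * t)) * (G + cst (y0 - G 0)).
exists y; first by rewrite /y mulrfctE addrfctE/= mulr0 expR0 mul1r addrC subrK.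
move=> t; apply: (is_derive_eq (is_deriveM (is_derive_expR_cmul (- nu) t)
  (is_deriveD (dG t) (is_derive_cst (y0 - G 0) t (1 : R))))).
rewrite /y mulrfctE addrfctE/= /GRing.scale/= addr0.
have EE : expR (- nu * t) * expR (nu * t) = 1.
  by rewrite -expRD mulNr addNr expR0.
change (expR (- nu * t) * (expR (nu * t) * g t) +
  (G t + (y0 - G 0)) * (- nu * expR (- nu * t)) =
  - nu * (expR (- nu * t) * (G t + (y0 - G 0))) + g t).
by rewrite mulrA EE; ring.
Qed.

(** The source of mode k involves only modes strictly below k, so each mode solves a scalar linear
    equation with a known continuous source and exists for all times. Nothing is said here about
    size. *)
Lemma modes_exist (nu : nat -> R) (p0 q0 : nat -> R) :
  exists p q : nat -> R -> R,
  [/\ forall k, p k 0 = p0 k, forall k, q k 0 = q0 k,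
      forall k t, is_derive t (1 : R) (p k) (- nu k * p k t -
        \sum_(1 <= l < k) l%:R * (k - l)%:R *
          (p l t * q (k - l)%N t + q l t * p (k - l)%N t)) &
      forall k t, is_derive t (1 : R) (q k) (- nu k * q k t +
        \sum_(1 <= l < k) l%:R * (k - l)%:R *
          (p l t * p (k - l)%N t - q l t * q (k - l)%N t))].
Proof.
(* The solver is a total function of the source, with a default value where no solution exists. The
   recursion can thus be set up first, and continuity of the sources proved afterwards by strong
   induction. *)
pose sol nu (y0 : R) (g : R -> R) : R -> R := xget (fun=> 0)
  [set y | y 0 = y0 /\ forall t, is_derive t (1 : R) y (- nu * y t + g t)].
have solP nu' y0 g : continuous g -> sol nu' y0 g 0 = y0 /\
    forall t, is_derive t (1 : R) (sol nu' y0 g) (- nu' * sol nu' y0 g t + g t).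
  move=> /(@linear_ode nu' _ y0)[y yy0 dy].
  exact: (@xgetPex _ (fun=> 0) [set y | y 0 = y0 /\ forall t,
    is_derive t (1 : R) y (- nu' * y t + g t)] (ex_intro _ y (conj yy0 dy))).
pose gp (f : nat -> (R -> R) * (R -> R)) k t : R := - \sum_(1 <= l < k) l%:R * (k - l)%:R *
  ((f l).1 t * (f (k - l)%N).2 t + (f l).2 t * (f (k - l)%N).1 t).
pose gq (f : nat -> (R -> R) * (R -> R)) k t : R := \sum_(1 <= l < k) l%:R * (k - l)%:R *
  ((f l).1 t * (f (k - l)%N).1 t - (f l).2 t * (f (k - l)%N).2 t).
pose F f k := (sol (nu k) (p0 k) (gp f k), sol (nu k) (q0 k) (gq f k)).
have [|f fE] := @strong_recursion _ (fun=> 0, fun=> 0) F.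
  move=> f g k fg.
  have fg2 l : (1 <= l < k)%N -> f l = g l /\ f (k - l)%N = g (k - l)%N.
    by move=> /andP[l1 lk]; split; apply: fg; rewrite // ltn_subrL l1 (leq_ltn_trans _ lk).
  congr (sol _ _ _, sol _ _ _); apply/funext => t; rewrite /gp /gq; last first.
    by apply: eq_big_nat => l /fg2[-> ->].
  by congr (- _); apply: eq_big_nat => l /fg2[-> ->].
have cont k : continuous (f k).1 /\ continuous (f k).2.
  elim/ltn_ind: k => k IH.
  have IH2 l : (1 <= l < k)%N -> [/\ continuous (f l).1, continuous (f l).2,
      continuous (f (k - l)%N).1 & continuous (f (k - l)%N).2].
    move=> /andP[l1 lk]; have [c1 c2] := IH l lk.
    have kl : (k - l < k)%N by rewrite ltn_subrL l1 (leq_ltn_trans _ lk).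
    by have [c3 c4] := IH _ kl.
  have cgp : continuous (gp f k).
    apply: continuous_oppf; apply: continuous_sum_nat => l /IH2[c1 c2 c3 c4].
    by apply: continuous_cmulf; apply: continuous_addf; apply: continuous_mulf.
  have cgq : continuous (gq f k).
    apply: continuous_sum_nat => l /IH2[c1 c2 c3 c4].
    apply: continuous_cmulf; apply: continuous_addf; first exact: continuous_mulf.
    by apply: continuous_oppf; exact: continuous_mulf.
  rewrite fE; split; last exact: (is_derive_continuous (solP _ _ _ cgq).2).
  exact: (is_derive_continuous (solP _ _ _ cgp).2).
have cgp k : continuous (gp f k).
  apply: continuous_oppf; apply: continuous_sum_nat => l _.
  apply: continuous_cmulf; apply: continuous_addf; apply: continuous_mulf;
    solve [exact: (cont _).1 | exact: (cont _).2].
have cgq k : continuous (gq f k).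
  apply: continuous_sum_nat => l _; apply: continuous_cmulf; apply: continuous_addf.
    by apply: continuous_mulf; exact: (cont _).1.
  by apply: continuous_oppf; apply: continuous_mulf; exact: (cont _).2.
exists (fun k => (f k).1), (fun k => (f k).2); split => k.
- by rewrite fE; exact: (solP _ _ _ (cgp k)).1.
- by rewrite fE; exact: (solP _ _ _ (cgq k)).1.
- by move=> t; rewrite [f k]fE; exact: (solP _ _ _ (cgp k)).2.
- by move=> t; rewrite [f k]fE; exact: (solP _ _ _ (cgq k)).2.
Qed.

End Modes.

(** * Gevrey bounds on the modes *)

Section ModeEstimates.
Context {R : realType}.
Implicit Types (x y t nu mu alpha K : R) (u A : nat -> R).

(* The exponent [t^(1/alpha)] is the analyticity radius set by the dissipation. *)
Definition gevrey mu alpha t (k : nat) : R :=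
  expR (- (mu / 2 * k%:R * t `^ (alpha^-1))).

Lemma gevrey_gt0 mu alpha t k : 0 < gevrey mu alpha t k.
Proof. exact: expR_gt0. Qed.

Lemma gevrey_split mu alpha t (k l : nat) : (l <= k)%N ->
  gevrey mu alpha t l * gevrey mu alpha t (k - l) = gevrey mu alpha t k.
Proof.
move=> lk; rewrite /gevrey -expRD natrB//; congr expR; ring.
Qed.

Lemma gevrey0 mu alpha k : 1 < alpha -> gevrey mu alpha 0 k = 1.
Proof.
move=> a1; rewrite /gevrey powR0 ?mulr0 ?oppr0 ?expR0//.
by rewrite invr_eq0 gt_eqF// (lt_trans ltr01).
Qed.

(** Subadditivity of the power 1/alpha reduces the left side to u = x (t - r)^(1/alpha), and u <= 1
    + u^alpha. The growth of the analyticity radius between r and t is thus paid by half of the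
    dissipation and a constant factor exp(mu / 2). *)
Lemma gevrey_exponent mu alpha x r t : 0 < mu -> 1 < alpha -> 0 <= x ->
  0 <= r <= t ->
  mu / 2 * x * (t `^ (alpha^-1) - r `^ (alpha^-1)) <=
  mu / 2 + mu / 2 * (x `^ alpha * (t - r)).
Proof.
move=> mu0 a1 x0 /andP[r0 rt].
have a0 : 0 < alpha by rewrite (lt_trans ltr01).
have tr0 : 0 <= t - r by rewrite subr_ge0.
have th : 0 < alpha^-1 <= 1 by rewrite invr_gt0 a0 invf_le1// ltW.
have h1 : t `^ (alpha^-1) - r `^ (alpha^-1) <= (t - r) `^ (alpha^-1).
  by rewrite lerBlDr; have := powR_subadd th tr0 r0; rewrite subrK.
set u := x * (t - r) `^ (alpha^-1).
have u0 : 0 <= u by rewrite mulr_ge0 ?powR_ge0.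
have -> : x `^ alpha * (t - r) = u `^ alpha.
  by rewrite powRM ?powR_ge0// -powRrM mulVf ?gt_eqF// powRr1.
have h2 : u <= 1 + u `^ alpha.
  have [u1|u1] := leP u 1; first by rewrite (le_trans u1)// lerDl powR_ge0.
  by rewrite (le_trans (le1r_powR (ltW u1) (ltW a1)))// lerDr.
have h3 := ler_wpM2l x0 h1.
have m2 : 0 <= mu / 2 by rewrite divr_ge0// ltW.
by have := ler_wpM2l m2 h3; have := ler_wpM2l m2 h2; rewrite -/u; lra.
Qed.

(** A duration bounded both by K^(- alpha) and by the dissipation time 2 / (mu x^alpha) is of order
    (x + K)^(- alpha), since the larger of x and K is at least (x + K) / 2. This is the gain in
    front of the convolution. *)
Lemma min_time_scale mu alpha K x t : 0 < mu -> 1 < alpha -> 0 < K -> 0 < x ->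
  0 <= t <= K `^ (- alpha) ->
  forall z, z <= t -> z <= 2 / (mu * x `^ alpha) ->
  z <= 2 `^ alpha * (1 + 2 / mu) * (x + K) `^ (- alpha).
Proof.
move=> mu0 a1 K0 x0 /andP[t0 tK] z zt zx.
have a0 : 0 < alpha by rewrite (lt_trans ltr01).
have H w : 0 < w -> x + K <= 2 * w -> w `^ (- alpha) <= 2 `^ alpha * (x + K) `^ (- alpha).
  move=> w0 xw.
  have -> : w `^ (- alpha) = 2 `^ alpha * (2 * w) `^ (- alpha).
    by rewrite powRM ?ltW// mulrA -powRDp// subrr powRr0 mul1r.
  by rewrite ler_wpM2l ?powR_ge0//; apply: le_powRN_gt0; lra.
have m0 : 0 < 2 / mu by rewrite divr_gt0.
have P0 : 0 <= 2 `^ alpha * (x + K) `^ (- alpha) by rewrite mulr_ge0 ?powR_ge0.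
have [xK|Kx] := leP x K.
  have : K `^ (- alpha) <= 2 `^ alpha * (x + K) `^ (- alpha) by apply: H; lra.
  by nra.
have h : x `^ (- alpha) <= 2 `^ alpha * (x + K) `^ (- alpha) by apply: H; lra.
have : 2 / (mu * x `^ alpha) = 2 / mu * x `^ (- alpha).
  by rewrite powRN; field; rewrite !gt_eqF ?powR_gt0.
by move: zx => /[swap] ->; have := powR_ge0 x (- alpha); nra.
Qed.

(** With the integrating factor exp(nu r), the derivative of [H] is bounded by that of [G], half of
    the dissipation having been spent on the Gevrey factor. The other half leaves the time integral
    (2 / nu)(1 - exp(- nu t / 2)), at most t and at most 2 / nu, to which [min_time_scale]
    applies. *)
Lemma scalar_mode_bound mu alpha K (k : nat) (y g : R -> R) (S t : R) :
  0 < mu -> 1 < alpha -> 0 < K -> (0 < k)%N -> 0 <= t <= K `^ (- alpha) ->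
  (forall r, is_derive r (1 : R) y (- (mu * k%:R `^ alpha) * y r + g r)) ->
  0 <= S -> (forall r, 0 <= r <= t -> `|g r| <= S * gevrey mu alpha r k) ->
  `|y t| <= (expR (mu / 2) * `|y 0| +
     expR (mu / 2) * (2 `^ alpha * (1 + 2 / mu)) * (k%:R + K) `^ (- alpha) * S) *
     gevrey mu alpha t k.
Proof.
move=> mu0 a1 K0 k0 /[dup] tK /andP[t0 _] dy S0 gS.
set nu := mu * k%:R `^ alpha in dy.
have kp : 0 < (k%:R : R) by rewrite ltr0n.
have nu0 : 0 < nu by rewrite mulr_gt0// powR_gt0.
set M := expR (mu / 2); set w := gevrey mu alpha t k.
have exponent r : 0 <= r <= t -> expR (- nu * (t - r)) * gevrey mu alpha r k <=
    M * w * expR (- (nu / 2) * (t - r)).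
  move=> rt; rewrite /M /w /gevrey -!expRD ler_expR.
  by have := gevrey_exponent mu0 a1 (ltW kp) rt; rewrite /nu; lra.
pose H := (fun r => expR (nu * r)) * y.
have dH r : is_derive r (1 : R) H (expR (nu * r) * g r).
  apply: (is_derive_eq (is_deriveM (is_derive_expR_cmul nu r) (dy r))).
  change (expR (nu * r) * (- nu * y r + g r) + y r * (nu * expR (nu * r)) =
    expR (nu * r) * g r); ring.
pose c := S * M * w * expR (nu / 2 * t).
pose G := (fun r => c * (2 / nu) * expR (nu / 2 * r)).
have dG r : is_derive r (1 : R) G (c * expR (nu / 2 * r)).
  apply: (is_derive_eq (is_deriveM (is_derive_cst (c * (2 / nu)) r (1 : R))
    (is_derive_expR_cmul (nu / 2) r))).
  change (c * (2 / nu) * (nu / 2 * expR (nu / 2 * r)) +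
    expR (nu / 2 * r) * 0 = c * expR (nu / 2 * r)).
  by field; rewrite gt_eqF.
have HG : `|H t - H 0| <= G t - G 0.
  apply: (derive_norm_le t0 dH dG) => r /andP[r0 rt].
  have rt' : 0 <= r <= t by rewrite !ltW.
  rewrite normrM (ger0_norm (expR_ge0 _)).
  have e1 : expR (nu * r) = expR (nu * t) * expR (- nu * (t - r)).
    by rewrite -expRD; congr expR; ring.
  have e2 : c * expR (nu / 2 * r) =
      S * expR (nu * t) * (M * w * expR (- (nu / 2) * (t - r))).
    have -> : expR (nu * t) = expR (nu / 2 * t) * expR (nu / 2 * t).
      by rewrite -expRD; congr expR; field.
    have -> : expR (nu / 2 * r) =
        expR (nu / 2 * t) * expR (- (nu / 2) * (t - r)).
      by rewrite -expRD; congr expR; ring.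
    rewrite /c; ring.
  rewrite e2 e1.
  have h1 := ler_wpM2l (expR_ge0 (nu * r)) (gS r rt').
  have h2 := ler_wpM2l (mulr_ge0 S0 (expR_ge0 (nu * t))) (exponent r rt').
  by move: h1; rewrite e1; lra.
have E1 : expR (- nu * t) * expR (nu * t) = 1.
  by rewrite -expRD mulNr addNr expR0.
have E2 : expR (- (nu / 2) * t) * expR (nu / 2 * t) = 1.
  by rewrite -expRD mulNr addNr expR0.
have E3 : expR (- nu * t) = expR (- (nu / 2) * t) * expR (- (nu / 2) * t).
  by rewrite -expRD; congr expR; field.
have yE : y t = expR (- nu * t) * y 0 + expR (- nu * t) * (H t - H 0).
  rewrite /H !mulrfctE mulr0 expR0 mul1r.
  by rewrite mulrBr mulrA E1; ring.
have GE : expR (- nu * t) * (G t - G 0) =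
    S * M * w * (2 / nu * (1 - expR (- (nu / 2) * t))).
  rewrite /G mulr0 expR0 mulr1 E3 /c.
  set a := expR (- _ * t) in E2 *; set b := expR (_ * t) in E2 *.
  transitivity (S * M * w * (2 / nu) * (a * b) * (a * b - a)).
    by field; rewrite gt_eqF.
  by rewrite E2; ring.
have first : expR (- nu * t) <= M * w.
  have := exponent 0; rewrite lexx t0 => /(_ isT); rewrite gevrey0// subr0 mulr1.
  move=> /le_trans; apply; rewrite ler_piMr//.
    by rewrite mulr_ge0 ?expR_ge0.
  by rewrite expR_le1 mulNr oppr_le0 mulr_ge0// divr_ge0// ltW.
have scale : 2 / nu * (1 - expR (- (nu / 2) * t)) <=
    2 `^ alpha * (1 + 2 / mu) * (k%:R + K) `^ (- alpha).
  apply: (min_time_scale mu0 a1 K0 kp tK).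
    have := expR_ge1Dx (- (nu / 2) * t).
    have n2 : 0 < 2 / nu by rewrite divr_gt0.
    move=> h; rewrite -ler_pdivlMl// invf_div; lra.
  rewrite -/nu; have n2 : 0 < 2 / nu by rewrite divr_gt0.
  by have := expR_ge0 (- (nu / 2) * t); nra.
have w0 : 0 < w by exact: gevrey_gt0.
rewrite yE (le_trans (ler_normD _ _))// !normrM (ger0_norm (expR_ge0 _)).
have h3 : expR (- nu * t) * `|H t - H 0| <= S * M * w *
    (2 `^ alpha * (1 + 2 / mu) * (k%:R + K) `^ (- alpha)).
  apply: (le_trans (ler_wpM2l (expR_ge0 _) HG)); rewrite GE ler_wpM2l//.
  by rewrite !mulr_ge0 ?expR_ge0// ltW.
have h4 := ler_wpM2r (normr_ge0 (y 0)) first.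
lra.
Qed.

Definition modes_ode mu alpha (p q : nat -> R -> R) :=
  (forall k t, is_derive t (1 : R) (p k) (- (mu * k%:R `^ alpha) * p k t -
        \sum_(1 <= l < k) l%:R * (k - l)%:R *
          (p l t * q (k - l)%N t + q l t * p (k - l)%N t))) /\
  (forall k t, is_derive t (1 : R) (q k) (- (mu * k%:R `^ alpha) * q k t +
        \sum_(1 <= l < k) l%:R * (k - l)%:R *
          (p l t * p (k - l)%N t - q l t * q (k - l)%N t))).

(** The sum of absolute values is the larger of |x + y| and |x - y|, so a bound on |p| + |q| reduces
    without loss to scalar equations for p + q and p - q. This norm is also submultiplicative for
    the product (p + i q)(p' + i q'), which keeps the constant 1 in the recursion. *)
Lemma normD_max x y c : `|x + y| <= c -> `|x - y| <= c -> `|x| + `|y| <= c.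
Proof.
rewrite !ler_norml => /andP[h1 h2] /andP[h3 h4].
by case: (ger0P x) => _; case: (ger0P y) => _; lra.
Qed.

(** The time and the majorant are produced from the amplitudes [y] alone, before any modes are
    given. [A] solves the recursion with equality; the bound on the modes follows by strong
    induction on k, the Gevrey factors of l and k - l multiplying to that of k. *)
Lemma modes_bound mu alpha (y : nat -> R) (Z : R) : 0 < mu -> 1 < alpha ->
  (forall k, 0 <= y k) ->
  (forall N, \sum_(1 <= k < N) (k%:R `^ (5 / 2 - alpha) * y k) ^+ 2 <= Z) ->
  exists T : R, exists A : nat -> R, exists Z' : R,
  [/\ 0 < T, forall k, 0 <= A k,
    forall N, \sum_(1 <= k < N) (k%:R `^ (5 / 2 - alpha) * A k) ^+ 2 <= Z' &
    forall p q, modes_ode mu alpha p q ->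
      (forall k, `|p k 0| + `|q k 0| <= y k) ->
      forall k t, (0 < k)%N -> 0 <= t <= T ->
      `|p k t| + `|q k t| <= A k * gevrey mu alpha t k].
Proof.
move=> mu0 a1 y0 yZ.
set M := expR (mu / 2); set M' := M * (2 `^ alpha * (1 + 2 / mu)).
have M0 : 0 < M by exact: expR_gt0.
have M'0 : 0 < M' by rewrite !mulr_gt0 ?powR_gt0// addr_gt0// divr_gt0.
have [C C0 HC] := majorant_bound a1.
have yZ2 N : \sum_(1 <= k < N) (k%:R `^ (5 / 2 - alpha) * (M * y k)) ^+ 2 <= M ^+ 2 * Z.
  apply: le_trans (ler_wpM2l (sqr_ge0 M) (yZ N)); rewrite mulr_sumr.
  rewrite le_eqVlt; apply/orP; left; apply/eqP; apply: eq_bigr => k _; ring.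
(* The size of the weighted data at which the smallness condition of [majorant_bound], with [M'] in
   the role of [M], becomes an equality. *)
pose e := (16 * C * M' ^+ 2)^-1.
have CM0 : 0 < 16 * C * M' ^+ 2.
  by apply: mulr_gt0; [exact: mulr_gt0|exact: exprn_gt0].
have e0 : 0 < e by rewrite invr_gt0.
have [K K0 HK] := kato_weight_tendsto0 a1 yZ2 e0.
pose F (A : nat -> R) k := M * y k + M' * (k%:R + K) `^ (- alpha) * mode_conv A k.
have [|A AE] := @strong_recursion R 0 F.
  move=> f g k fg; rewrite /F /mode_conv; congr (_ + _ * _).
  apply: eq_big_nat => l /andP[l1 lk]; rewrite !fg//.
  by rewrite ltn_subrL l1 (leq_ltn_trans _ lk).
have A0 k : 0 <= A k.
  elim/ltn_ind: k => k IH; rewrite AE /F addr_ge0//.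
    by rewrite mulr_ge0// ltW.
  apply: mulr_ge0; first by apply: mulr_ge0; [exact: ltW|exact: powR_ge0].
  rewrite /mode_conv big_nat_cond sumr_ge0// => l; rewrite andbT => /andP[l1 lk].
  by rewrite !mulr_ge0 ?IH// ltn_subrL l1 (leq_ltn_trans _ lk).
have AW := HC K A (fun k => M * y k) M' e (ltW K0) A0 (ltW M'0) _ HK _.
exists (K `^ (- alpha)), A, (((1 + K) `^ ((alpha - 1) / 2)) ^+ 2 * (4 * e)).
split => //.
- exact: powR_gt0.
- move=> N; have {}AW : \sum_(1 <= k < N) (kato_weight alpha K k * A k) ^+ 2 <= 4 * e.
    apply: AW; first by move=> k k0; rewrite [leLHS]AE.
    by rewrite /e divff// gt_eqF.
  apply: le_trans (ler_wpM2l (sqr_ge0 _) AW); rewrite mulr_sumr ler_sum_nat//.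
  move=> k /andP[k1 _]; rewrite -exprMn; apply: ler_sqr_ge0.
    by rewrite mulr_ge0 ?powR_ge0.
  by rewrite mulrA ler_wpM2r//; exact: powR_le_kato_weight (ltW K0) k1.
- move=> p q [dp dq] pq0 k.
  elim/ltn_ind: k => k IH t k0 tK.
  set S := mode_conv A k.
  have S0 : 0 <= S.
    by rewrite /S /mode_conv sumr_ge0// => l _; rewrite !mulr_ge0.
  pose g1 r := \sum_(1 <= l < k) l%:R * (k - l)%:R *
          (p l r * q (k - l)%N r + q l r * p (k - l)%N r).
  pose g2 r := \sum_(1 <= l < k) l%:R * (k - l)%:R *
          (p l r * p (k - l)%N r - q l r * q (k - l)%N r).
  have g12 r : 0 <= r <= t -> `|g1 r| + `|g2 r| <= S * gevrey mu alpha r k.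
    move=> /andP[r0 rt].
    have rK : 0 <= r <= K `^ (- alpha) by rewrite r0 (le_trans rt)//; case/andP: tK.
    apply: (le_trans (lerD (ler_norm_sum _ _ _) (ler_norm_sum _ _ _))).
    rewrite -big_split/= /S /mode_conv mulr_suml ler_sum_nat// => l /andP[l1 lk].
    have kl : (0 < k - l < k)%N by rewrite subn_gt0 lk ltn_subrL l1 (leq_ltn_trans _ lk).
    case/andP: kl => kl1 kl2.
    have hl := IH l lk r l1 rK; have hm := IH _ kl2 r kl1 rK.
    rewrite !normrM !normr_nat -mulrDr -[leRHS]mulrA ler_wpM2l ?mulr_ge0//.
    rewrite -(gevrey_split mu alpha r (ltnW lk)).
    have := ler_pM (addr_ge0 (normr_ge0 _) (normr_ge0 _))
      (addr_ge0 (normr_ge0 _) (normr_ge0 _)) hl hm.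
    set a := p l r; set b := q l r; set c := p _ r; set d := q _ r.
    have := ler_normD (a * d) (b * c); have := ler_normB (a * c) (b * d).
    rewrite !normrM; lra.
  rewrite AE /F.
  have bound (sg : R) : `|sg| = 1 -> `|p k t + sg * q k t| <=
      (M * y k + M' * (k%:R + K) `^ (- alpha) * mode_conv A k) * gevrey mu alpha t k.
    move=> sg1.
    (* For [sg] equal to 1 and -1 this is the source in the equation for p + q and p - q. *)
    pose g r := - g1 r + sg * g2 r.
    have dg r : is_derive r (1 : R) (p k + cst sg * q k)
        (- (mu * k%:R `^ alpha) * (p k r + sg * q k r) + g r).
      apply: (is_derive_eq (is_deriveD (dp k r)
        (is_deriveM (is_derive_cst sg r (1 : R)) (dq k r)))).
      change (- (mu * k%:R `^ alpha) * p k r - g1 r +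
        (sg * (- (mu * k%:R `^ alpha) * q k r + g2 r) + q k r * 0) =
        - (mu * k%:R `^ alpha) * (p k r + sg * q k r) + g r).
      rewrite /g; ring.
    have := scalar_mode_bound mu0 a1 K0 k0 tK dg S0 _.
    have hg r : 0 <= r <= t -> `|g r| <= S * gevrey mu alpha r k.
      move=> /g12; apply: le_trans; rewrite (le_trans (ler_normD _ _))//.
      by rewrite normrN normrM sg1 mul1r.
    move=> /(_ hg) /le_trans; apply; rewrite ler_wpM2r ?(ltW (gevrey_gt0 _ _ _ _))//.
    rewrite lerD2r ler_wpM2l ?(ltW M0)// (le_trans _ (pq0 k))//.
    rewrite (le_trans (ler_normD _ _))// [X in _ + X](_ : _ = `|sg * q k 0|)//.
    by rewrite normrM sg1 mul1r.
  apply: normD_max; first by have := bound 1; rewrite normr1 mul1r; apply.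
  by have := bound (-1); rewrite normrN1 mulN1r; apply.
Qed.

End ModeEstimates.

(** * Uniqueness of Fourier coefficients *)

Section CircleIntegral.
Context {R : realType}.
Local Notation mu := (@lebesgue_measure R).
Local Notation circ := (`[- pi, pi]%classic : set R).
Implicit Types (f g h : R -> R) (c x : R) (j : int).

Definition circle_integrable f := mu.-integrable circ (EFin \o f).

Lemma measurable_circ : measurable (circ : set (measurableTypeR R)). Proof. exact: measurable_itv. Qed.
Hint Resolve measurable_circ : core.

Lemma continuous_circle_integrable h : continuous h -> circle_integrable h.
Proof. exact: continuous_itv_integrable. Qed.

Lemma circle_integrableM f h : circle_integrable f -> continuous h ->
  circle_integrable (fun x => f x * h x).
Proof.
move=> fi ch; apply: (@integrableMl _ _ _ mu circ measurable_circ (EFin \o f) h fi).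
  by apply: measurable_funTS; exact: continuous_measurable_fun.
have /compact_bounded := @continuous_compact _ _ h circ
  (continuous_subspaceT ch) (@segment_compact _ _ _).
move=> [M [Mr HM]]; exists M; split => // y My x xc.
by apply: (HM y My); exists x.
Qed.

Lemma circle_integrableD f g : circle_integrable f -> circle_integrable g ->
  circle_integrable (fun x => f x + g x).
Proof.
move=> fi gi; have := integrableD measurable_circ fi gi.
by apply: eq_integrable.
Qed.

Lemma circle_integrableZ c f : circle_integrable f ->
  circle_integrable (fun x => c * f x).
Proof. by move=> fi; exact: (integrableZl measurable_circ c fi). Qed.

Lemma circle_integralD f g : circle_integrable f -> circle_integrable g ->
  circle_integral (fun x => f x + g x) = circle_integral f + circle_integral g.
Proof. by move=> fi gi; exact: RintegralD. Qed.

Lemma circle_integralZ c f : circle_integrable f ->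
  circle_integral (fun x => c * f x) = c * circle_integral f.
Proof. by move=> fi; exact: RintegralZl. Qed.

Lemma circle_integral_FTC F f : (forall x, is_derive x (1 : R) F (f x)) ->
  continuous f -> circle_integral f = F pi - F (- pi).
Proof.
move=> dF cf; apply: Rintegral_FTC => //.
by rewrite (@le_trans _ _ 0) ?oppr_le0 ?pi_ge0.
Qed.

Lemma continuous_cosZ c : continuous (fun x => cos (c * x)).
Proof.
move=> x; apply: continuous_comp; last exact: continuous_cos.
exact: (is_derive_continuous (is_derive_cmul c)).
Qed.

Lemma continuous_sinZ c : continuous (fun x => sin (c * x)).
Proof.
move=> x; apply: continuous_comp; last exact: continuous_sin.
exact: (is_derive_continuous (is_derive_cmul c)).
Qed.

Lemma is_derive_sinZ c x : is_derive x (1 : R) (fun x => sin (c * x)) (c * cos (c * x)).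
Proof.
rewrite mulrC.
exact: (is_derive1_comp (is_derive_sin (c * x)) (is_derive_cmul c x)).
Qed.

Lemma is_derive_cosZ c x : is_derive x (1 : R) (fun x => cos (c * x)) (- c * sin (c * x)).
Proof.
have -> : - c * sin (c * x) = - sin (c * x) * c by ring.
exact: (is_derive1_comp (is_derive_cos (c * x)) (is_derive_cmul c x)).
Qed.

Lemma is_derive_cmulf c f (df x : R) : is_derive x (1 : R) f df ->
  is_derive x (1 : R) (fun x => c * f x) (c * df).
Proof.
move=> dfx; pose g := cst c * f; rewrite -[fun _ => _]/g.
apply: (is_derive_eq (is_deriveM (is_derive_cst c x (1 : R)) dfx)).
by rewrite scaler0 addr0.
Qed.

Definition fcos f j := circle_integral (fun x => f x * cos (j%:~R * x)).
Definition fsin f j := circle_integral (fun x => f x * sin (j%:~R * x)).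

Lemma fcosN f j : fcos f (- j) = fcos f j.
Proof. by rewrite /fcos; congr circle_integral; apply/funext => x; rewrite mulrNz mulNr cosN. Qed.

Lemma cosp1 (z x : R) : cos (z * x) * cos x = 2^-1 * (cos ((z + 1) * x) + cos ((z - 1) * x)).
Proof.
have -> : (z + 1) * x = z * x + x by ring.
have -> : (z - 1) * x = z * x - x by ring.
by rewrite cosB cosD; field.
Qed.

Lemma cosps1 (z x : R) : cos (z * x) * sin x = 2^-1 * (sin ((z + 1) * x) - sin ((z - 1) * x)).
Proof.
have -> : (z + 1) * x = z * x + x by ring.
have -> : (z - 1) * x = z * x - x by ring.
by rewrite sinB sinD; field.
Qed.

Lemma sinpc1 (z x : R) : sin (z * x) * cos x = 2^-1 * (sin ((z + 1) * x) + sin ((z - 1) * x)).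
Proof.
have -> : (z + 1) * x = z * x + x by ring.
have -> : (z - 1) * x = z * x - x by ring.
by rewrite sinB sinD; field.
Qed.

Lemma sinps1 (z x : R) : sin (z * x) * sin x = 2^-1 * (cos ((z - 1) * x) - cos ((z + 1) * x)).
Proof.
have -> : (z + 1) * x = z * x + x by ring.
have -> : (z - 1) * x = z * x - x by ring.
by rewrite cosB cosD; field.
Qed.

(** Asking that all coefficients of [f h] vanish, and not only its mean, makes the class of
    multipliers stable under products with cos and sin. Powers of trigonometric polynomials are then
    reached without being expanded. *)
Definition annihilates f h := [/\ continuous h,
  forall j, fcos (fun x => f x * h x) j = 0 &
  forall j, fsin (fun x => f x * h x) j = 0].

Lemma annihilatesD f g h : circle_integrable f -> annihilates f g ->
  annihilates f h -> annihilates f (fun x => g x + h x).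
Proof.
move=> fi [cg gc gs] [ch hc hs]; split=> [|j|j]; first exact: continuous_addf.
- rewrite /fcos (_ : (fun x => _) = (fun x => f x * g x * cos (j%:~R * x) +
      f x * h x * cos (j%:~R * x))); last by apply/funext => x; ring.
  rewrite circle_integralD; first by rewrite -!/(fcos _ _) gc hc addr0.
    by apply: (circle_integrableM (h := fun x => cos (_ * x))); [exact: circle_integrableM|exact: continuous_cosZ].
  by apply: (circle_integrableM (h := fun x => cos (_ * x))); [exact: circle_integrableM|exact: continuous_cosZ].
- rewrite /fsin (_ : (fun x => _) = (fun x => f x * g x * sin (j%:~R * x) +
      f x * h x * sin (j%:~R * x))); last by apply/funext => x; ring.
  rewrite circle_integralD; first by rewrite -!/(fsin _ _) gs hs addr0.
    by apply: (circle_integrableM (h := fun x => sin (_ * x))); [exact: circle_integrableM|exact: continuous_sinZ].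
  by apply: (circle_integrableM (h := fun x => sin (_ * x))); [exact: circle_integrableM|exact: continuous_sinZ].
Qed.

Lemma annihilatesZ c f h : circle_integrable f -> annihilates f h ->
  annihilates f (fun x => c * h x).
Proof.
move=> fi [ch hc hs]; split=> [|j|j]; first exact: continuous_cmulf.
- rewrite /fcos (_ : (fun x => _) = (fun x => c * (f x * h x * cos (j%:~R * x))));
    last by apply/funext => x; ring.
  rewrite circle_integralZ; first by rewrite -!/(fcos _ _) hc mulr0.
  by apply: (circle_integrableM (h := fun x => cos (_ * x))); [exact: circle_integrableM|exact: continuous_cosZ].
- rewrite /fsin (_ : (fun x => _) = (fun x => c * (f x * h x * sin (j%:~R * x))));
    last by apply/funext => x; ring.
  rewrite circle_integralZ; first by rewrite -!/(fsin _ _) hs mulr0.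
  by apply: (circle_integrableM (h := fun x => sin (_ * x))); [exact: circle_integrableM|exact: continuous_sinZ].
Qed.

(** Multiplication by cos x or sin x shifts frequencies by one in each direction. *)
Lemma annihilates_trig f h : circle_integrable f -> annihilates f h ->
  annihilates f (fun x => h x * cos x) /\ annihilates f (fun x => h x * sin x).
Proof.
move=> fi [ch hc hs].
have ic z : circle_integrable (fun x => f x * h x * cos (z * x)).
  by apply: (circle_integrableM (h := fun x => cos (_ * x))); [exact: circle_integrableM|exact: continuous_cosZ].
have is_ z : circle_integrable (fun x => f x * h x * sin (z * x)).
  by apply: (circle_integrableM (h := fun x => sin (_ * x))); [exact: circle_integrableM|exact: continuous_sinZ].
have jp j : (j + 1)%:~R = j%:~R + 1 :> R by rewrite intrD.
have jm j : (j - 1)%:~R = j%:~R - 1 :> R by rewrite intrB.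
have comb (u v : R -> R) c : circle_integrable u -> circle_integrable v ->
    circle_integral u = 0 -> circle_integral v = 0 ->
    circle_integral (fun x => 2^-1 * (u x + c * v x)) = 0.
  move=> iu iv u0 v0; rewrite circle_integralZ; last first.
    by apply: circle_integrableD => //; exact: circle_integrableZ.
  rewrite circle_integralD//; last exact: circle_integrableZ.
  by rewrite circle_integralZ// u0 v0 mulr0 addr0 mulr0.
split; split.
- exact: continuous_mulf ch (@continuous_cos R).
- move=> j; rewrite /fcos (_ : (fun x => _) = (fun x => 2^-1 *
    (f x * h x * cos ((j + 1)%:~R * x) + 1 * (f x * h x * cos ((j - 1)%:~R * x))))).
    by apply: comb => //; exact: hc.
  by apply/funext => x; rewrite jp jm -mulrA -(mulrA _ _ (cos _)) (mulrC (cos x)) cosp1; ring.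
- move=> j; rewrite /fsin (_ : (fun x => _) = (fun x => 2^-1 *
    (f x * h x * sin ((j + 1)%:~R * x) + 1 * (f x * h x * sin ((j - 1)%:~R * x))))).
    by apply: comb => //; exact: hs.
  by apply/funext => x; rewrite jp jm -mulrA -(mulrA _ _ (sin _)) (mulrC (cos x)) sinpc1; ring.
- exact: continuous_mulf ch (@continuous_sin R).
- move=> j; rewrite /fcos (_ : (fun x => _) = (fun x => 2^-1 *
    (f x * h x * sin ((j + 1)%:~R * x) + (-1) * (f x * h x * sin ((j - 1)%:~R * x))))).
    by apply: comb => //; exact: hs.
  by apply/funext => x; rewrite jp jm -mulrA -(mulrA _ _ (cos _)) (mulrC (sin x)) cosps1; ring.
- move=> j; rewrite /fsin (_ : (fun x => _) = (fun x => 2^-1 *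
    (f x * h x * cos ((j - 1)%:~R * x) + (-1) * (f x * h x * cos ((j + 1)%:~R * x))))).
    by apply: comb => //; exact: hc.
  by apply/funext => x; rewrite jp jm -mulrA -(mulrA _ _ (sin _)) (mulrC (sin x)) sinps1; ring.
Qed.

Lemma annihilatesM f h (c0 c1 c2 : R) : circle_integrable f -> annihilates f h ->
  annihilates f (fun x => h x * (c0 + c1 * cos x + c2 * sin x)).
Proof.
move=> fi ah; have [ac as_] := annihilates_trig fi ah.
rewrite (_ : (fun x => _) = (fun x => c0 * h x + (c1 * (h x * cos x) + c2 * (h x * sin x)))).
  exact: (annihilatesD fi (annihilatesZ c0 fi ah)
    (annihilatesD fi (annihilatesZ c1 fi ac) (annihilatesZ c2 fi as_))).
by apply/funext => x; ring.
Qed.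

Lemma annihilates_exp f (y : R -> R) :
  (forall h, annihilates f h -> annihilates f (fun x => h x * y x)) ->
  forall n h, annihilates f h -> annihilates f (fun x => h x * y x ^+ n).
Proof.
move=> Hy; elim=> [|n IH] h ah; first by under eq_fun do rewrite expr0 mulr1.
under eq_fun do rewrite exprSr mulrA; exact/Hy/IH.
Qed.

Lemma annihilates_bump f (y : R -> R) n m : circle_integrable f ->
  (forall h, annihilates f h -> annihilates f (fun x => h x * y x)) ->
  annihilates f (fun=> 1) -> annihilates f (fun x => (1 - y x ^+ n) ^+ m).
Proof.
move=> fi Hy a1; rewrite (_ : (fun x => _) = (fun x => 1 * (1 - y x ^+ n) ^+ m)).
  apply: (@annihilates_exp f (fun x => 1 - y x ^+ n) _ m _ a1) => h ah.
  rewrite (_ : (fun x => _) = (fun x => h x + (-1) * (h x * y x ^+ n))).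
    exact: (annihilatesD fi ah (annihilatesZ _ fi (annihilates_exp Hy n ah))).
  by apply/funext => x; ring.
by apply/funext => x; rewrite mul1r.
Qed.

End CircleIntegral.
#[global] Hint Resolve measurable_circ : core.

#[global] Instance lebesgue_ae_nbhs_filter {R : realType} :
  Filter (nbhs (almost_everywhere (@lebesgue_measure R))).
Proof. exact: ae_filter_ringOfSetsType. Qed.

#[global] Instance lebesgue_ae_filter {R : realType} :
  Filter (almost_everywhere (@lebesgue_measure R)).
Proof. exact: ae_filter_ringOfSetsType. Qed.

(** * From vanishing coefficients to vanishing integrals over arcs *)

Section FourierUniqueness.
Context {R : realType}.
Local Notation mu := (@lebesgue_measure R).
Local Notation circ := (`[- pi, pi]%classic : set (measurableTypeR R)).
Implicit Types (f g h : R -> R) (a b c x y : R) (j : int).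

(* For [y] affine in [cos (x - c)] these trigonometric polynomials tend to the
   indicator of the arc [y < 1/2], which replaces Fejer's theorem. *)
Lemma bump_cvg1 y : 0 <= y -> y < 2^-1 ->
  (1 - y ^+ n) ^+ (2 ^ n) @[n --> \oo] --> (1 : R).
Proof.
move=> y0 y1.
have y2 : `|2 * y| < 1 by rewrite ger0_norm; lra.
apply: (@squeeze_cvgr _ _ _ _ (fun n => 1 - (2 * y) ^+ n) (fun=> 1)).
- apply: nearW => n; apply/andP; split.
    have bern m (t : R) : 0 <= t <= 1 -> 1 - m%:R * t <= (1 - t) ^+ m.
      move=> /andP[t0 t1]; elim: m => [|m IH]; first by rewrite mul0r subr0 expr0.
      rewrite exprS -natr1.
      have t2 : 0 <= 1 - t by lra.
      have := ler_wpM2l t2 IH; have := mulr_ge0 (ler0n R m) (sqr_ge0 t); lra.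
    have := bern (2 ^ n)%N (y ^+ n); rewrite exprn_ge0// exprn_ile1//; last by lra.
    by move=> /(_ isT); rewrite exprMn natrX.
  apply: exprn_ile1; last by rewrite gerBl exprn_ge0.
  by rewrite subr_ge0 exprn_ile1//; lra.
- rewrite -[X in _ --> X]subr0; apply: cvgB; first exact: cvg_cst.
  exact: cvg_expr.
- exact: cvg_cst.
Qed.

(** With t = y^n and m = 2^n, (1 - t)^m (1 + t)^m <= 1 while Bernoulli gives (1 + t)^m >= m t. The
    bump is therefore at most 1 / (m t) = (2 y)^(- n), which tends to 0 precisely above the
    threshold 1/2. *)
Lemma bump_cvg0 y : 2^-1 < y -> y <= 1 ->
  (1 - y ^+ n) ^+ (2 ^ n) @[n --> \oo] --> (0 : R).
Proof.
move=> y1 y2.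
have y0 : 0 < y by lra.
have yn n : 0 < y ^+ n by rewrite exprn_gt0.
have yn1 n : y ^+ n <= 1 by rewrite exprn_ile1//; lra.
have z1 : `|(2 * y)^-1| < 1.
  by rewrite ger0_norm ?invr_ge0 ?invf_lt1; lra.
apply: (@squeeze_cvgr _ _ _ _ (fun=> 0) (fun n => (2 * y)^-1 ^+ n)).
- apply: nearW => n; apply/andP; split; first by rewrite exprn_ge0// subr_ge0.
  set m := (2 ^ n)%N; set t := y ^+ n.
  have t0 : 0 < t := yn n; have t1 : t <= 1 := yn1 n.
  have bern (k : nat) : 1 + k%:R * t <= (1 + t) ^+ k.
    elim: k => [|k IH]; first by rewrite mul0r addr0 expr0.
    rewrite exprS -natr1.
    have t2 : 0 <= 1 + t by lra.
    have := ler_wpM2l t2 IH; have := mulr_ge0 (ler0n R k) (sqr_ge0 t); lra.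
  have h : (1 - t) ^+ m * (1 + t) ^+ m <= 1.
    by rewrite -exprMn exprn_ile1//; nra.
  have m0 : 0 < (m%:R : R) by rewrite ltr0n expn_gt0.
  rewrite exprVn exprMn -natrX -/m -/t -div1r ler_pdivlMr ?mulr_gt0//.
  have q0 : 0 <= (1 - t) ^+ m by rewrite exprn_ge0// subr_ge0.
  apply: le_trans h; apply: ler_wpM2l => //.
  by apply: le_trans (bern m); lra.
- exact: cvg_cst.
- exact: cvg_expr.
Qed.

Lemma ae_neq c : {ae mu, forall x, x != c}.
Proof.
exists [set c]; split; first exact: measurable_set1.
  exact: lebesgue_measure_set1.
by move=> x /=; move/negP; rewrite negbK => /eqP.
Qed.

Lemma cos_lt_arc (d z : R) : 0 < d -> d <= pi -> `|z| < d -> cos d < cos z.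
Proof.
move=> d0 dp zd; have z0 := normr_ge0 z.
by rewrite -(cos_norm z) ltr_cos// in_itv/=; apply/andP; split; lra.
Qed.

Lemma cos_gt_arc (d z : R) : 0 < d -> d <= pi -> d < `|z| -> `|z| < 2 * pi - d ->
  cos z < cos d.
Proof.
move=> d0 dp zd zp; rewrite -(cos_norm z).
have [z1|z1] := leP `|z| pi.
  have z0 := normr_ge0 z.
  by rewrite ltr_cos// in_itv/=; apply/andP; split; lra.
have -> : cos `|z| = cos (2 * pi - `|z|).
  by rewrite cosB mulr_natl cos2pi sin2pi mul1r mul0r addr0.
by rewrite ltr_cos ?in_itv/=; [lra|apply/andP; split; lra|apply/andP; split; lra].
Qed.

(** Here y = 1/2 - (cos(x - x0) - cos d) / 8 crosses 1/2 exactly at the ends of the arc centred at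
    [x0] with half-length [d], and the divisor 8 keeps it in [0, 1]. The bumps are bounded by 1 and
    integrate to 0 against f, so dominated convergence passes this to the indicator of the arc. *)
Lemma arc_integral0 f a b : circle_integrable f ->
  (forall j, fcos f j = 0) -> (forall j, fsin f j = 0) ->
  - pi <= a -> a < b -> b <= pi -> \int[mu]_(x in `]a, b[) f x = 0.
Proof.
move=> fi fc fs pa ab bp.
pose x0 := (a + b) / 2; pose d := (b - a) / 2.
have d0 : 0 < d by rewrite /d; lra.
have dp : d <= pi by rewrite /d; lra.
pose y x := (2^-1 + cos d / 8) + (- cos x0 / 8) * cos x + (- sin x0 / 8) * sin x.
have yE x : y x = 2^-1 - (cos (x - x0) - cos d) / 8.
  by rewrite /y cosB; field.
have y01 x : 0 <= y x <= 1.
  rewrite yE; have := cos_le1 (x - x0); have := cos_geN1 (x - x0).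
  by have := cos_le1 d; have := cos_geN1 d; lra.
pose q n x := (1 - y x ^+ n) ^+ (2 ^ n).
have q01 n x : 0 <= q n x <= 1.
  have /andP[y0 y1] := y01 x.
  have t0 : 0 <= y x ^+ n by rewrite exprn_ge0.
  have t1 : y x ^+ n <= 1 by rewrite exprn_ile1.
  by rewrite /q exprn_ge0 ?subr_ge0//= exprn_ile1// ?subr_ge0// gerBl.
have a1 : annihilates f (fun=> 1).
  split=> [x|j|j]; first exact: cvg_cst.
  - by rewrite -[RHS](fc j); congr fcos; apply/funext => x; rewrite mulr1.
  - by rewrite -[RHS](fs j); congr fsin; apply/funext => x; rewrite mulr1.
have aq n : annihilates f (q n).
  apply: annihilates_bump => // h; exact: annihilatesM.
have intq n : (\int[mu]_(x in circ) (f x * q n x)%:E = 0)%E.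
  have [cq cq0 _] := aq n.
  have fqi := circle_integrableM fi cq.
  rewrite -[LHS]fineK; last exact: (integrable_fin_num measurable_circ fqi).
  congr (_%:E); rewrite -[RHS](cq0 0); congr (fine (integral _ _ _)).
  by apply/funext => x /=; rewrite mulr0z mul0r cos0 mulr1.
have mf : measurable_fun circ f by apply/measurable_EFinP; exact: measurable_int fi.
have mab : measurable (`]a, b[%classic : set (measurableTypeR R)) by exact: measurable_itv.
have [] := @dominated_convergence _ _ _ mu circ measurable_circ
  (fun n x => (f x * q n x)%:E) ((EFin \o f) \_ `]a, b[) (fun x => `|f x|%:E).
- move=> n; have [cq _ _] := aq n.
  exact: measurable_int (circle_integrableM fi cq).
- apply/measurable_restrict => //; apply: measurable_funS (measurable_int _ fi) => //.
(* At [a] and [b] the function [y] equals 1/2 and no limit is claimed. Discarding the points pi and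
   - pi makes |x - x0| < 2 pi - d strict outside the arc. *)
- have h1 := ae_neq a; have h2 := ae_neq b; have h3 := ae_neq pi; have h4 := ae_neq (- pi).
  near=> x => xc.
  have xa : x != a by near: x.
  have xb : x != b by near: x.
  have xp : x != pi by near: x.
  have xN : x != - pi by near: x.
  move: xc; rewrite /= in_itv/= => /andP[xc1 xc2].
  have {}xc1 : - pi < x by rewrite lt_neqAle eq_sym xN.
  have {}xc2 : x < pi by rewrite lt_neqAle xp.
  have /andP[y0 y1] := y01 x.
  rewrite patchE; case: ifPn => [|]; rewrite ?inE ?notin_setE/= in_itv/=.
    move=> /andP[ax xb'].
    have : `|x - x0| < d by rewrite ltr_norml /x0 /d; apply/andP; split; lra.
    move=> /(cos_lt_arc d0 dp) cdx.
    apply: cvg_EFin; first exact: nearW.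
    rewrite -[X in _ --> X]mulr1; apply: cvgMr.
    by apply: bump_cvg1 => //; rewrite yE; lra.
  move=> /negP; rewrite negb_and -!leNgt => xab.
  have {xab} : d < `|x - x0| /\ `|x - x0| < 2 * pi - d.
    move: xa xb; rewrite !neq_lt => /orP[xa|xa] /orP[xb|xb]; rewrite /x0 /d in xab *.
    - by rewrite ltr0_norm; [split; lra|lra].
    - lra.
    - by case/orP: xab; lra.
    - by rewrite gtr0_norm; [split; lra|lra].
  move=> [h5 h6]; have cdx := cos_gt_arc d0 dp h5 h6.
  apply: cvg_EFin; first exact: nearW.
  rewrite -[X in _ --> X](mulr0 (f x)); apply: cvgMr.
  by apply: bump_cvg0 => //; rewrite yE; lra.
- exact: integrable_norm fi.
- apply: aeW => x n _; have /andP[q0 q1] := q01 n x.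
  by rewrite lee_fin normrM (ger0_norm q0) ler_piMr.
move=> _ _; under [X in X @ _ --> _]eq_fun do rewrite intq.
move=> lim0; have := cvg_unique (@ereal_hausdorff R) lim0 (cvg_cst _).
rewrite -integral_mkcondr (_ : circ `&` _ = `]a, b[%classic).
  by rewrite /Rintegral => ->.
apply/seteqP; split => x /=; rewrite !in_itv/=; first by case.
by move=> /andP[ax xb]; split => //; apply/andP; split; lra.
Unshelve. all: by end_near. Qed.

(** Extended by 0 outside the circle, f has an identically zero indefinite integral, because
    integrals over arcs vanish. Lebesgue differentiation then gives f = 0 almost everywhere. *)
Lemma fourier_unique f : circle_integrable f ->
  (forall j, fcos f j = 0) -> (forall j, fsin f j = 0) ->
  {ae mu, forall x, circ x -> f x = 0}.
Proof.
move=> fi fc fs; pose f0 := f \_ circ.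
have f0i : mu.-integrable setT (EFin \o f0).
  have := (@integrable_mkcond _ (measurableTypeR R) R mu circ (EFin \o f) measurable_circ).1 fi.
  by rewrite restrict_EFin.
have f0i' (y : R) : mu.-integrable `]-oo, y] (EFin \o f0).
  by apply: integrableS f0i.
have lf0 : locally_integrable [set: R] f0 by exact: integrable_locally.
have F0 x : \int[mu]_(t in `]-oo, x]) f0 t = 0.
  rewrite /f0 -Rintegral_mkcondr.
  have [xp|px] := leP x (- pi).
    move: xp; rewrite le_eqVlt => /predU1P[->|xp].
      rewrite (_ : _ `&` _ = [set - pi]) ?Rintegral_set1//.
      apply/seteqP; split => z /=; rewrite !in_itv/=.
        by move=> [z1 /andP[z2 z3]]; apply/eqP; rewrite eq_le z1 z2.
      by move=> ->; rewrite lexx; split=> //; have := pi_ge0 R; lra.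
    rewrite (_ : _ `&` _ = set0) ?Rintegral_set0//.
    by apply/seteqP; split => z //=; rewrite !in_itv/= => -[z1 /andP[z2 z3]]; lra.
  pose m := Num.min x pi.
  have pi0 := pi_gt0 R.
  have Nm : - pi < m by rewrite lt_min px/=; lra.
  have mp : m <= pi by rewrite ge_min lexx orbT.
  rewrite (_ : _ `&` _ = `[- pi, m]%classic); last first.
    apply/seteqP; split => z /=; rewrite !in_itv/= /m le_min.
      by move=> [z1 /andP[z2 z3]]; rewrite z1 z2 z3.
    by move=> /andP[z1 /andP[z2 z3]]; rewrite z1 z2 z3.
  have fis (b0 b1 : bool) : mu.-integrable
      [set` Interval (BSide b0 (- pi)) (BSide b1 m)] (EFin \o f).
    apply: integrableS fi => //; apply: subset_itv; first by rewrite bnd_simp; case: b0.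
    by case: b1; rewrite ?bnd_simp.
  rewrite -Rintegral_itv_bndo_bndc; last exact: fis.
  rewrite -Rintegral_itv_obnd_cbnd; last exact: fis.
  exact: arc_integral0.
have hF := FTC1Ny f0i' lf0.
near=> x => xc.
have [_] : derivable (fun x => \int[mu]_(t in `]-oo, x]) f0 t) x 1 /\
  derive1 (fun x => \int[mu]_(t in `]-oo, x]) f0 t) x = f0 x by near: x.
rewrite (_ : (fun _ => _) = cst 0); last exact/funext.
by rewrite derive1_cst /f0 patchE mem_set// => <-.
Unshelve. all: by end_near. Qed.

End FourierUniqueness.

(** * Trigonometric series and their products *)

Section TrigSeries.
Context {R : realType}.
Local Notation mu := (@lebesgue_measure R).
Local Notation circ := (`[- pi, pi]%classic : set (measurableTypeR R)).
Implicit Types (f g h : R -> R) (a b c x y : R) (j : int) (u v : nat -> R).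

(** The image measure under translation gives half-open intervals their length, and this
    characterizes Lebesgue measure. *)
Lemma lebesgue_measure_shift c (A : set (measurableTypeR R)) : measurable A ->
  mu [set x : R | A (x + c)] = mu A.
Proof.
move=> mA.
have mf : measurable_fun (setT : set (measurableTypeR R)) ((fun x => x + c) : measurableTypeR R -> measurableTypeR R).
  by apply: measurable_funD => //.
pose nu := measure_function_pushforward__canonical__measure_function_Measure mu mf.
apply/esym; apply: (@lebesgue_measure_unique R nu) => //.
move=> X [[a b] /= _ <-].
rewrite /nu /= /pushforward (_ : _ @^-1` _ = `](a - c), (b - c)]%classic); last first.
  apply/seteqP; split => x /=; rewrite !in_itv/= => /andP[h1 h2];
    apply/andP; split; lra.
have [ab|ab] := leP b a.
  by rewrite !set_itv_ge// bnd_simp -leNgt//; lra.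
rewrite !lebesgue_measure_itv/= !lte_fin ab ifT; last by lra.
by rewrite -!EFinD; congr (_%:E); ring.
Qed.

Lemma ae_shift c (P : R -> Prop) : {ae mu, forall x, P x} ->
  {ae mu, forall x, P (x + c)}.
Proof.
move=> [N [mN N0 PN]]; exists [set x : R | N (x + c)]; split.
- have mf : measurable_fun (setT : set (measurableTypeR R)) ((fun x => x + c) : measurableTypeR R -> measurableTypeR R).
    by apply: measurable_funD => //.
  by have := mf measurableT _ mN; rewrite setTI.
- by rewrite -[RHS]N0; exact: lebesgue_measure_shift.
- by move=> x /= nP; exact: PN.
Qed.

Lemma periodicZ f (n : int) x : Defs.periodic f -> f (x + n%:~R * (2 * pi)) = f x.
Proof.
move=> pf; case: n => n.
  elim: n => [|n IH]; first by rewrite mul0r addr0.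
  rewrite -[RHS]IH -[RHS]pf; congr f; rewrite -addn1 PoszD intrD; ring.
rewrite NegzE mulrNz mulNr; elim: n x => [|n IH] x.
  by rewrite mul1r -[LHS]pf subrK.
rewrite -[RHS]IH -[LHS]pf; congr f; rewrite -addn1 PoszD intrD; ring.
Qed.

Lemma ae_circ_periodic f g : Defs.periodic f -> Defs.periodic g ->
  {ae mu, forall x, circ x -> f x = g x} -> {ae mu, forall x, f x = g x}.
Proof.
move=> pf pg h.
have hn (e : bool) (n : nat) : {ae mu, forall x : R,
    circ (x + (-1) ^+ e * n%:R * (2 * pi)) ->
    f (x + (-1) ^+ e * n%:R * (2 * pi)) = g (x + (-1) ^+ e * n%:R * (2 * pi))}.
  exact: (@ae_shift ((-1) ^+ e * n%:R * (2 * pi)) (fun x => circ x -> f x = g x)).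
have h1 := ae_foralln (hn false); have h2 := ae_foralln (hn true).
near=> x.
have x1 : forall n : nat, circ (x + (-1) ^+ false * n%:R * (2 * pi)) ->
   f (x + (-1) ^+ false * n%:R * (2 * pi)) = g (x + (-1) ^+ false * n%:R * (2 * pi)).
  by near: x.
have x2 : forall n : nat, circ (x + (-1) ^+ true * n%:R * (2 * pi)) ->
   f (x + (-1) ^+ true * n%:R * (2 * pi)) = g (x + (-1) ^+ true * n%:R * (2 * pi)).
  by near: x.
(* The translation by k periods that brings x into [- pi, pi]; the exceptional set is a countable
   union of translates of a null set. *)
pose k : int := - Num.floor ((x + pi) / (2 * pi)).
have pi0 := pi_gt0 R.
have kc : circ (x + k%:~R * (2 * pi)).
  have /andP[] := floor_itv ((x + pi) / (2 * pi)).
  rewrite ler_pdivlMr ?mulr_gt0// ltr_pdivrMr ?mulr_gt0//.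
  rewrite /= in_itv/= /k mulrNz intrD1; set z := _%:~R => h3 h4.
  by apply/andP; split; lra.
rewrite -(@periodicZ f k)// -[RHS](@periodicZ g k)//.
case: k kc => n kc; first by have := x1 n; rewrite expr0 mul1r; apply.
have := x2 n.+1; rewrite expr1 mulN1r; move: kc; rewrite NegzE mulrNz => kc.
by apply.
Unshelve. all: by end_near. Qed.

Definition trig_series u v x : R :=
  limn (series (fun k => u k * cos (k%:R * x) + v k * sin (k%:R * x))).

Definition abs_summable u := cvgn (series (fun k => `|u k|)).

Lemma abs_summable_le u v : (forall k, `|u k| <= v k) -> cvgn (series v) -> abs_summable u.
Proof. by move=> uv cv; apply: series_le_cvg cv => // k; exact: le_trans (uv k). Qed.

Lemma trig_term_le u v k x :
  `|u k * cos (k%:R * x) + v k * sin (k%:R * x)| <= `|u k| + `|v k|.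
Proof.
rewrite (le_trans (ler_normD _ _))// !normrM.
by rewrite lerD// ler_piMr ?cos_max ?sin_max.
Qed.

Lemma abs_summableD u v : abs_summable u -> abs_summable v ->
  cvgn (series (fun k => `|u k| + `|v k|)).
Proof. by move=> su sv; exact: (is_cvg_seriesD su sv). Qed.

Lemma trig_series_cvg u v x : abs_summable u -> abs_summable v ->
  cvgn (series (fun k => u k * cos (k%:R * x) + v k * sin (k%:R * x))).
Proof.
move=> su sv; apply: (normal_series_cvg _ (abs_summableD su sv)) => n.
exact: trig_term_le.
Qed.

Lemma trig_series_bound u v x : abs_summable u -> abs_summable v ->
  `|trig_series u v x| <= limn (series (fun k => `|u k| + `|v k|)).
Proof.
move=> su sv; apply: (normal_series_le _ (abs_summableD su sv)) => n.
exact: trig_term_le.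
Qed.

Lemma trig_series_measurable u v : abs_summable u -> abs_summable v ->
  measurable_fun [set: R] (trig_series u v).
Proof.
move=> su sv; apply: (measurable_fun_cvg (h := fun n x =>
  series (fun k => u k * cos (k%:R * x) + v k * sin (k%:R * x)) n)).
  move=> m; apply: measurable_sum => k; apply: continuous_measurable_fun.
  apply: continuous_addf; apply: continuous_cmulf.
    exact: continuous_cosZ.
  exact: continuous_sinZ.
by move=> x _; exact: trig_series_cvg.
Qed.

Lemma cosDnat2pi x (n : nat) : cos (x + n%:R * (2 * pi)) = cos x.
Proof.
have := @periodicZ cos n x; apply => y.
by rewrite mulr_natl cosD2pi.
Qed.

Lemma sinDnat2pi x (n : nat) : sin (x + n%:R * (2 * pi)) = sin x.
Proof.
have := @periodicZ sin n x; apply => y.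
by rewrite mulr_natl sinD2pi.
Qed.

Lemma trig_series_periodic u v : Defs.periodic (trig_series u v).
Proof.
move=> x; rewrite /trig_series; congr (limn (series _)); apply/funext => k.
by rewrite mulrDr cosDnat2pi sinDnat2pi.
Qed.

(** The domain is left general because the exchange is used on the circle and also on the truncated
    window of the Hilbert transform. *)
Lemma trig_series_Rintegral (D : set (measurableTypeR R)) u v h :
  measurable D -> abs_summable u -> abs_summable v -> mu.-integrable D (EFin \o h) ->
  mu.-integrable D (EFin \o (fun x => trig_series u v x * h x)) /\
  series (fun k => \int[mu]_(x in D)
     ((u k * cos (k%:R * x) + v k * sin (k%:R * x)) * h x)) @ \oo -->
     \int[mu]_(x in D) (trig_series u v x * h x).
Proof.
move=> mD su sv hi.
have mh : measurable_fun D h by apply/measurable_EFinP; exact: measurable_int hi.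
have := @Rintegral_series _ (measurableTypeR R) R mu D
  (fun k x => (u k * cos (k%:R * x) + v k * sin (k%:R * x)) * h x)
  (fun k => `|u k| + `|v k|) (fun x => `|h x|) mD _ _ _ (abs_summableD su sv).
have -> : (fun x => limn (series (fun k =>
    (u k * cos (k%:R * x) + v k * sin (k%:R * x)) * h x))) =
    (fun x => trig_series u v x * h x).
  apply/funext => x; rewrite /trig_series mulrC.
  have := @lim_seriesZ R (fun k => u k * cos (k%:R * x) + v k * sin (k%:R * x)) (h x)
    (trig_series_cvg su sv).
  rewrite -[RHS]/(h x * _) => <-; congr (limn (series _)).
  by apply/funext => k; rewrite mulrC.
apply.
- move=> n; apply: measurable_funM => //; apply: measurable_funTS.
  apply: continuous_measurable_fun; apply: continuous_addf; apply: continuous_cmulf.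
    exact: continuous_cosZ.
  exact: continuous_sinZ.
- exact: integrable_norm hi.
- by move=> n x _; rewrite normrM ler_wpM2r//; exact: trig_term_le.
Qed.

Lemma trig_series_integral u v h : abs_summable u -> abs_summable v ->
  circle_integrable h ->
  circle_integrable (fun x => trig_series u v x * h x) /\
  series (fun k => u k * fcos h k + v k * fsin h k) @ \oo -->
     circle_integral (fun x => trig_series u v x * h x).
Proof.
move=> su sv hi; have [h1 h2] := trig_series_Rintegral measurable_circ su sv hi.
split => //; rewrite (_ : (fun k => _) = (fun k => \int[mu]_(x in circ)
     ((u k * cos (k%:R * x) + v k * sin (k%:R * x)) * h x)))//; apply/funext => k.
have ic := circle_integrableM hi (@continuous_cosZ R k%:R).
have is_ := circle_integrableM hi (@continuous_sinZ R k%:R).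
rewrite -(circle_integralZ _ ic) -(circle_integralZ _ is_) -circle_integralD; last 2 first.
- exact: circle_integrableZ.
- exact: circle_integrableZ.
congr circle_integral; apply/funext => x; ring.
Qed.

Lemma sin_intpi j : sin (j%:~R * pi) = 0 :> R.
Proof.
have H (n : nat) : sin (n%:R * pi) = 0 :> R.
  elim: n => [|n IH]; first by rewrite mul0r sin0.
  by rewrite -natr1 mulrDl mul1r sinDpi IH oppr0.
by case: j => n; rewrite ?NegzE ?mulrNz ?mulNr ?sinN H ?oppr0.
Qed.

Lemma integral_cos j : circle_integral (fun x : R => cos (j%:~R * x)) =
  if j == 0 then 2 * pi else 0.
Proof.
case: eqP => [->|/eqP j0].
  have dF x : is_derive x (1 : R) (id : R -> R) (cos (0%:~R * x)).
    by rewrite mulr0z mul0r cos0; exact: is_derive_id.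
  rewrite (circle_integral_FTC dF); first by rewrite opprK mulr_natl mulr2n.
  exact: continuous_cosZ.
have jr : j%:~R != 0 :> R by rewrite intr_eq0.
have dF (x : R) : is_derive x (1 : R) (fun x => j%:~R^-1 * sin (j%:~R * x)) (cos (j%:~R * x)).
  apply: (is_derive_eq (is_derive_cmulf j%:~R^-1 (is_derive_sinZ j%:~R x))).
  exact: mulKf.
rewrite (circle_integral_FTC dF); last exact: continuous_cosZ.
by rewrite mulrN sinN sin_intpi oppr0 mulr0 subr0.
Qed.

Lemma integral_sin j : circle_integral (fun x : R => sin (j%:~R * x)) = 0.
Proof.
have [->|j0] := eqVneq j 0.
  rewrite (_ : (fun x => _) = cst 0).
    by rewrite /circle_integral /Rintegral integral0.
  by apply/funext => x; rewrite mulr0z mul0r sin0.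
have jr : j%:~R != 0 :> R by rewrite intr_eq0.
have dF (x : R) : is_derive x (1 : R) (fun x => - j%:~R^-1 * cos (j%:~R * x)) (sin (j%:~R * x)).
  apply: (is_derive_eq (is_derive_cmulf (- j%:~R^-1) (is_derive_cosZ j%:~R x))).
  by rewrite !mulNr mulrN opprK mulKf.
rewrite (circle_integral_FTC dF); last exact: continuous_sinZ.
by rewrite mulrN cosN subrr.
Qed.

Lemma integral_half_sum (F1 F2 : R -> R) (e : R) : continuous F1 -> continuous F2 ->
  circle_integral (fun x => 2^-1 * (F1 x + e * F2 x)) =
  2^-1 * (circle_integral F1 + e * circle_integral F2).
Proof.
move=> c1 c2; have i1 := continuous_circle_integrable c1.
have i2 := continuous_circle_integrable c2.
have ei2 := circle_integrableZ e i2.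
by rewrite circle_integralZ ?circle_integralD ?circle_integralZ//; exact: circle_integrableD.
Qed.

Lemma fcos_cos j k : fcos (fun x : R => cos (j%:~R * x)) k =
  2^-1 * ((if j + k == 0 then 2 * pi else 0) + (if j - k == 0 then 2 * pi else 0)).
Proof.
rewrite -!integral_cos -[X in _ * (_ + X)]mul1r.
rewrite -integral_half_sum; [|exact: continuous_cosZ|exact: continuous_cosZ].
congr circle_integral; apply/funext => x.
by rewrite intrD intrB mulrDl mulrBl cosB cosD; field.
Qed.

Lemma fsin_cos j k : fsin (fun x : R => cos (j%:~R * x)) k = 0.
Proof.
transitivity (2^-1 * (circle_integral (fun x : R => sin ((j + k)%:~R * x)) +
  (-1) * circle_integral (fun x : R => sin ((j - k)%:~R * x)))).
  rewrite -integral_half_sum; [|exact: continuous_sinZ|exact: continuous_sinZ].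
  congr circle_integral; apply/funext => x.
  by rewrite intrD intrB mulrDl mulrBl sinB sinD; field.
by rewrite !integral_sin mulr0 addr0 mulr0.
Qed.

Lemma fcos_sin j k : fcos (fun x : R => sin (j%:~R * x)) k = 0.
Proof.
transitivity (2^-1 * (circle_integral (fun x : R => sin ((j + k)%:~R * x)) +
  1 * circle_integral (fun x : R => sin ((j - k)%:~R * x)))).
  rewrite -integral_half_sum; [|exact: continuous_sinZ|exact: continuous_sinZ].
  congr circle_integral; apply/funext => x.
  by rewrite intrD intrB mulrDl mulrBl sinB sinD; field.
by rewrite !integral_sin mulr0 addr0 mulr0.
Qed.

Lemma fsin_sin j k : fsin (fun x : R => sin (j%:~R * x)) k =
  2^-1 * ((if j - k == 0 then 2 * pi else 0) - (if j + k == 0 then 2 * pi else 0)).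
Proof.
rewrite -!integral_cos -[X in _ * (_ + X)]mulN1r.
rewrite -integral_half_sum; [|exact: continuous_cosZ|exact: continuous_cosZ].
congr circle_integral; apply/funext => x.
by rewrite intrB intrD mulrBl mulrDl cosB cosD; field.
Qed.

Lemma series_single u (n : nat) : (forall k, k != n -> u k = 0) ->
  series u @ \oo --> u n.
Proof.
move=> u0; apply: cvg_near_cst; exists n.+1 => // m /= nm.
rewrite /series/= (bigD1_seq n)/= ?iota_uniq ?mem_index_iota//.
by rewrite big1 ?addr0// => k /u0.
Qed.

Lemma fcos_trig_series u v (n : nat) : abs_summable u -> abs_summable v ->
  fcos (trig_series u v) n%:Z = (if n is 0%N then 2 * pi else pi) * u n.
Proof.
move=> su sv.
have [_ h] := trig_series_integral su sv (continuous_circle_integrable (@continuous_cosZ R n%:R)).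
apply: (cvg_unique _ h); first exact: norm_hausdorff.
have E k : u k * fcos (fun x : R => cos (n%:R * x)) k%:Z +
    v k * fsin (fun x : R => cos (n%:R * x)) k%:Z =
    if k == n then (if n is 0%N then 2 * pi else pi) * u n else 0.
  have := @fcos_cos n k; have := @fsin_cos n k; rewrite -!pmulrn => -> ->.
  rewrite mulr0 addr0 subr_eq0 -PoszD !eqz_nat addn_eq0.
  have [->|kn] := eqVneq k n.
    by case: (n) => [|m]/=; [rewrite -mulrDr; field|rewrite add0r; field].
  case: ifP => [/andP[/eqP n0 /eqP k0]|_]; first by rewrite n0 k0 in kn.
  by rewrite addr0 !mulr0.
rewrite /= (_ : (fun k => _) = fun k => if k == n then (if n is 0%N then 2 * pi else pi) * u n else 0); last exact/funext.
have := @series_single (fun k => if k == n then (if n is 0%N then 2 * pi else pi) * u n else 0) n.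
by rewrite eqxx; apply => k /negbTE ->.
Qed.

Lemma fsin_trig_series u v (n : nat) : abs_summable u -> abs_summable v ->
  fsin (trig_series u v) n.+1%:Z = pi * v n.+1.
Proof.
move=> su sv.
have [_ h] := trig_series_integral su sv (continuous_circle_integrable (@continuous_sinZ R n.+1%:R)).
apply: (cvg_unique _ h); first exact: norm_hausdorff.
have E k : u k * fcos (fun x : R => sin (n.+1%:R * x)) k%:Z +
    v k * fsin (fun x : R => sin (n.+1%:R * x)) k%:Z =
    if k == n.+1 then pi * v n.+1 else 0.
  have := @fcos_sin n.+1 k; have := @fsin_sin n.+1 k; rewrite -!pmulrn => -> ->.
  rewrite mulr0 add0r subr_eq0 -PoszD !eqz_nat addn_eq0/=.
  have [->|kn] := eqVneq k n.+1; first by field.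
  by rewrite subr0 !mulr0.
rewrite /= (_ : (fun k => _) = fun k => if k == n.+1 then pi * v n.+1 else 0); last exact/funext.
have := @series_single (fun k => if k == n.+1 then pi * v n.+1 else 0) n.+1.
by rewrite eqxx; apply => k /negbTE ->.
Qed.

End TrigSeries.

(** * Parseval's formula and the coefficients of J B_x *)

Section Pairing.
Context {R : realType}.
Local Notation mu := (@lebesgue_measure R).
Local Notation circ := (`[- pi, pi]%classic : set (measurableTypeR R)).
Implicit Types (f g h : R -> R) (c x y : R) (j : int) (u v : nat -> R).

Definition acoef f (k : nat) : R := (if k is 0%N then 2 * pi else pi)^-1 * fcos f k%:Z.
Definition bcoef f (k : nat) : R := pi^-1 * fsin f k%:Z.

Lemma fsinN f j : circle_integrable f -> fsin f (- j) = - fsin f j.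
Proof.
move=> fi; rewrite /fsin -[RHS]mulN1r -circle_integralZ; last first.
  exact: (circle_integrableM fi (@continuous_sinZ R j%:~R)).
by congr circle_integral; apply/funext => x; rewrite mulrNz mulNr sinN; ring.
Qed.

Lemma fsin0 f : fsin f 0 = 0.
Proof.
rewrite /fsin (_ : (fun x => _) = cst 0).
  by rewrite /circle_integral /Rintegral integral0.
by apply/funext => x; rewrite mulr0z mul0r sin0 mulr0.
Qed.

Lemma abs_summable_scale c u : abs_summable u ->
  cvgn (series (fun k => c * `|u k|)).
Proof.
move=> su; rewrite (_ : (fun k => _) = c *: (fun k => `|u k|) :> (nat -> R)) //.
exact: is_cvg_seriesZ su.
Qed.

Lemma abs_summable_coefs f : abs_summable (fun k => fcos f k%:Z) ->
  abs_summable (fun k => fsin f k%:Z) -> abs_summable (acoef f) /\ abs_summable (bcoef f).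
Proof.
move=> sc ss; have pi0 := pi_gt0 R; have pii : 0 < (pi : R)^-1 by rewrite invr_gt0.
split.
  apply: (@abs_summable_le _ _ (fun k => (pi : R)^-1 * `|fcos f k%:Z|)).
    move=> k; rewrite /acoef normrM ler_wpM2r//.
    have pii2 : 0 < (2 * pi : R)^-1 by rewrite invr_gt0 mulr_gt0.
    case: k => [|k]; last by rewrite ger0_norm ?(ltW pii).
    by rewrite ger0_norm ?(ltW pii2)// lef_pV2 ?posrE ?mulr_gt0//; lra.
  exact: abs_summable_scale.
apply: (@abs_summable_le _ _ (fun k => (pi : R)^-1 * `|fsin f k%:Z|)).
  by move=> k; rewrite /bcoef normrM (ger0_norm (ltW pii)).
exact: abs_summable_scale.
Qed.

Lemma trig_series_circle_integrable u v : abs_summable u -> abs_summable v ->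
  circle_integrable (trig_series u v).
Proof.
move=> su sv.
have c1 : continuous ((fun=> 1) : R -> R) by move=> x; exact: cvg_cst.
have [+ _] := trig_series_integral su sv (continuous_circle_integrable c1).
by rewrite (_ : (fun x => _) = trig_series u v)//; apply/funext => x; rewrite mulr1.
Qed.

Lemma trig_series_repr f : circle_integrable f ->
  abs_summable (fun k => fcos f k%:Z) -> abs_summable (fun k => fsin f k%:Z) ->
  {ae mu, forall x, circ x -> f x = trig_series (acoef f) (bcoef f) x}.
Proof.
move=> fi sc ss; have [sa sb] := abs_summable_coefs sc ss.
set F := trig_series _ _.
have Fi : circle_integrable F by exact: trig_series_circle_integrable.
have NFi := circle_integrableZ (-1) Fi.
have gi := circle_integrableD fi NFi.
have pi0 := pi_gt0 R.
have H1 (n : nat) : fcos (fun x => f x + -1 * F x) n = 0.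
  rewrite /fcos (_ : (fun x => _) = (fun x => f x * cos (n%:~R * x) + -1 * (F x * cos (n%:~R * x)))); last first.
    by apply/funext => x; ring.
  have i1 := circle_integrableM fi (@continuous_cosZ R n%:~R).
  have i2 := circle_integrableM Fi (@continuous_cosZ R n%:~R).
  have i3 := circle_integrableZ (-1) i2.
  rewrite circle_integralD// circle_integralZ// -!/(fcos _ _) fcos_trig_series//.
  rewrite /acoef mulVKf; first by rewrite mulN1r subrr.
  by case: (n) => *; rewrite gt_eqF// mulr_gt0.
have H2 (n : nat) : fsin (fun x => f x + -1 * F x) n = 0.
  case: n => [|n]; first exact: fsin0.
  rewrite /fsin (_ : (fun x => _) = (fun x => f x * sin (n.+1%:~R * x) + -1 * (F x * sin (n.+1%:~R * x)))); last first.
    by apply/funext => x; ring.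
  have i1 := circle_integrableM fi (@continuous_sinZ R n.+1%:~R).
  have i2 := circle_integrableM Fi (@continuous_sinZ R n.+1%:~R).
  have i3 := circle_integrableZ (-1) i2.
  rewrite circle_integralD// circle_integralZ// -!/(fsin _ _) fsin_trig_series//.
  by rewrite /bcoef mulVKf ?gt_eqF// mulN1r subrr.
have := fourier_unique gi _ _.
have h1 j : fcos (fun x => f x + -1 * F x) j = 0.
  by case: j => n; rewrite ?NegzE ?fcosN H1.
have h2 j : fsin (fun x => f x + -1 * F x) j = 0.
  by case: j => n; rewrite ?NegzE ?fsinN// H2 ?oppr0.
move=> /(_ h1 h2); apply: filterS => x + xc => /(_ xc).
by rewrite mulN1r => /eqP; rewrite subr_eq0 => /eqP.
Qed.

(** Parseval's formula with all the regularity on one side: f is replaced almost everywhere by its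
    normally convergent series, and g need only be integrable. The second factor can thus be the
    product J B_x itself, or one factor of it times a cosine. *)
Lemma fourier_pairing f g : circle_integrable f -> circle_integrable g ->
  abs_summable (fun k => fcos f k%:Z) -> abs_summable (fun k => fsin f k%:Z) ->
  series (fun k => acoef f k * fcos g k%:Z + bcoef f k * fsin g k%:Z) @ \oo -->
    circle_integral (fun x => f x * g x).
Proof.
move=> fi gi sc ss; have [sa sb] := abs_summable_coefs sc ss.
have [ig h] := trig_series_integral sa sb gi.
rewrite (_ : circle_integral (fun x => f x * g x) =
  circle_integral (fun x => trig_series (acoef f) (bcoef f) x * g x))//.
rewrite /circle_integral /Rintegral; congr fine.
apply: ae_eq_integral => //.
- apply/measurable_EFinP; apply: measurable_funM; apply/measurable_EFinP.
    exact: measurable_int fi.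
  exact: measurable_int gi.
- exact: measurable_int ig.
- by have := trig_series_repr fi sc ss; apply: filterS => x + xc => /(_ xc) /= ->.
Qed.

Lemma L2_circle_integrable f : L2 f -> circle_integrable f.
Proof.
move=> [_ mf f2].
have c1 : continuous ((fun=> 1) : R -> R) by move=> x; exact: cvg_cst.
have i1 := circle_integrableD (continuous_circle_integrable c1) f2.
apply: (le_integrable measurable_circ _ _ i1).
  by apply/measurable_EFinP; exact: measurable_funTS.
move=> x _ /=; rewrite lee_fin [leRHS]ger0_norm ?addr_ge0 ?sqr_ge0//.
rewrite -[f x ^+ 2]real_normK ?num_real//.
by have := sqr_ge0 (`|f x| - 1); have := normr_ge0 (f x); nra.
Qed.

Lemma L2_mul_circle_integrable f g : L2 f -> L2 g ->
  circle_integrable (fun x => f x * g x).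
Proof.
move=> [_ mf f2] [_ mg g2].
have i1 := circle_integrableD f2 g2.
apply: (le_integrable measurable_circ _ _ i1).
  by apply/measurable_EFinP; apply: measurable_funTS; exact: measurable_funM.
move=> x _ /=; rewrite lee_fin [leRHS]ger0_norm ?addr_ge0 ?sqr_ge0// ler_norml.
by have := sqr_ge0 (f x - g x); have := sqr_ge0 (f x + g x); have := sqr_ge0 (f x); have := sqr_ge0 (g x);
  move=> *; apply/andP; split; lra.
Qed.

Lemma abs_summable_cvg0 u : abs_summable u -> u @ \oo --> 0.
Proof.
move=> su; apply: cvg_series_cvg_0; apply: (normal_series_cvg _ su) => n.
exact: lexx.
Qed.

Lemma integral_mul_half f (F1 F2 : R -> R) (e : R) : circle_integrable f ->
  continuous F1 -> continuous F2 ->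
  circle_integral (fun x => f x * (2^-1 * (F1 x + e * F2 x))) =
  2^-1 * (circle_integral (fun x => f x * F1 x) + e * circle_integral (fun x => f x * F2 x)).
Proof.
move=> fi c1 c2.
have i1 := circle_integrableM fi c1; have i2 := circle_integrableM fi c2.
have ei2 := circle_integrableZ e i2; have i12 := circle_integrableD i1 ei2.
rewrite -(circle_integralZ e i2) -circle_integralD// -circle_integralZ//.
by congr circle_integral; apply/funext => x; ring.
Qed.

(* Interactions between frequencies of opposite signs telescope, because
   [l m (p l q m - q l p m)] is antisymmetric in [(l, m)]. *)
Lemma telescoping_series (n : R) (k : nat) (t h : nat -> R) :
  (0 < k)%N -> t 0%N = 0 -> h @ \oo --> 0 ->
  (forall l, (k < l)%N -> t l = h l - h (l - k)%N) ->
  \sum_(1 <= l < k.+1) (t l - h l) = n ->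
  series t @ \oo --> n.
Proof.
move=> k0 t0 h0 th tn.
have part N : \sum_(1 <= l < (N + k).+1) t l =
    n + \sum_(N.+1 <= l < (N + k).+1) h l.
  elim: N => [|N IH].
    rewrite add0n -tn -big_split/=; apply: eq_bigr => l _; ring.
  rewrite addSn big_nat_recr//= IH th; last by lia.
  have -> : ((N + k).+1 - k = N.+1)%N by lia.
  rewrite [in LHS]big_ltn; last by lia.
  rewrite [in RHS]big_nat_recr/=; last by lia.
  ring.
have hsum : (fun N => \sum_(N.+1 <= l < (N + k).+1) h l) @ \oo --> 0.
  have -> : (fun N => \sum_(N.+1 <= l < (N + k).+1) h l) =
      (fun N => \sum_(0 <= i < k) h (i + N.+1)%N).
    apply/funext => N; rewrite -[N.+1 in LHS]add0n big_addn.
    by rewrite subSS addKn.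
  elim: (k) => [|m IH].
    rewrite (_ : (fun N => _) = (fun _ : nat => 0 : R)); first exact: cvg_cst.
    by apply/funext => N; rewrite big_geq.
  have hm : (fun N => h (m + N.+1)%N) @ \oo --> 0.
    rewrite (_ : (fun N => _) = (fun N => h (N + m.+1)%N)).
      by rewrite (cvg_shiftn m.+1 h).
    by apply/funext => N; rewrite addnC addSnnS.
  rewrite (_ : (fun N => \sum_(0 <= i < m.+1) h (i + N.+1)%N) =
    (fun N => \sum_(0 <= i < m) h (i + N.+1)%N) + (fun N => h (m + N.+1)%N)).
    by have := cvgD IH hm; rewrite addr0 => H; exact: H.
  by apply/funext => N; rewrite big_nat_recr.
have nsum : (fun N => n + \sum_(N.+1 <= l < (N + k).+1) h l) @ \oo --> n.
  have cn : (fun _ : nat => n) @ \oo --> n by exact: cvg_cst.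
  by have := cvgD cn hsum; rewrite addr0 => H; exact: H.
rewrite -(cvg_shiftn k.+1) (_ : (fun N => _) = (fun N => n + \sum_(N.+1 <= l < (N + k).+1) h l))//.
by apply/funext => N; rewrite -part /series/= addnS big_ltn// t0 add0r.
Qed.

Section ProductCoefs.
Variables (J D : R -> R) (p q : nat -> R).
Hypothesis Ji : circle_integrable J.
Hypothesis Di : circle_integrable D.
Hypothesis Jc : forall k : nat, fcos J k = - (2 * pi) * (k%:R * p k).
Hypothesis Js : forall k : nat, fsin J k = 2 * pi * (k%:R * q k).
Hypothesis Dc : forall k : nat, fcos D k = - (2 * pi) * (k%:R * q k).
Hypothesis Ds : forall k : nat, fsin D k = - (2 * pi) * (k%:R * p k).
Hypothesis sp : abs_summable (fun k => k%:R * p k).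
Hypothesis sq : abs_summable (fun k => k%:R * q k).

Let sJc : abs_summable (fun k => fcos J k%:Z).
Proof.
rewrite (_ : (fun k => _) = (fun k => - (2 * pi) * (k%:R * p k))); last exact/funext.
apply: (@abs_summable_le _ _ (fun k => `|- (2 * pi)| * `|k%:R * p k|)).
  by move=> k; rewrite normrM.
exact: abs_summable_scale.
Qed.

Let sJs : abs_summable (fun k => fsin J k%:Z).
Proof.
rewrite (_ : (fun k => _) = (fun k => (2 * pi) * (k%:R * q k))); last exact/funext.
apply: (@abs_summable_le _ _ (fun k => `|2 * pi| * `|k%:R * q k|)).
  by move=> k; rewrite normrM.
exact: abs_summable_scale.
Qed.

Let fcosD_sub (l k : nat) : (l <= k)%N ->
  fcos D (l%:Z - k%:Z) = fcos D (k - l)%N.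
Proof. by move=> lk; rewrite -opprB fcosN subzn. Qed.

Let fsinD_sub (l k : nat) : (l <= k)%N ->
  fsin D (l%:Z - k%:Z) = - fsin D (k - l)%N.
Proof. by move=> lk; rewrite -opprB fsinN// subzn. Qed.

Let h_cvg0 (k : nat) (a b c d : nat -> R) :
  abs_summable a -> abs_summable b -> abs_summable c -> abs_summable d ->
  (fun l => a l * b (l + k)%N + c l * d (l + k)%N) @ \oo --> 0.
Proof.
move=> /abs_summable_cvg0 a0 /abs_summable_cvg0 b0 /abs_summable_cvg0 c0 /abs_summable_cvg0 d0.
have {}b0 : (fun l => b (l + k)%N) @ \oo --> 0 by rewrite (cvg_shiftn k b).
have {}d0 : (fun l => d (l + k)%N) @ \oo --> 0 by rewrite (cvg_shiftn k d).
by have := cvgD (cvgM a0 b0) (cvgM c0 d0); rewrite !mulr0 addr0 => H; exact: H.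
Qed.

Let acoefJ l : acoef J l = - 2 * (l%:R * p l).
Proof.
have pi0 : pi != 0 :> R by rewrite gt_eqF ?pi_gt0.
rewrite /acoef Jc; move: (pi : R) pi0 => c c0; case: l => [|l]; last by field.
by rewrite !mul0r !mulr0.
Qed.

Let bcoefJ l : bcoef J l = 2 * (l%:R * q l).
Proof.
have pi0 : pi != 0 :> R by rewrite gt_eqF ?pi_gt0.
by rewrite /bcoef Js; move: (pi : R) pi0 => c c0; field.
Qed.

Let P (l : nat) := l%:R * p l.
Let Q (l : nat) := l%:R * q l.

(** Pairing J with D cos(k x) brings in the coefficients of D at l + k and at l - k. The first give
    [h l] and, for l > k, the second give - h (l - k), so that these interactions telescope. Only l
    < k survives; at l = k the coefficients of D at frequency 0 vanish. *)
Lemma product_cos_coef (k : nat) : fcos (fun x => J x * D x) k =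
  2 * pi * \sum_(1 <= l < k) l%:R * (k - l)%:R *
    (p l * q (k - l)%N + q l * p (k - l)%N).
Proof.
have Dk := circle_integrableM Di (@continuous_cosZ R k%:R).
have := fourier_pairing Ji Dk sJc sJs.
have -> : circle_integral (fun x => J x * (D x * cos (k%:R * x))) =
    fcos (fun x => J x * D x) k.
  by congr circle_integral; apply/funext => x; rewrite mulrA.
move=> /(cvg_unique (@norm_hausdorff _ R)); apply.
pose h (l : nat) := 2 * pi * (P l * Q (l + k)%N + (- Q l) * P (l + k)%N).
have tE (l : nat) : acoef J l * fcos (fun x => D x * cos (k%:R * x)) l +
    bcoef J l * fsin (fun x => D x * cos (k%:R * x)) l =
    h l + (- P l * fcos D (l%:Z - k%:Z) + Q l * fsin D (l%:Z - k%:Z)).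
  rewrite acoefJ bcoefJ /h -/(P l) -/(Q l).
  have -> : fcos (fun x => D x * cos (k%:R * x)) l =
      2^-1 * (fcos D (l%:Z + k%:Z) + 1 * fcos D (l%:Z - k%:Z)).
    rewrite -integral_mul_half//; [|exact: continuous_cosZ|exact: continuous_cosZ].
    congr circle_integral; apply/funext => x.
    by rewrite intrD intrB mulrDl mulrBl cosB cosD -!pmulrn; field.
  have -> : fsin (fun x => D x * cos (k%:R * x)) l =
      2^-1 * (fsin D (l%:Z + k%:Z) + 1 * fsin D (l%:Z - k%:Z)).
    rewrite -integral_mul_half//; [|exact: continuous_sinZ|exact: continuous_sinZ].
    congr circle_integral; apply/funext => x.
    by rewrite intrD intrB mulrDl mulrBl sinB sinD -!pmulrn; field.
  by rewrite -PoszD Dc Ds -/(P _) -/(Q _); field.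
have h0 : h @ \oo --> 0.
  have sNq : abs_summable (fun l => - Q l).
    by apply: (abs_summable_le _ sq) => l; rewrite normrN.
  have cc : (fun _ : nat => 2 * pi : R) @ \oo --> (2 * pi : R) by exact: cvg_cst.
  by have := cvgM cc (h_cvg0 k sp sq sNq sp); rewrite mulr0 => H; exact: H.
have fc0 : fcos D 0 = 0 by have := Dc 0; rewrite mul0r mulr0.
(* At frequency 0 the series vanishes term by term: J B_x has zero mean, which is why the mean of B
   is conserved. *)
have [k0|k0] := posnP k.
  subst k; rewrite big_geq// mulr0; rewrite (_ : (fun l : nat => _) = (fun _ : nat => 0 : R)).
    rewrite (_ : series _ = fun _ : nat => 0 : R); first exact: cvg_cst.
    by apply/funext => n; rewrite /series/= big1.
  apply/funext => l; rewrite tE subr0 /h addn0 Dc Ds -/(P _) -/(Q _); ring.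
apply: (telescoping_series k0 _ h0).
- by rewrite acoefJ bcoefJ !mul0r !mulr0 !mul0r addr0.
- move=> l kl; rewrite tE subzn ?(ltnW kl)// Dc Ds -/(P _) -/(Q _).
  by rewrite /h subnK ?(ltnW kl)//; ring.
- under eq_bigr do rewrite tE addrAC subrr add0r.
  rewrite big_nat_recr//= subrr fc0 fsin0 !mulr0 !addr0 mulr_sumr.
  apply: eq_big_nat => l /andP[l1 lk].
  rewrite fcosD_sub ?(ltnW lk)// fsinD_sub ?(ltnW lk)// Dc Ds /P /Q; ring.
Qed.

Lemma product_sin_coef (k : nat) : fsin (fun x => J x * D x) k =
  2 * pi * \sum_(1 <= l < k) l%:R * (k - l)%:R *
    (p l * p (k - l)%N - q l * q (k - l)%N).
Proof.
have [->|k0] := posnP k; first by rewrite fsin0 big_geq// mulr0.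
have Dk := circle_integrableM Di (@continuous_sinZ R k%:R).
have := fourier_pairing Ji Dk sJc sJs.
have -> : circle_integral (fun x => J x * (D x * sin (k%:R * x))) =
    fsin (fun x => J x * D x) k.
  by congr circle_integral; apply/funext => x; rewrite mulrA.
move=> /(cvg_unique (@norm_hausdorff _ R)); apply.
pose h (l : nat) := 2 * pi * (P l * P (l + k)%N + Q l * Q (l + k)%N).
have tE (l : nat) : acoef J l * fcos (fun x => D x * sin (k%:R * x)) l +
    bcoef J l * fsin (fun x => D x * sin (k%:R * x)) l =
    h l + (P l * fsin D (l%:Z - k%:Z) + Q l * fcos D (l%:Z - k%:Z)).
  rewrite acoefJ bcoefJ /h -/(P l) -/(Q l).
  have -> : fcos (fun x => D x * sin (k%:R * x)) l =
      2^-1 * (fsin D (l%:Z + k%:Z) + (-1) * fsin D (l%:Z - k%:Z)).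
    rewrite -integral_mul_half//; [|exact: continuous_sinZ|exact: continuous_sinZ].
    congr circle_integral; apply/funext => x.
    by rewrite intrD intrB mulrDl mulrBl sinB sinD -!pmulrn; field.
  have -> : fsin (fun x => D x * sin (k%:R * x)) l =
      2^-1 * (fcos D (l%:Z - k%:Z) + (-1) * fcos D (l%:Z + k%:Z)).
    rewrite -integral_mul_half//; [|exact: continuous_cosZ|exact: continuous_cosZ].
    congr circle_integral; apply/funext => x.
    by rewrite intrB intrD mulrBl mulrDl cosB cosD -!pmulrn; field.
  by rewrite -PoszD Dc Ds -/(P _) -/(Q _); field.
have h0 : h @ \oo --> 0.
  have cc : (fun _ : nat => 2 * pi : R) @ \oo --> (2 * pi : R) by exact: cvg_cst.
  by have := cvgM cc (h_cvg0 k sp sp sq sq); rewrite mulr0 => H; exact: H.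
have fc0 : fcos D 0 = 0 by have := Dc 0; rewrite mul0r mulr0.
apply: (telescoping_series k0 _ h0).
- by rewrite acoefJ bcoefJ !mul0r !mulr0 !mul0r addr0.
- move=> l kl; rewrite tE subzn ?(ltnW kl)// Dc Ds -/(P _) -/(Q _).
  by rewrite /h subnK ?(ltnW kl)//; ring.
- under eq_bigr do rewrite tE addrAC subrr add0r.
  rewrite big_nat_recr//= subrr fc0 fsin0 !mulr0 !addr0 mulr_sumr.
  apply: eq_big_nat => l /andP[l1 lk].
  rewrite fcosD_sub ?(ltnW lk)// fsinD_sub ?(ltnW lk)// Dc Ds /P /Q; ring.
Qed.

End ProductCoefs.

End Pairing.

(** * Sobolev norms *)

Section SobolevNorm.
Context {R : realType}.
Implicit Types (f g : R -> R) (c x y s : R).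

Definition fourier_energy f (k : nat) : R :=
  (2 * pi)^-1 ^+ 2 * (fcos f k%:Z ^+ 2 + fsin f k%:Z ^+ 2).

Definition sobolev_energy s f (k : nat) : R :=
  (1 + k%:R ^+ 2) `^ s * fourier_energy f k.

Lemma fourier_energy_ge0 f k : 0 <= fourier_energy f k.
Proof. by rewrite mulr_ge0 ?addr_ge0 ?sqr_ge0. Qed.

Lemma sobolev_energy_ge0 s f k : 0 <= sobolev_energy s f k.
Proof. by rewrite mulr_ge0 ?powR_ge0 ?fourier_energy_ge0. Qed.

Lemma fourier_coefE f (k : int) : fourier_coef f k =
  ((2 * pi)^-1 * fcos f k +i* - ((2 * pi)^-1 * fsin f k))%C.
Proof. by []. Qed.

Lemma normc_fourier_coef f (k : int) : circle_integrable f ->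
  ComplexField.Normc.normc (fourier_coef f k) ^+ 2 = fourier_energy f `|k|%N.
Proof.
move=> fi; rewrite fourier_coefE /= sqr_sqrtr ?addr_ge0 ?sqr_ge0// /fourier_energy.
have H (n : nat) : fcos f n ^+ 2 + fsin f n ^+ 2 = fcos f n ^+ 2 + (- fsin f n) ^+ 2.
  by rewrite sqrrN.
case: k => n; first by ring.
by rewrite NegzE fcosN fsinN// abszN; ring.
Qed.

(** The integers are split as the ranges of [Posz] and [Negz]; the absolute value of [Negz n] is n +
    1, whence the shifted second series. *)
Lemma esum_int_even (e : nat -> \bar R) : (forall k, 0 <= e k)%E ->
  \esum_(k in [set: int]) e `|k|%N =
  (\sum_(k <oo) e k + \sum_(k <oo) e k.+1)%E.
Proof.
move=> e0; rewrite (esumID [set Posz n | n in [set: nat]])//; congr (_ + _)%E.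
  rewrite setTI (@esum_set_image _ _ (fun k : int => e `|k|%N) Posz setT)//=.
    by apply: eq_eseriesl => i; rewrite in_setT.
  by move=> m n _ _ [].
have -> : [set: int] `&` ~` [set Posz n | n in [set: nat]] =
    [set Negz n | n in [set: nat]].
  rewrite setTI; apply/seteqP; split => [[n|n]|_ [n _ <-]] /=.
  - by move=> h; exfalso; apply: h; exists n.
  - by move=> _; exists n.
  - by move=> [m _].
rewrite (@esum_set_image _ _ (fun k : int => e `|k|%N) Negz setT)//=.
  by apply: eq_eseriesl => i; rewrite in_setT.
by move=> m n _ _ [].
Qed.

Lemma sobolev_normE s f : circle_integrable f ->
  sobolev_norm s f = ((\sum_(k <oo) (sobolev_energy s f k)%:E +
     \sum_(k <oo) (sobolev_energy s f k.+1)%:E) `^ 2^-1)%E.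
Proof.
move=> fi; rewrite /sobolev_norm; congr poweR.
rewrite -(esum_int_even (e := fun k => (sobolev_energy s f k)%:E)); last first.
  by move=> k; rewrite lee_fin sobolev_energy_ge0.
apply: eq_esum => k _; rewrite normc_fourier_coef// /sobolev_energy.
by congr ((1 + _) `^ _ * _)%:E; case: k => n; rewrite ?NegzE ?mulrNz ?sqrrN ?abszN.
Qed.

Lemma nneseries_EFin (h : nat -> R) : (forall k, 0 <= h k) -> cvgn (series h) ->
  (\sum_(k <oo) (h k)%:E = (limn (series h))%:E)%E.
Proof.
move=> h0 ch; apply/cvg_lim => //.
have -> : (fun n => \sum_(0 <= k < n) (h k)%:E)%E = EFin \o series h.
  by apply/funext => n; rewrite /= /series/= sumEFin.
by apply: cvg_EFin; [exact: nearW|exact: ch].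
Qed.

Lemma sobolev_norm_le s f (h : nat -> R) : circle_integrable f ->
  (forall k, sobolev_energy s f k <= h k) -> cvgn (series h) ->
  (sobolev_norm s f <= ((2 * limn (series h)) `^ 2^-1)%:E)%E.
Proof.
move=> fi eh ch; have h0 k : 0 <= h k by exact: le_trans (sobolev_energy_ge0 _ _ _) (eh k).
rewrite sobolev_normE// -poweR_EFin.
have H : (\sum_(k <oo) (sobolev_energy s f k)%:E <= (limn (series h))%:E)%E.
  rewrite -nneseries_EFin//; apply: lee_nneseries => k _.
    by rewrite lee_fin sobolev_energy_ge0.
  by rewrite lee_fin.
have H' : (\sum_(k <oo) (sobolev_energy s f k.+1)%:E <= (limn (series h))%:E)%E.
  apply: lime_le; first by apply: is_cvg_nneseries => k _ _; rewrite lee_fin sobolev_energy_ge0.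
  apply: nearW => n; rewrite sumEFin lee_fin.
  apply: le_trans (partial_sum_le_series n.+1 h0 ch).
  rewrite /series/= big_nat_recl//= -[leLHS]add0r lerD//.
  by apply: ler_sum => k _; exact: eh.
apply: gt0_ler_poweR; rewrite ?in_itv/= ?leey ?andbT ?invr_ge0//.
- by rewrite adde_ge0// nneseries_ge0// => k _; rewrite lee_fin sobolev_energy_ge0.
- by rewrite lee_fin mulr_ge0// (le_trans _ (normal_series_le (u := fun=> 0) _ ch))// => k; rewrite normr0.
- by rewrite mulr_natl mulr2n EFinD leeD.
Qed.

Lemma sobolev_norm_lty s f : circle_integrable f -> (sobolev_norm s f < +oo)%E ->
  cvgn (series (sobolev_energy s f)).
Proof.
have two0 : (2^-1 : R) != 0 by rewrite invr_eq0 pnatr_eq0.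
move=> fi; rewrite sobolev_normE// => /(lty_poweRy two0) h.
apply: nnseries_is_cvg; first exact: sobolev_energy_ge0.
apply: le_lt_trans h; rewrite leeDl// nneseries_ge0// => k _.
by rewrite lee_fin sobolev_energy_ge0.
Qed.

(** Tannery's theorem along an arbitrary filter: the tail is controlled by that of [H] uniformly in
    t, and finitely many terms tend to 0 one by one. *)
Lemma tannery (T : Type) (F : set_system T) {FF : Filter F} (h : T -> nat -> R) (H : nat -> R) :
  (\forall t \near F, forall k, 0 <= h t k <= H k) -> cvgn (series H) ->
  (forall k, h ^~ k @ F --> 0) ->
  (fun t => limn (series (h t))) @ F --> 0.
Proof.
move=> hH cH h0.
(* A negative entry of [H] contradicts the domination, so the filter then contains the empty set and
   every limit holds. *)
have [H0|FN] := pselect (forall k, 0 <= H k); last first.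
  have : \forall t \near F, False.
    by apply: filterS hH => t ht; apply: FN => k; have /andP[] := ht k; exact: le_trans.
  by move=> Ff; apply/cvgrPdist_le => e e0; apply: filterS Ff.
apply/cvgrPdist_le => e e0.
have e2 : 0 < e / 2 by rewrite divr_gt0.
have /cvgrPdist_le/(_ _ e2)[N _ HN] : series H @ \oo --> limn (series H) := cH.
have hs : (fun t => series (h t) N) @ F --> 0.
  elim: N {HN} => [|N IH].
    rewrite (_ : (fun t => _) = (fun _ => 0 : R)); first exact: cvg_cst.
    by apply/funext => t; rewrite /series/= big_geq.
  rewrite (_ : (fun t => _) = (fun t => series (h t) N) + (h ^~ N)).
    by have := cvgD IH (h0 N); rewrite addr0 => Z; exact: Z.
  by apply/funext => t; rewrite /series/= big_nat_recr.
move/cvgrPdist_le: hs => /(_ _ e2) hs.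
near=> t.
have ht : forall k, 0 <= h t k <= H k by near: t.
have st : `|0 - series (h t) N| <= e / 2 by near: t.
have ht0 k : 0 <= h t k by have /andP[] := ht k.
have cht : cvgn (series (h t)).
  by apply: series_le_cvg cH => // k; have /andP[] := ht k.
have lim0 : 0 <= limn (series (h t)).
  by apply: le_trans (partial_sum_le_series 0 ht0 cht); rewrite /series/= big_geq.
rewrite sub0r normrN ger0_norm//.
have : limn (series (h t)) <= series (h t) N + (limn (series H) - series H N).
  apply: limr_le => //; exists N => // n /= Nn.
  have := sub_series_geq (h t) Nn; have := sub_series_geq H Nn.
  have := partial_sum_le_series n H0 cH.
  have : \sum_(N <= k < n) h t k <= \sum_(N <= k < n) H k.
    by apply: ler_sum => k _; have /andP[] := ht k.
  lra.
have := HN N (leqnn N); rewrite /= ler_norml => /andP[_].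
by move: st; rewrite sub0r normrN => /(le_trans (ler_norm _)); lra.
Unshelve. all: by end_near. Qed.

(** The form in which [sobolev_norm_le] bounds a norm: twice the one-sided series, under a square
    root. *)
Lemma sqrt_tannery (T : Type) (F : set_system T) {FF : Filter F} (h : T -> nat -> R) (H : nat -> R) :
  (\forall t \near F, forall k, 0 <= h t k <= H k) -> cvgn (series H) ->
  (forall k, h ^~ k @ F --> 0) ->
  (fun t => (2 * limn (series (h t))) `^ 2^-1) @ F --> 0.
Proof.
move=> hH cH h0; have /cvgrPdist_le lim0 := @tannery T F FF h H hH cH h0.
apply/cvgrPdist_le => e e0.
have e2 : 0 < e ^+ 2 / 2 by rewrite divr_gt0// exprn_gt0.
have lim1 := lim0 _ e2; near=> t.
have ht : forall k, 0 <= h t k <= H k by near: t.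
have : `|0 - limn (series (h t))| <= e ^+ 2 / 2 by near: t.
rewrite !sub0r !normrN => h1.
rewrite ger0_norm ?powR_ge0//.
have -> : e = (e ^+ 2) `^ 2^-1.
  by rewrite -powR_mulrn ?ltW// -powRrM divff ?powRr1 ?ltW.
have ht0 k : 0 <= h t k by have /andP[] := ht k.
have cht : cvgn (series (h t)).
  by apply: series_le_cvg cH => // k; have /andP[h0' h1'] := ht k; rewrite // (le_trans h0').
have lt0 : 0 <= limn (series (h t)).
  by apply: le_trans (partial_sum_le_series 0 ht0 cht); rewrite /series/= big_geq.
apply: ge0_ler_powR; rewrite ?nnegrE ?invr_ge0 ?sqr_ge0 ?mulr_ge0//.
by have := le_trans (ler_norm _) h1; lra.
Unshelve. all: by end_near. Qed.

End SobolevNorm.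

(** * The Hilbert transform of a trigonometric series *)

Section HilbertTransform.
Context {R : realType}.
Local Notation mu := (@lebesgue_measure R).
Implicit Types (f g : R -> R) (a b c x y z e : R) (u v : nat -> R).

Lemma Rintegral_reflect f x a b : continuous f -> a <= b ->
  \int[mu]_(y in `[x - b, x - a]) f y = \int[mu]_(z in `[a, b]) f (x - z).
Proof.
move=> cf ab; have [F dF] := continuous_antiderivative cf.
rewrite (Rintegral_FTC _ dF cf); last by lra.
have dz z : is_derive z (1 : R) (fun z => x - z) (- 1).
  by apply: is_derive_eq; rewrite ?add0r ?mul1r.
have dG z : is_derive z (1 : R) (fun z => -1 * F (x - z)) (f (x - z)).
  have h : is_derive z (1 : R) (fun z => F (x - z)) (f (x - z) * -1).
    exact: (is_derive1_comp (g := fun z => x - z) (dF _) (dz z)).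
  apply: (is_derive_eq (is_derive_cmulf (-1) h)); ring.
rewrite (Rintegral_FTC ab dG); first by ring.
move=> z; apply: (continuous_comp (f := fun z => x - z)); last exact: cf.
exact: (is_derive_continuous dz).
Qed.

Lemma Rintegral_translate f x a b : continuous f -> a <= b ->
  \int[mu]_(y in `[x + a, x + b]) f y = \int[mu]_(z in `[a, b]) f (x + z).
Proof.
move=> cf ab; have [F dF] := continuous_antiderivative cf.
rewrite (Rintegral_FTC _ dF cf); last by lra.
have dz z : is_derive z (1 : R) (fun z => x + z) 1.
  by apply: is_derive_eq; rewrite ?add0r ?mul1r.
have dG z : is_derive z (1 : R) (fun z => 1 * F (x + z)) (f (x + z)).
  have h : is_derive z (1 : R) (fun z => F (x + z)) (f (x + z) * 1).
    exact: (is_derive1_comp (g := fun z => x + z) (dF _) (dz z)).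
  apply: (is_derive_eq (is_derive_cmulf 1 h)); ring.
rewrite (Rintegral_FTC ab dG); first by ring.
move=> z; apply: (continuous_comp (f := fun z => x + z)); last exact: cf.
exact: (is_derive_continuous dz).
Qed.

(* On [e <= |z| <= pi] this is [cot (z / 2)]; unlike the latter it is
   continuous everywhere. *)
Definition cut_cot e z : R :=
  cos (z / 2) * sin (z / 2) * (Num.max (sin (z / 2) ^+ 2) (sin (e / 2) ^+ 2))^-1.

Lemma sin_half_gt0 e : 0 < e -> e <= pi -> 0 < sin (e / 2).
Proof. by move=> e0 ep; apply: sin_gt0_pi; apply/andP; split; lra. Qed.

Lemma continuous_cut_cot e : 0 < e -> e <= pi -> continuous (cut_cot e).
Proof.
move=> e0 ep; have s0 := sin_half_gt0 e0 ep.
have c1 : continuous (fun z : R => cos (z / 2)).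
  rewrite (_ : (fun z => _) = (fun z => cos (2^-1 * z))); first exact: continuous_cosZ.
  by apply/funext => z; rewrite mulrC.
have c2 : continuous (fun z : R => sin (z / 2)).
  rewrite (_ : (fun z => _) = (fun z => sin (2^-1 * z))); first exact: continuous_sinZ.
  by apply/funext => z; rewrite mulrC.
apply: continuous_mulf; first exact: continuous_mulf.
move=> z; apply: cvgV.
  by rewrite gt_eqF// lt_max (exprn_gt0 2 s0) orbT.
apply: (@continuous_max _ _ (fun z => sin (z / 2) ^+ 2) (fun=> sin (e / 2) ^+ 2)).
  exact: (continuous_mulf c2 c2).
exact: cvg_cst.
Qed.

Lemma cut_cotN e z : cut_cot e (- z) = - cut_cot e z.
Proof. by rewrite /cut_cot mulNr cosN sinN sqrrN mulrN mulNr. Qed.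

Lemma cut_cotE e z : 0 < e -> e <= `|z| -> `|z| <= pi ->
  cut_cot e z = cos (z / 2) / sin (z / 2).
Proof.
move=> e0; wlog z0 : z / 0 <= z.
  move=> H; have [z0|z0] := leP 0 z; first exact: H.
  rewrite -(normrN z) => ez zp; have := H (- z); rewrite oppr_ge0 (ltW z0).
  move=> /(_ isT ez zp); rewrite cut_cotN mulNr cosN sinN invrN mulrN.
  exact: oppr_inj.
rewrite ger0_norm// => ez zp; rewrite /cut_cot.
have z0' : 0 < z by lra.
have s0 := sin_half_gt0 e0 (le_trans ez zp).
have s1 := sin_half_gt0 z0' zp.
have : sin (e / 2) <= sin (z / 2).
  move: ez; rewrite le_eqVlt => /predU1P[->//|ez]; apply/ltW.
  rewrite ltr_sin ?in_itv/=; [lra|apply/andP; split; lra|apply/andP; split; lra].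
move=> es; rewrite (max_idPl _); last by apply: ler_sqr_ge0 => //; exact: ltW.
by field; rewrite gt_eqF.
Qed.

(** For k > 0 the modified Dirichlet kernel 1 + 2 (cos z + ... + cos((k - 1) z)) + cos(k z), which
    is sin(k z) cot(z / 2). Grouping consecutive cosines suits induction on k. *)
Definition dirichlet (k : nat) z : R :=
  \sum_(0 <= j < k) (cos (j%:R * z) + cos (j.+1%:R * z)).

Definition dirichlet_prim (k : nat) z : R :=
  \sum_(0 <= j < k) ((if j is 0%N then z else j%:R^-1 * sin (j%:R * z)) +
    j.+1%:R^-1 * sin (j.+1%:R * z)).

Lemma sin_cos_dirichlet k z :
  sin (k%:R * z) * cos (z / 2) = sin (z / 2) * dirichlet k z.
Proof.
elim: k => [|k IH]; first by rewrite /dirichlet big_geq// mul0r sin0 mul0r mulr0.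
rewrite /dirichlet big_nat_recr//= -/(dirichlet k z) mulrDr -IH -natr1.
set w := z / 2; have -> : z = w + w by rewrite /w; field.
have -> : (k%:R + 1) * (w + w) = (k%:R * (w + w) + w) + w by ring.
set t := k%:R * (w + w).
rewrite (sinD (t + w) w) (cosD (t + w) w) (sinD t w) (cosD t w).
have := cos2Dsin2 w; set c := cos w; set s := sin w => cs.
set ct := cos t; set st := sin t.
have -> : ((st * c + ct * s) * c + (ct * c - st * s) * s) * c =
  st * c + s * (ct + ((ct * c - st * s) * c - (st * c + ct * s) * s)) +
  (c ^+ 2 + s ^+ 2 - 1) * (st * c + ct * s) by ring.
by rewrite cs; ring.
Qed.

Lemma is_derive_dirichlet_prim k z :
  is_derive z (1 : R) (dirichlet_prim k) (dirichlet k z).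
Proof.
have H (j : nat) : is_derive z (1 : R) (fun z => j.+1%:R^-1 * sin (j.+1%:R * z)) (cos (j.+1%:R * z)).
  apply: (is_derive_eq (is_derive_cmulf j.+1%:R^-1 (is_derive_sinZ j.+1%:R z))).
  by rewrite mulKf// pnatr_eq0.
elim: k => [|k IH].
  rewrite (_ : dirichlet_prim 0 = cst 0).
    by rewrite /dirichlet big_geq//; exact: is_derive_cst.
  by apply/funext => y; rewrite /dirichlet_prim big_geq.
rewrite (_ : dirichlet_prim k.+1 = dirichlet_prim k +
    ((fun z => if k is 0%N then z else k%:R^-1 * sin (k%:R * z)) +
    (fun z => k.+1%:R^-1 * sin (k.+1%:R * z)))); last first.
  by apply/funext => y; rewrite /dirichlet_prim big_nat_recr.
rewrite /dirichlet big_nat_recr//= -/(dirichlet k z).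
have H0 : is_derive z (1 : R) (fun z => if k is 0%N then z else k%:R^-1 * sin (k%:R * z)) (cos (k%:R * z)).
  case: (k) => [|j]; last exact: H.
  by rewrite mul0r cos0; exact: is_derive_id.
exact: (is_deriveD IH (is_deriveD H0 (H k))).
Qed.

(** Only the constant term of the kernel contributes: the integral of sin(k z) cot(z / 2) over
    [0, pi] is pi for every k > 0. This is why the Hilbert transform multiplies each nonzero mode by
    a number of modulus 1. *)
Lemma dirichlet_prim_pi k : (0 < k)%N -> dirichlet_prim k pi = pi.
Proof.
case: k => // k _; elim: k => [|k IH].
  by rewrite /dirichlet_prim big_nat1 (sin_intpi 1) mulr0 addr0.
rewrite /dirichlet_prim big_nat_recr//= -/(dirichlet_prim k.+1 pi) IH.
by rewrite (sin_intpi k.+1) (sin_intpi k.+2) !mulr0 !addr0.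
Qed.

Lemma sin_le_id z : 0 <= z -> `|sin z| <= z.
Proof.
move=> z0; have ds (x : R) : is_derive x (1 : R) sin (cos x) by exact: is_derive_sin.
have di (x : R) : is_derive x (1 : R) id (1 : R) by exact: is_derive_id.
have := derive_norm_le z0 ds di (fun x _ => cos_max x).
by rewrite sin0 !subr0.
Qed.

(** The truncation at distance e costs mode k an error of order e k, so summability of k u_k is what
    makes the error uniform over the modes. *)
Lemma dirichlet_prim_le k e : 0 <= e -> `|dirichlet_prim k e| <= 2 * e * k%:R.
Proof.
move=> e0; have H (j : nat) : `|j.+1%:R^-1 * sin (j.+1%:R * e)| <= e.
  rewrite normrM ger0_norm ?invr_ge0// ler_pdivrMl//.
  by apply: sin_le_id; rewrite mulr_ge0.
elim: k => [|k IH]; first by rewrite /dirichlet_prim big_geq// normr0 mulr0.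
rewrite /dirichlet_prim big_nat_recr//= -/(dirichlet_prim k e) -[in leRHS]natr1.
have h1 : `|(if k is 0%N then e else k%:R^-1 * sin (k%:R * e))| <= e.
  by case: (k) => [|j]; [rewrite ger0_norm|exact: H].
have := ler_normD (dirichlet_prim k e) ((if k is 0%N then e else k%:R^-1 * sin (k%:R * e)) +
  k.+1%:R^-1 * sin (k.+1%:R * e)).
have := ler_normD (if k is 0%N then e else k%:R^-1 * sin (k%:R * e))
  (k.+1%:R^-1 * sin (k.+1%:R * e)).
have := H k; move: h1 IH; lra.
Qed.

Lemma integral_sin_cut_cot (k : nat) e : (0 < k)%N -> 0 < e -> e <= pi ->
  \int[mu]_(z in `[e, pi]) (sin (k%:R * z) * cut_cot e z) = pi - dirichlet_prim k e.
Proof.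
move=> k0 e0 ep; rewrite -[X in X - _](dirichlet_prim_pi k0).
rewrite -(Rintegral_FTC ep (is_derive_dirichlet_prim k)); last first.
  apply: continuous_sum_nat => l _; apply: continuous_addf; exact: continuous_cosZ.
apply: eq_Rintegral => z; rewrite inE/= in_itv/= => /andP[ez zp].
have z0 : 0 < z by lra.
rewrite cut_cotE//; [|by rewrite ger0_norm// ltW|by rewrite ger0_norm// ltW].
have s1 := sin_half_gt0 z0 zp.
by rewrite mulrA sin_cos_dirichlet mulrAC divff ?mul1r// gt_eqF.
Qed.

Lemma hilbert_window e x : 0 < e -> [set y | e < `|x - y| <= pi] =
  `[x - pi, x - e[%classic `|` `]x + e, x + pi]%classic.
Proof.
move=> e0; apply/seteqP; split => y /=; rewrite !in_itv/=.
  move=> /andP[]; have [h1|h1] := leP 0 (x - y).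
    by rewrite ger0_norm// => h2 h3; left; apply/andP; split; lra.
  by rewrite ltr0_norm// => h2 h3; right; apply/andP; split; lra.
move=> [/andP[h1 h2]|/andP[h1 h2]].
  by rewrite ger0_norm; [apply/andP; split|]; lra.
by rewrite ler0_norm; [apply/andP; split|]; lra.
Qed.

Lemma Rintegral_hilbert_window f e x : continuous f -> 0 < e -> e <= pi ->
  \int[mu]_(y in [set y | e < `|x - y| <= pi]) f y =
  \int[mu]_(z in `[e, pi]) (f (x - z) + f (x + z)).
Proof.
move=> cf e0 ep; rewrite hilbert_window//.
have fis (b0 b1 : bool) a b : mu.-integrable
    [set` Interval (BSide b0 a) (BSide b1 b)] (EFin \o f).
  apply: integrableS (continuous_itv_integrable a b cf) => //.
  by apply: subset_itv; case: b0; case: b1; rewrite ?bnd_simp.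
rewrite Rintegral_setU//=; first last.
- apply/disj_setPS => y [/=]; rewrite !in_itv/= => /andP[_ h1] /andP[h2 _]; lra.
- apply: (@integrableS _ _ _ mu `[x - pi, x + pi]) => //.
  + by apply: measurableU; exact: measurable_itv.
  + by move=> y /= []; rewrite !in_itv/= => /andP[h1 h2]; apply/andP; split; lra.
rewrite Rintegral_itv_bndo_bndc// Rintegral_itv_obnd_cbnd//.
rewrite Rintegral_reflect// Rintegral_translate// -RintegralD//.
- apply: continuous_itv_integrable => z.
  apply: (continuous_comp (f := fun z => x - z)); last exact: cf.
  by apply: cvgB; [exact: cvg_cst|exact: cvg_id].
- apply: continuous_itv_integrable => z.
  apply: (continuous_comp (f := fun z => x + z)); last exact: cf.
  by apply: cvgD; [exact: cvg_cst|exact: cvg_id].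
Qed.

Lemma hilbert_trunc_mode (k : nat) (c d e x : R) : 0 < e -> e <= pi ->
  \int[mu]_(y in [set y | e < `|x - y| <= pi])
     ((c * cos (k%:R * y) + d * sin (k%:R * y)) * cut_cot e (x - y)) =
  2 * (c * sin (k%:R * x) - d * cos (k%:R * x)) *
  (if k is 0%N then 0 else pi - dirichlet_prim k e).
Proof.
move=> e0 ep; have cc := continuous_cut_cot e0 ep.
have cxy : continuous (fun y => cut_cot e (x - y)).
  move=> y; apply: (continuous_comp (f := fun z => x - z)); last exact: cc.
  by apply: cvgB; [exact: cvg_cst|exact: cvg_id].
have cm : continuous (fun y => (c * cos (k%:R * y) + d * sin (k%:R * y))).
  by apply: continuous_addf; apply: continuous_cmulf; [exact: continuous_cosZ|exact: continuous_sinZ].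
rewrite (Rintegral_hilbert_window _ (continuous_mulf cm cxy) e0 ep).
transitivity (\int[mu]_(z in `[e, pi])
   (2 * (c * sin (k%:R * x) - d * cos (k%:R * x)) * (sin (k%:R * z) * cut_cot e z))).
  congr (fine (integral _ _ _)); apply/funext => z; congr (_%:E).
  have -> : x - (x - z) = z by ring.
  have -> : x - (x + z) = - z by ring.
  rewrite cut_cotN !mulrBr !mulrDr cosB cosD sinB sinD; ring.
have csc : continuous (fun z => sin (k%:R * z) * cut_cot e z).
  by apply: continuous_mulf cc; exact: continuous_sinZ.
rewrite RintegralZl//; last exact: continuous_itv_integrable.
case: k csc {cm} => [|k] csc; last by rewrite integral_sin_cut_cot.
congr (_ * _); rewrite -[RHS](Rintegral_set0 mu (fun=> 0)) /Rintegral; congr fine.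
rewrite integral_set0 integral0_eq// => z _; by rewrite mul0r sin0 mul0r.
Qed.

(** The convergence holds at every point, with error at most (2 e / pi) times the sum of k (|u_k| +
    |v_k|). The condition on [v 0] makes the constant term of the conjugate series vanish, as the
    transform of a constant must. *)
Lemma trig_series_hilbert u v : v 0%N = 0 -> abs_summable u -> abs_summable v ->
  abs_summable (fun k => k%:R * u k) -> abs_summable (fun k => k%:R * v k) ->
  is_hilbert (trig_series u v) (trig_series (fun k => - v k) u).
Proof.
move=> v0 su sv sku skv; apply: aeW => x.
have pi0 := pi_gt0 R.
have sNv : abs_summable (fun k => - v k).
  by apply: (abs_summable_le _ sv) => k; rewrite normrN.
set C := limn (series (fun k => `|k%:R * u k| + `|k%:R * v k|)).
have main e : 0 < e -> e <= pi ->
    `|trig_series (fun k => - v k) u x - hilbert_trunc (trig_series u v) e x| <=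
    pi^-1 * (2 * e) * C.
  move=> e0 ep.
  have cxy : continuous (fun y => cut_cot e (x - y)).
    move=> y; apply: (continuous_comp (f := fun z => x - z)); last exact: continuous_cut_cot.
    by apply: cvgB; [exact: cvg_cst|exact: cvg_id].
  set E := [set y | e < `|x - y| <= pi].
  have mE : measurable (E : set (measurableTypeR R)).
    by rewrite /E hilbert_window//; apply: measurableU; exact: measurable_itv.
  have iE : mu.-integrable E (EFin \o (fun y => cut_cot e (x - y))).
    apply: (@integrableS _ _ _ mu `[x - pi, x + pi]) => //.
    + rewrite /E hilbert_window// => y /= []; rewrite !in_itv/= => /andP[h1 h2]; apply/andP; split; lra.
    + exact: continuous_itv_integrable.
  have [_ h] := trig_series_Rintegral mE su sv iE.
  have -> : hilbert_trunc (trig_series u v) e x = (2 * pi)^-1 *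
      \int[mu]_(y in E) (trig_series u v y * cut_cot e (x - y)).
    rewrite /hilbert_trunc; congr (_ * _); apply: eq_Rintegral => y.
    rewrite inE/= => /andP[h1 h2]; rewrite (cut_cotE e0)//; exact: ltW.
  pose w k := (2 * pi)^-1 * (2 * (u k * sin (k%:R * x) - v k * cos (k%:R * x)) *
      (if k is 0%N then 0 else pi - dirichlet_prim k e)).
  have hw : series w @ \oo --> (2 * pi)^-1 *
      \int[mu]_(y in E) (trig_series u v y * cut_cot e (x - y)).
    have [m hm] : exists m : nat -> R, m = (fun k => \int[mu]_(y in E)
        ((u k * cos (k%:R * y) + v k * sin (k%:R * y)) * cut_cot e (x - y))) by eexists.
    have -> : series w = (fun n => (2 * pi)^-1 * series m n).
      apply/funext => n; rewrite /series/= mulr_sumr; apply: eq_bigr => k _.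
      by rewrite /w hm hilbert_trunc_mode.
    rewrite -hm in h.
    have cc : (fun _ : nat => (2 * pi)^-1 : R) @ \oo --> ((2 * pi)^-1 : R) by exact: cvg_cst.
    by have := cvgM cc h => H; exact: H.
  have -> : (2 * pi)^-1 * \int[mu]_(y in E) (trig_series u v y * cut_cot e (x - y)) =
    limn (series w) by apply/esym/cvg_lim.
  have cw : cvgn (series w) by apply/cvg_ex; eexists; exact: hw.
  have ct := trig_series_cvg (x := x) sNv su.
  rewrite /trig_series -lim_seriesB//.
  have cC := abs_summableD sku skv.
  have -> : pi^-1 * (2 * e) * C =
      limn (series ((pi^-1 * (2 * e)) *: (fun k => `|k%:R * u k| + `|k%:R * v k|))).
    by rewrite lim_seriesZ.
  apply: (@normal_series_le _ _ _ _); last exact: is_cvg_seriesZ.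
  move=> k; rewrite /w -[X in `|X|]/(_ - _) -[leRHS]/(_ * _).
  case: k => [|k].
    rewrite [X in `|X|](_ : _ = 0); last by rewrite v0 mul0r sin0; ring.
    rewrite normr0 mulr_ge0 ?addr_ge0//; apply: mulr_ge0; last by rewrite mulr_ge0// ltW.
    by rewrite invr_ge0 ltW.
  set t := k.+1%:R * x; set D := dirichlet_prim k.+1 e.
  have -> : - v k.+1 * cos t + u k.+1 * sin t - (2 * pi)^-1 *
      (2 * (u k.+1 * sin t - v k.+1 * cos t) * (pi - D)) =
      pi^-1 * D * (u k.+1 * sin t - v k.+1 * cos t).
    by move: (pi : R) pi0 D => p p0 D; field; rewrite gt_eqF.
  rewrite !normrM (ger0_norm (ltW _)) ?invr_gt0// -!mulrA ler_wpM2l ?invr_ge0 ?(ltW pi0)//.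
  have h1 := dirichlet_prim_le k.+1 (ltW e0).
  have h2 : `|u k.+1 * sin t - v k.+1 * cos t| <= `|u k.+1| + `|v k.+1|.
    rewrite (le_trans (ler_normB _ _))// !normrM.
    by rewrite lerD// ler_piMr ?cos_max ?sin_max.
  have := ler_pM (normr_ge0 D) (normr_ge0 _) h1 h2.
  by rewrite normr_nat; lra.
have C0 : 0 <= C.
  have cC := abs_summableD sku skv.
  by apply: (le_trans (normr_ge0 _) (normal_series_le (u := fun=> 0) _ cC)) => k; rewrite normr0 addr_ge0.
have q0 : 0 < (pi : R)^-1 * 2 * (C + 1).
  apply: mulr_gt0; last by rewrite ltr_wpDl.
  by apply: mulr_gt0; rewrite ?invr_gt0.
apply/cvgrPdist_le => d d0.
have dq0 : 0 < d / (pi^-1 * 2 * (C + 1)) by exact: divr_gt0.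
near=> e.
have e0 : 0 < e by near: e; exact: nbhs_right_gt.
have ep : e <= pi by apply/ltW; near: e; exact: nbhs_right_lt.
apply: (le_trans (main e e0 ep)).
have : e <= d / (pi^-1 * 2 * (C + 1)).
  by apply/ltW; near: e; exact: nbhs_right_lt.
rewrite ler_pdivlMr//.
apply: le_trans.
have : 0 <= e * (pi^-1 * 2).
  by apply: mulr_ge0; [exact: ltW|apply: mulr_ge0; rewrite ?invr_ge0 ?ltW].
by lra.
Unshelve. all: by end_near. Qed.

End HilbertTransform.

(** * Test functions *)

Section TestFunctions.
Context {R : realType}.
Local Notation mu := (@lebesgue_measure R).
Implicit Types (f g F G phi : R -> R) (a b c x y : R) (u v : nat -> R).

Lemma derivable_is_derive f x : derivable f x (1 : R) -> is_derive x (1 : R) f (derive1 f x).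
Proof. by move=> df; apply: DeriveDef => //; rewrite derive1E. Qed.

Lemma circle_integration_by_parts F G f g :
  (forall x, is_derive x (1 : R) F (f x)) -> (forall x, is_derive x (1 : R) G (g x)) ->
  continuous f -> continuous g -> Defs.periodic F -> Defs.periodic G ->
  circle_integral (fun x => f x * G x) = - circle_integral (fun x => F x * g x).
Proof.
move=> dF dG cf cg pF pG.
have cF := is_derive_continuous dF; have cG := is_derive_continuous dG.
have dFG x : is_derive x (1 : R) (F * G) (F x * g x + f x * G x).
  apply: (is_derive_eq (is_deriveM (dF x) (dG x))).
  by rewrite -[G x *: f x]/(G x * f x) [G x * _]mulrC.
have i1 := continuous_circle_integrable (continuous_mulf cF cg).
have i2 := continuous_circle_integrable (continuous_mulf cf cG).
have := circle_integral_FTC dFG (continuous_addf (continuous_mulf cF cg) (continuous_mulf cf cG)).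
rewrite circle_integralD// -[(F * G) pi]/(F pi * G pi) -[(F * G) (- pi)]/(F (- pi) * G (- pi)).
have e : pi = - pi + 2 * pi :> R by ring.
rewrite [in F pi]e [in G pi]e pF pG subrr => /eqP; rewrite addr_eq0 => /eqP ->.
by rewrite opprK.
Qed.

Lemma smooth_periodic_is_derive phi x : smooth_periodic phi ->
  is_derive x (1 : R) phi (derive1 phi x).
Proof. by move=> [_ /(_ 0%N x)]; exact: derivable_is_derive. Qed.

Lemma smooth_periodic_continuous phi : smooth_periodic phi -> continuous phi.
Proof. by move=> sphi; exact: (is_derive_continuous (fun x => smooth_periodic_is_derive x sphi)). Qed.

Lemma smooth_periodic_derive phi : smooth_periodic phi ->
  smooth_periodic (derive1 phi).
Proof.
move=> sphi; split; last first.
  by move=> n x; have [_ /(_ n.+1 x)] := sphi; rewrite derive1Sn.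
move=> x; have d1 := smooth_periodic_is_derive x sphi.
have ds : is_derive x (1 : R) (fun x => x + 2 * pi) (1 : R).
  by apply: is_derive_eq; rewrite ?addr0.
have := is_derive1_comp (g := fun x => x + 2 * pi) (smooth_periodic_is_derive (x + 2 * pi) sphi) ds.
rewrite (_ : phi \o _ = phi); last by apply/funext => y /=; case: sphi => ->.
by rewrite mulr1 => d2; have [_ <-] := d2; rewrite derive1E.
Qed.

Lemma periodic_cosZ (k : nat) : Defs.periodic (fun x : R => cos (k%:R * x)).
Proof. by move=> x; rewrite mulrDr cosDnat2pi. Qed.

Lemma periodic_sinZ (k : nat) : Defs.periodic (fun x : R => sin (k%:R * x)).
Proof. by move=> x; rewrite mulrDr sinDnat2pi. Qed.

Lemma derivative_coefs F f (k : nat) : (forall x, is_derive x (1 : R) F (f x)) ->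
  continuous f -> Defs.periodic F ->
  fcos f k = k%:R * fsin F k /\ fsin f k = - (k%:R * fcos F k).
Proof.
move=> dF cf pF; have cF := is_derive_continuous dF.
have c1 := continuous_circle_integrable (continuous_mulf cF (@continuous_sinZ R k%:R)).
have c2 := continuous_circle_integrable (continuous_mulf cF (@continuous_cosZ R k%:R)).
split; rewrite /fcos /fsin.
  rewrite (circle_integration_by_parts dF (is_derive_cosZ k%:R) cf); first last.
  - exact: periodic_cosZ.
  - exact: pF.
  - by apply: continuous_cmulf; exact: continuous_sinZ.
  rewrite -circle_integralZ// -mulN1r -circle_integralZ; last first.
    by apply: continuous_circle_integrable; apply: continuous_mulf cF _; apply: continuous_cmulf; exact: continuous_sinZ.
  by congr circle_integral; apply/funext => x; rewrite -pmulrn; ring.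
rewrite (circle_integration_by_parts dF (is_derive_sinZ k%:R) cf); first last.
- exact: periodic_sinZ.
- exact: pF.
- by apply: continuous_cmulf; exact: continuous_cosZ.
rewrite -circle_integralZ//; congr (- circle_integral _); apply/funext => x; rewrite -pmulrn; ring.
Qed.

Lemma fourier_coef_bound f : circle_integrable f -> forall k : nat,
  `|fcos f k| <= circle_integral (fun x => `|f x|) /\
  `|fsin f k| <= circle_integral (fun x => `|f x|).
Proof.
move=> fi k; have nf : circle_integrable (fun x => `|f x|) by exact: integrable_norm fi.
have H (h : R -> R) : continuous h -> (forall x, `|h x| <= 1) ->
    `|circle_integral (fun x => f x * h x)| <= circle_integral (fun x => `|f x|).
  move=> ch h1; have fh := circle_integrableM fi ch.
  apply: (le_trans (le_normr_Rintegral measurable_circ fh)).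
  apply: le_Rintegral => //; first exact: integrable_norm fh.
  by move=> x _; rewrite normrM ler_piMr.
split; apply: H; [exact: continuous_cosZ| |exact: continuous_sinZ|].
  by move=> x; exact: cos_max.
by move=> x; exact: sin_max.
Qed.

Lemma smooth_periodic_decay (n : nat) phi : smooth_periodic phi ->
  exists M : R, forall k : nat, k%:R ^+ n * `|fcos phi k| <= M /\
    k%:R ^+ n * `|fsin phi k| <= M.
Proof.
elim: n phi => [|n IH] phi sphi.
  have fi := continuous_circle_integrable (smooth_periodic_continuous sphi).
  by eexists => k; rewrite expr0 !mul1r; exact: fourier_coef_bound.
have sphi' := smooth_periodic_derive sphi.
have [M HM] := IH _ sphi'; exists M => k; have [h1 h2] := HM k.
have [e1 e2] := derivative_coefs k (fun x => smooth_periodic_is_derive x sphi)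
  (smooth_periodic_continuous sphi') sphi.1.
move: h1 h2; rewrite e1 e2 normrN !normrM normr_nat !mulrA -!exprSr.
by split.
Qed.

(** Comparison with M / (m (m + 1)), which telescopes; the remainder M / (m + 1) is kept in the
    induction. *)
Lemma summable_inv_sqr u (M : R) : (forall k : nat, k%:R ^+ 2 * `|u k| <= M) ->
  abs_summable u.
Proof.
move=> uM; have M0 : 0 <= M by apply: le_trans (uM 0%N); rewrite expr0n mul0r.
apply: nondecreasing_is_cvgn.
  by apply/nondecreasing_seqP => k; rewrite /series/= big_nat_recr//= lerDl.
exists (`|u 0%N| + 2 * M) => _ [n _ <-].
suff H m : series (fun k => `|u k|) m.+2 <= `|u 0%N| + 2 * M - M / m.+1%:R.
  apply: (@le_trans _ _ (series (fun k => `|u k|) n.+2)).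
    by rewrite /series/= !big_nat_recr//= -addrA lerDl addr_ge0.
  by apply: (le_trans (H n)); rewrite gerBl divr_ge0.
elim: m => [|m IH].
  rewrite /series/= !big_nat_recr//= big_geq// add0r divr1.
  by have := uM 1%N; rewrite expr1n mul1r; lra.
rewrite /series/= big_nat_recr//=; move: IH; rewrite /series/= => h.
have m1 : 0 < (m.+1%:R : R) by rewrite ltr0n.
have m2 : 0 < (m.+2%:R : R) by rewrite ltr0n.
have := uM m.+2; rewrite mulrC -ler_pdivlMr ?exprn_gt0// => h'.
apply: (le_trans (lerD h h')).
have : M / m.+2%:R ^+ 2 <= M / m.+1%:R - M / m.+2%:R.
  have -> : M / m.+1%:R - M / m.+2%:R = M / (m.+1%:R * m.+2%:R).
    rewrite -[m.+2%:R]natr1; move: m.+1%:R m1 => z z0.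
    by field; rewrite !gt_eqF//; lra.
  rewrite ler_wpM2l// lef_pV2 ?posrE ?mulr_gt0 ?exprn_gt0//.
  by rewrite expr2 ler_wpM2r ?ltW// ltr_nat.
by move: (M / _) (M / _) (M / _) => p q r; lra.
Qed.

Lemma trig_derive_form (c a b : R) (n : nat) : exists a' b' : R,
  derive1n n (fun x => a * cos (c * x) + b * sin (c * x)) =
  (fun x => a' * cos (c * x) + b' * sin (c * x)).
Proof.
elim: n a b => [|n IH] a b; first by exists a, b.
have [a' [b' e]] := IH (b * c) (- (a * c)).
exists a', b'; rewrite derive1Sn -e; congr derive1n; apply/funext => x.
have h : is_derive x (1 : R) (fun x => a * cos (c * x) + b * sin (c * x))
   (a * (- c * sin (c * x)) + b * (c * cos (c * x))).
  exact: (is_deriveD (is_derive_cmulf a (is_derive_cosZ c x)) (is_derive_cmulf b (is_derive_sinZ c x))).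
rewrite derive1E; have [_ ->] := h; ring.
Qed.

Lemma smooth_periodic_trig (k : nat) (a b : R) :
  smooth_periodic (fun x => a * cos (k%:R * x) + b * sin (k%:R * x)).
Proof.
split=> [x|n x]; first by rewrite mulrDr cosDnat2pi sinDnat2pi.
have [a' [b' ->]] := trig_derive_form k%:R a b n.
by case: (is_deriveD (is_derive_cmulf a' (is_derive_cosZ k%:R x)) (is_derive_cmulf b' (is_derive_sinZ k%:R x))).
Qed.

End TestFunctions.

(** From x / b <= exp(x / b) raised to the power b; the constant is b^b. It trades the Gevrey factor
    for any power of the frequency. *)
Lemma powR_expRN_bound {R : realType} (b : R) : 0 <= b -> exists2 C : R, 0 <= C &
  forall x, 0 <= x -> x `^ b * expR (- x) <= C.
Proof.
rewrite le_eqVlt => /predU1P[<-|b0].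
  exists 1 => // x x0; rewrite powRr0 mul1r expRN invf_le1 ?expR_gt0//.
  by have := expR_ge1Dx x; lra.
exists (b `^ b); first exact: powR_ge0.
move=> x x0; rewrite expRN ler_pdivrMr ?expR_gt0//.
have -> : x = b * (x / b) by field; rewrite gt_eqF.
rewrite powRM ?divr_ge0 ?(ltW b0)// ler_wpM2l ?powR_ge0// [b * _ in leRHS]mulrC expRM.
apply: ge0_ler_powR; rewrite ?nnegrE ?expR_ge0 ?divr_ge0 ?(ltW b0)//.
by have := expR_ge1Dx (x / b); lra.
Qed.

(** * Square integrability of series, and the action of Lambda on real coefficients *)

Section TrigSeriesFunctions.
Context {R : realType}.
Local Notation mu := (@lebesgue_measure R).
Implicit Types (f g : R -> R) (u v : nat -> R).

Lemma L2_trig_series u v : abs_summable u -> abs_summable v -> L2 (trig_series u v).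
Proof.
move=> su sv; split; first exact: trig_series_periodic.
  exact: trig_series_measurable.
set M := limn (series (fun k => `|u k| + `|v k|)).
have Mi : circle_integrable (fun _ : R => M ^+ 2).
  by apply: continuous_circle_integrable => x; exact: cvg_cst.
apply: (le_integrable _ _ _ Mi) => //.
  apply/measurable_EFinP; apply: measurable_funTS; apply: measurable_funX.
  exact: trig_series_measurable.
move=> x _; rewrite lee_fin /= normrX.
rewrite [leRHS]ger0_norm ?sqr_ge0//.
by apply: ler_sqr_ge0 => //; exact: trig_series_bound.
Qed.

Lemma series_scale (c : R) u : cvgn (series u) -> cvgn (series (fun k => c * u k)) /\
  limn (series (fun k => c * u k)) = c * limn (series u).
Proof.
move=> cu; have l : series (fun k => c * u k) @ \oo --> c * limn (series u).
  rewrite (_ : series _ = (fun n => c * series u n)); first exact: (@cvgMr _ _ _ _ _ c).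
  by apply/funext => n; rewrite /series /= mulr_sumr.
by split; [apply/cvg_ex; exists (c * limn (series u))|exact: cvg_lim l].
Qed.

Lemma limn_series_ge0 u : (forall k, 0 <= u k) -> cvgn (series u) -> 0 <= limn (series u).
Proof.
by move=> u0 cu; have := partial_sum_le_series 0 u0 cu; rewrite /series /= big_geq.
Qed.

Lemma integrable_obnd_cbnd (a b : R) f : mu.-integrable `]a, b] (EFin \o f) ->
  mu.-integrable `[a, b] (EFin \o f).
Proof.
move=> /integrableP[mf fi]; have mf' := proj1 (emeasurable_fun_itv_obnd_cbndP _ _ _) mf.
apply/integrableP; split => //; rewrite -integral_itv_obnd_cbnd//.
exact: measurableT_comp.
Qed.

Lemma fourier_energyB f g (k : nat) : circle_integrable f -> circle_integrable g ->
  fcos (fun x => f x - g x) k = fcos f k - fcos g k /\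
  fsin (fun x => f x - g x) k = fsin f k - fsin g k.
Proof.
move=> fi gi.
have fc := circle_integrableM fi (@continuous_cosZ R k%:~R).
have fs := circle_integrableM fi (@continuous_sinZ R k%:~R).
have gc := circle_integrableM gi (@continuous_cosZ R k%:~R).
have gs := circle_integrableM gi (@continuous_sinZ R k%:~R).
have Ngc := circle_integrableZ (-1) gc; have Ngs := circle_integrableZ (-1) gs.
rewrite /fcos /fsin -mulN1r -[- circle_integral (fun x => g x * sin _)]mulN1r.
rewrite -!circle_integralZ// -!circle_integralD//.
by split; congr circle_integral; apply/funext => x; ring.
Qed.

Lemma fourier_coef_Lambda f g (a : R) : circle_integrable f -> circle_integrable g ->
  (forall k : nat, fcos g k = k%:R `^ a * fcos f k /\
     fsin g k = k%:R `^ a * fsin f k) -> is_Lambda a f g.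
Proof.
move=> fi gi H k; rewrite !fourier_coefE.
have {}H : fcos g k = `|k|%:~R `^ a * fcos f k /\ fsin g k = `|k|%:~R `^ a * fsin f k.
  case: k => n; first exact: H.
  by rewrite NegzE !fcosN !fsinN// normrN; have [-> ->] := H n.+1; rewrite mulrN.
have [-> ->] := H; set c := _ `^ a.
by apply/eqP; rewrite eq_complex /=; apply/andP; split; apply/eqP; ring.
Qed.

Lemma Lambda_fourier_coef f g (a : R) (k : nat) : is_Lambda a f g ->
  fcos g k = k%:R `^ a * fcos f k /\ fsin g k = k%:R `^ a * fsin f k.
Proof.
move=> /(_ k%:Z); rewrite !fourier_coefE => /eqP; rewrite eq_complex /= => /andP[/eqP h1 /eqP h2].
have pi2 : (2 * pi : R)^-1 != 0 by rewrite invr_eq0 mulf_neq0 ?gt_eqF ?pi_gt0.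
split; apply: (mulfI pi2).
  by rewrite h1 /=; ring.
by apply: oppr_inj; rewrite h2 /=; ring.
Qed.

Lemma fourier_oppE (f : R -> R) (k : nat) : circle_integrable f ->
  fcos (fun x => - f x) k = - fcos f k /\ fsin (fun x => - f x) k = - fsin f k.
Proof.
move=> fi; rewrite /fcos /fsin -mulN1r -[- circle_integral (fun x => f x * sin _)]mulN1r.
rewrite -!circle_integralZ; last 2 first.
- exact: circle_integrableM fi (@continuous_sinZ R k%:~R).
- exact: circle_integrableM fi (@continuous_cosZ R k%:~R).
by split; congr circle_integral; apply/funext => x; ring.
Qed.

End TrigSeriesFunctions.

(** * Existence *)

Section Existence.
Context {R : realType}.
Local Notation leb := (@lebesgue_measure R).
Variables (mu alpha T : R) (A : nat -> R) (Z : R) (p q : nat -> R -> R) (B0 : R -> R).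
Let s := 5 / 2 - alpha.
Hypothesis mu0 : 0 < mu.
Hypothesis alpha1 : 1 < alpha <= 5 / 2.
Hypothesis A0 : forall k, 0 <= A k.
Hypothesis AZ : forall N, \sum_(1 <= k < N) (k%:R `^ s * A k) ^+ 2 <= Z.
Hypothesis ode : modes_ode mu alpha p q.
Hypothesis pqA : forall k t, (0 < k)%N -> 0 <= t <= T ->
  `|p k t| + `|q k t| <= A k * gevrey mu alpha t k.
Hypothesis HB0 : sobolev s B0.
Hypothesis B0mean : zero_mean B0.
Hypothesis p_init : forall k : nat, fcos B0 k = 2 * pi * p k 0.
Hypothesis q_init : forall k : nat, fsin B0 k = - (2 * pi * q k 0).

Let a1 : 1 < alpha. Proof. by case/andP: alpha1. Qed.
Let a0 : 0 < alpha. Proof. exact: lt_trans a1. Qed.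
Let s0 : 0 <= s. Proof. by case/andP: alpha1 => _; rewrite /s; lra. Qed.
Let pi0 : 0 < pi :> R. Proof. exact: pi_gt0. Qed.

(** Frequency 0 is set to zero in accordance with the zero mean of B; the bound [pqA] speaks of
    positive frequencies only. *)
Definition mode (f : nat -> R -> R) t (k : nat) : R := if k is 0%N then 0 else f k t.

Let P := mode p.
Let Q := mode q.

(* [fcos B k = 2 pi p_k] and [fsin B k = - 2 pi q_k], whence the signs below. *)
Definition solution t : R -> R := if t <= 0 then B0 else
  trig_series (fun k => 2 * P t k) (fun k => - (2 * Q t k)).

Definition solution_J t : R -> R :=
  trig_series (fun k => - (2 * (k%:R * P t k))) (fun k => 2 * (k%:R * Q t k)).

Definition solution_x t : R -> R :=
  trig_series (fun k => - (2 * (k%:R * Q t k))) (fun k => - (2 * (k%:R * P t k))).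

Let Z0 : 0 <= Z. Proof. by have := AZ 0%N; rewrite big_geq. Qed.

(** The H^s energies of the majorant [A]. Up to constants this one summable sequence, independent of
    t, dominates all the Sobolev energies below. *)
Let H (k : nat) : R := if k is 0%N then 0 else (k%:R `^ s * A k) ^+ 2.

Let H0 k : 0 <= H k. Proof. by case: k => [|k]//; exact: sqr_ge0. Qed.

Let cH : cvgn (series H).
Proof.
apply: nondecreasing_is_cvgn.
  by apply/nondecreasing_seqP => k; rewrite /series/= big_nat_recr//= lerDl.
exists Z => _ [n _ <-]; case: n => [|n]; first by rewrite /series/= big_geq.
by rewrite /series/= big_nat_recl//= add0r; have := AZ n.+1; rewrite big_add1.
Qed.

Let A_bound k : (0 < k)%N -> A k <= Z + 1.
Proof.
case: k => // k _.
have h : (k.+1%:R `^ s * A k.+1) ^+ 2 <= Z.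
  apply: le_trans (AZ k.+2); rewrite big_nat_recr//= lerDr.
  by apply: sumr_ge0 => i _; exact: sqr_ge0.
have k1 : 1 <= (k.+1%:R : R) `^ s.
  by rewrite -[leLHS](powRr0 k.+1%:R); apply: ler_powR => //; rewrite ler1n.
have : A k.+1 <= k.+1%:R `^ s * A k.+1 by rewrite ler_peMl.
by move: h; set a := _ * _; have := sqr_ge0 (a - 1); nra.
Qed.

Let pq_le_A t k : 0 <= t <= T -> `|P t k| + `|Q t k| <= A k.
Proof.
move=> tT; case: k => [|k]; first by rewrite /P /Q /= normr0 addr0.
apply: (le_trans (pqA (ltn0Sn k) tT)); rewrite ler_piMr// /gevrey expR_le1 oppr_le0.
by rewrite !mulr_ge0 ?powR_ge0// ltW.
Qed.

Let PQ_decay (n : nat) t : 0 < t <= T -> exists M : R, forall k : nat,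
  k%:R ^+ n * (`|P t k| + `|Q t k|) <= M.
Proof.
move=> /andP[t0 tT]; have [C C0 HC] := @powR_expRN_bound R n%:R (ler0n _ n).
pose c := mu / 2 * t `^ (alpha^-1).
have c0 : 0 < c by rewrite mulr_gt0 ?powR_gt0// divr_gt0.
exists ((Z + 1) * (C / c ^+ n)) => -[|k].
  rewrite /P /Q /= normr0 addr0 mulr0; apply: mulr_ge0; first by rewrite addr_ge0.
  by rewrite divr_ge0// exprn_ge0// ltW.
have tT' : 0 <= t <= T by rewrite (ltW t0).
have k0 : 0 <= (k.+1%:R : R) by rewrite ler0n.
have := pqA (ltn0Sn k) tT'; rewrite /P /Q /=.
have := HC (c * k.+1%:R) (mulr_ge0 (ltW c0) k0).
rewrite (powR_mulrn n (mulr_ge0 (ltW c0) k0)) exprMn.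
have -> : expR (- (c * k.+1%:R)) = gevrey mu alpha t k.+1.
  by rewrite /gevrey /c; congr expR; ring.
have := A_bound (ltn0Sn k); have g0 := gevrey_gt0 mu alpha t k.+1.
move=> hA hC hpq.
have cn : 0 < c ^+ n by rewrite exprn_gt0.
have kn : 0 <= (k.+1%:R : R) ^+ n by rewrite exprn_ge0.
have h1 : k.+1%:R ^+ n * gevrey mu alpha t k.+1 <= C / c ^+ n.
  by rewrite ler_pdivlMr// mulrC mulrA.
apply: (le_trans (ler_wpM2l kn hpq)).
rewrite mulrCA; apply: ler_pM => //.
by rewrite mulr_ge0// ltW.
Qed.

Let summ (n : nat) t : 0 < t <= T -> abs_summable (fun k => k%:R ^+ n * P t k) /\
  abs_summable (fun k => k%:R ^+ n * Q t k).
Proof.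
move=> tT; have [M HM] := PQ_decay n.+2 tT.
split; apply: (summable_inv_sqr (M := M)) => k.
  rewrite normrM ger0_norm ?exprn_ge0// mulrA -exprD; apply: le_trans (HM k).
  by rewrite ler_wpM2l ?exprn_ge0// lerDl.
rewrite normrM ger0_norm ?exprn_ge0// mulrA -exprD; apply: le_trans (HM k).
by rewrite ler_wpM2l ?exprn_ge0// lerDr.
Qed.

Let summ_scale (c : R) (u : nat -> R) : abs_summable u -> abs_summable (fun k => c * u k).
Proof.
move=> su; have h k : `|c * u k| <= `|c| * `|u k| by rewrite normrM.
exact: (abs_summable_le h (abs_summable_scale su)).
Qed.

Let summ0 t : 0 < t <= T -> abs_summable (fun k => 2 * P t k) /\
  abs_summable (fun k => - (2 * Q t k)).
Proof.
move=> tT; have [h1 h2] := summ 0 tT; split.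
  rewrite (_ : (fun k => _) = (fun k => 2 * (k%:R ^+ 0 * P t k))); first exact: summ_scale.
  by apply/funext => k; rewrite expr0 mul1r.
rewrite (_ : (fun k => _) = (fun k => -2 * (k%:R ^+ 0 * Q t k))); first exact: summ_scale.
by apply/funext => k; rewrite expr0; ring.
Qed.

Let summ1 t : 0 < t <= T -> abs_summable (fun k => k%:R * P t k) /\
  abs_summable (fun k => k%:R * Q t k).
Proof. by move=> tT; have := summ 1 tT; under eq_fun do rewrite expr1. Qed.

Let summ1' t (c : R) : 0 < t <= T -> abs_summable (fun k => c * (k%:R * P t k)) /\
  abs_summable (fun k => c * (k%:R * Q t k)).
Proof. by move=> /summ1[h1 h2]; split; exact: summ_scale. Qed.

Lemma solution_L2 t : 0 <= t <= T -> L2 (solution t).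
Proof.
move=> /andP[]; rewrite /solution le_eqVlt => /predU1P[<- _|t0 tT].
  by rewrite lexx; case: HB0.
by rewrite leNgt t0 /=; apply: L2_trig_series; case: (@summ0 t); rewrite // t0.
Qed.

(** The formulas hold down to t = 0, where the function is [B0] itself and its series need not
    converge absolutely. There the mode k = 0 is the zero mean of [B0], and the others are the
    initial values of the system. *)
Lemma solution_coefs t (k : nat) : 0 <= t <= T ->
  fcos (solution t) k = 2 * pi * P t k /\ fsin (solution t) k = - (2 * pi * Q t k).
Proof.
move=> /andP[]; rewrite /solution le_eqVlt => /predU1P[<- _|t0 tT].
  rewrite lexx; case: k => [|k]; last by rewrite p_init q_init.
  rewrite /P /Q /= !mulr0 oppr0 fsin0; split => //.
  rewrite -[RHS]B0mean /fcos; congr circle_integral; apply/funext => x.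
  by rewrite mulr0z mul0r cos0 mulr1.
rewrite leNgt t0 /=; have [|h1 h2] := @summ0 t; first by rewrite t0.
rewrite fcos_trig_series//; case: k => [|k].
  by rewrite fsin0 /P /Q /= !mulr0 oppr0.
rewrite fsin_trig_series//; split; ring.
Qed.

Let sJ t : 0 < t <= T -> abs_summable (fun k => - (2 * (k%:R * P t k))) /\
  abs_summable (fun k => 2 * (k%:R * Q t k)).
Proof.
move=> tT; have [h1 h2] := summ1' 2 tT; split => //.
by have [+ _] := summ1' (-2) tT; under eq_fun do rewrite mulNr.
Qed.

Let sx t : 0 < t <= T -> abs_summable (fun k => - (2 * (k%:R * Q t k))) /\
  abs_summable (fun k => - (2 * (k%:R * P t k))).
Proof. by move=> tT; have [h1 h2] := summ1' (-2) tT; split; [move: h2|move: h1]; under eq_fun do rewrite mulNr. Qed.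

Lemma solution_J_L2 t : 0 < t <= T -> L2 (solution_J t).
Proof. by move=> /sJ[h1 h2]; exact: L2_trig_series. Qed.

Lemma solution_x_L2 t : 0 < t <= T -> L2 (solution_x t).
Proof. by move=> /sx[h1 h2]; exact: L2_trig_series. Qed.

Lemma solution_J_coefs t (k : nat) : 0 < t <= T ->
  fcos (solution_J t) k = - (2 * pi) * (k%:R * P t k) /\
  fsin (solution_J t) k = 2 * pi * (k%:R * Q t k).
Proof.
move=> /sJ[h1 h2]; rewrite fcos_trig_series//; case: k => [|k].
  by rewrite fsin0 !mul0r !mulr0 oppr0 mulr0.
by rewrite fsin_trig_series//; split; ring.
Qed.

Lemma solution_x_coefs t (k : nat) : 0 < t <= T ->
  fcos (solution_x t) k = - (2 * pi) * (k%:R * Q t k) /\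
  fsin (solution_x t) k = - (2 * pi) * (k%:R * P t k).
Proof.
move=> /sx[h1 h2]; rewrite fcos_trig_series//; case: k => [|k].
  by rewrite fsin0 !mul0r !mulr0 oppr0 mulr0.
by rewrite fsin_trig_series//; split; ring.
Qed.

Lemma solution_Lambda t : 0 < t <= T ->
  is_Lambda 1 (solution t) (fun x => - solution_J t x).
Proof.
move=> tT; have t0T : 0 <= t <= T by case/andP: tT => /ltW -> ->.
have Ji := L2_circle_integrable (solution_J_L2 tT).
apply: fourier_coef_Lambda.
- exact: L2_circle_integrable (solution_L2 t0T).
- rewrite (_ : (fun x => _) = (fun x => -1 * solution_J t x)).
    exact: circle_integrableZ.
  by apply/funext => x; rewrite mulN1r.
move=> k; have [-> ->] := fourier_oppE k Ji.
have [-> ->] := solution_J_coefs k tT; have [-> ->] := solution_coefs k t0T.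
by rewrite powRr1//; split; ring.
Qed.

Lemma solution_weak_derivative t : 0 < t <= T ->
  is_weak_derivative (solution t) (solution_x t).
Proof.
move=> tT phi sphi; have [h1 h2] := sx tT; have [h3 h4] := summ0 tT.
have cphi := smooth_periodic_continuous sphi.
have cdphi := smooth_periodic_continuous (smooth_periodic_derive sphi).
have [_ l1] := trig_series_integral h1 h2 (continuous_circle_integrable cphi).
have [_ l2] := trig_series_integral h3 h4 (continuous_circle_integrable cdphi).
have l3 := cvgN l2; rewrite /solution leNgt; case/andP: (tT) => -> _ /=.
move: l1 => /(cvg_unique (@norm_hausdorff _ R)); apply.
set S := series _; rewrite (_ : S = (fun n => - series (fun k => 2 * P t k * fcos (derive1 phi) k +
   - (2 * Q t k) * fsin (derive1 phi) k) n)) /S; first exact: l3.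
apply/funext => n; rewrite /series /= -sumrN; apply: eq_bigr => k _.
have [-> ->] := derivative_coefs k (fun x => smooth_periodic_is_derive x sphi) cdphi (proj1 sphi).
ring.
Qed.

Lemma solution_hilbert t : 0 < t <= T -> is_hilbert (solution_J t) (solution_x t).
Proof.
move=> tT; have [h1 h2] := sJ tT; have [g1 g2] := summ 2 tT.
have := @trig_series_hilbert R (fun k => - (2 * (k%:R * P t k))) (fun k => 2 * (k%:R * Q t k)).
apply=> //; first by rewrite /P /= !mulr0 ?oppr0.
  rewrite (_ : (fun k => _) = (fun k => -2 * (k%:R ^+ 2 * P t k))); first exact: summ_scale.
  by apply/funext => k; ring.
rewrite (_ : (fun k => _) = (fun k => 2 * (k%:R ^+ 2 * Q t k))); first exact: summ_scale.
by apply/funext => k; ring.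
Qed.

Lemma solution_fourier_energy t (k : nat) : 0 <= t <= T ->
  fourier_energy (solution t) k = P t k ^+ 2 + Q t k ^+ 2.
Proof.
move=> tT; rewrite /fourier_energy; have [-> ->] := solution_coefs k tT.
by move: (pi : R) pi0 => c c0; field; rewrite gt_eqF.
Qed.

Let weight_le (b : R) (k : nat) : 0 <= b -> (0 < k)%N ->
  (1 + k%:R ^+ 2) `^ (s + b) <= 2 `^ (s + b) * (k%:R `^ s ^+ 2 * k%:R `^ (2 * b)).
Proof.
move=> b0 k0; have k1 : 1 <= k%:R :> R by rewrite ler1n.
have kp : 0 < k%:R :> R by rewrite ltr0n.
have -> : 2 `^ (s + b) * (k%:R `^ s ^+ 2 * k%:R `^ (2 * b)) = (2 * k%:R ^+ 2) `^ (s + b) :> R.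
  rewrite powRM ?exprn_ge0//; congr (_ * _).
  rewrite expr2 -(powRDp s s)// -(powRDp (s + s) (2 * b))// -powR_mulrn ?(ltW kp)// -powRrM.
  by congr (_ `^ _); ring.
have kk : 1 <= k%:R ^+ 2 :> R by rewrite expr_ge1// ltW.
by apply: le_powR_gt0; [rewrite addr_ge0|lra|lra].
Qed.

Let mode_sqr_le t (k : nat) : 0 <= t <= T -> (0 < k)%N ->
  P t k ^+ 2 + Q t k ^+ 2 <= A k ^+ 2 * expR (- (mu * (k%:R * t `^ (alpha^-1)))).
Proof.
move=> tT; case: k => // k _; have := pqA (ltn0Sn k) tT; rewrite /P /Q /=.
have -> : expR (- (mu * (k.+1%:R * t `^ (alpha^-1)))) = gevrey mu alpha t k.+1 ^+ 2.
  by rewrite /gevrey -expRM_natl; congr expR; field.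
move=> h; rewrite -exprMn; apply: (@le_trans _ _ ((`|p k.+1 t| + `|q k.+1 t|) ^+ 2)).
  rewrite -(real_normK (num_real (p k.+1 t))) -(real_normK (num_real (q k.+1 t))).
  have := normr_ge0 (p k.+1 t); have := normr_ge0 (q k.+1 t); nra.
by apply: ler_sqr_ge0 => //; exact: addr_ge0.
Qed.

(** With w = k t^(1/alpha) this is w^(2 b) exp(- mu w), up to the constant from 1 + k^2 <= 2 k^2. It
    is bounded in k and t, which yields the supremum, and for b > 0 and fixed k it tends to 0 with
    t, which yields the limit by Tannery's theorem. *)
Let gain (b t : R) (k : nat) : R := 2 `^ (s + b) *
  ((k%:R * t `^ (alpha^-1)) `^ (2 * b) * expR (- (mu * (k%:R * t `^ (alpha^-1))))).

Let gain_ge0 b t k : 0 <= gain b t k.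
Proof. by rewrite mulr_ge0 ?powR_ge0// mulr_ge0 ?powR_ge0// expR_ge0. Qed.

Let energy_gain (b t : R) (k : nat) : 0 <= b -> 0 <= t <= T ->
  sobolev_energy (s + b) (solution t) k * t `^ (alpha^-1) `^ (2 * b) <= gain b t k * H k.
Proof.
move=> b0 tT; rewrite /sobolev_energy solution_fourier_energy//.
case: k => [|k]; first by rewrite /P /Q /= expr0n /= addr0 !(mulr0, mul0r).
have h1 := weight_le b0 (ltn0Sn k); have h2 := mode_sqr_le tT (ltn0Sn k).
rewrite /gain powRM ?powR_ge0// /H exprMn.
set E := expR _ in h2 *; set t' := _ `^ (2 * b).
have t'0 : 0 <= t' by exact: powR_ge0.
set w := 2 `^ (s + b) in h1 *; set x := k.+1%:R `^ s ^+ 2 in h1 *.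
set y := k.+1%:R `^ (2 * b) in h1 *.
rewrite (_ : w * _ * _ = w * (x * y) * (A k.+1 ^+ 2 * E) * t'); last by ring.
rewrite ler_wpM2r//; apply: ler_pM => //.
by rewrite addr_ge0// sqr_ge0.
Qed.

Let gain_bound (b : R) : 0 <= b -> exists2 C : R, 0 <= C & forall t k, gain b t k <= C.
Proof.
move=> b0; have b20 : 0 <= 2 * b by rewrite mulr_ge0.
have [C C0 HC] := powR_expRN_bound b20.
exists (2 `^ (s + b) * (C / mu `^ (2 * b))).
  by rewrite mulr_ge0 ?powR_ge0// divr_ge0 ?powR_ge0.
move=> t k; rewrite ler_wpM2l ?powR_ge0// ler_pdivlMr ?powR_gt0//.
have w0 : 0 <= k%:R * t `^ (alpha^-1) by rewrite mulr_ge0 ?powR_ge0.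
have := HC _ (mulr_ge0 (ltW mu0) w0); rewrite (powRM (2 * b) (ltW mu0) w0).
by rewrite -mulrA [X in X <= _]mulrC.
Qed.

Let gain_series (b t : R) : 0 <= b -> cvgn (series (fun k => gain b t k * H k)).
Proof.
move=> b0; have [C C0 HC] := gain_bound b0.
have cC : cvgn (series (fun k => C * H k)) by case: (series_scale C cH).
apply: (normal_series_cvg _ cC) => k.
have g0 := mulr_ge0 (gain_ge0 b t k) (H0 k); rewrite ger0_norm//; exact: ler_wpM2r.
Qed.

Let solution_norm_le (b t : R) : 0 <= b -> 0 < t <= T ->
  ((t `^ (b / alpha))%:E * sobolev_norm (s + b) (solution t) <=
   ((2 * limn (series (fun k => gain b t k * H k)))  `^ 2^-1)%:E)%E.
Proof.
move=> b0 tT; have t0T : 0 <= t <= T by case/andP: tT => /ltW -> ->.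
have t0 : 0 < t by case/andP: tT.
pose c := t `^ (alpha^-1) `^ (2 * b).
have c0 : 0 < c by rewrite !powR_gt0.
have cs : c `^ 2^-1 = t `^ (b / alpha).
  by rewrite /c -!powRrM; congr (_ `^ _); field; rewrite gt_eqF.
have cg := @gain_series b t b0.
have h := @sobolev_norm_le _ (s + b) (solution t) (fun k => c^-1 * (gain b t k * H k))
  (L2_circle_integrable (solution_L2 t0T)).
have {}h : (sobolev_norm (s + b) (solution t) <=
   ((2 * limn (series (fun k => c^-1 * (gain b t k * H k)))) `^ 2^-1)%:E)%E.
  apply: h => [k|]; last by case: (series_scale c^-1 cg).
  by rewrite mulrC ler_pdivlMr//; exact: energy_gain.
rewrite -cs.
apply: (le_trans (lee_wpmul2l _ h)); first by rewrite lee_fin powR_ge0.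
have [_ ->] := series_scale c^-1 cg.
have L0 : 0 <= limn (series (fun k => gain b t k * H k)).
  by apply: limn_series_ge0 => // k; exact: mulr_ge0.
rewrite -EFinM lee_fin -powRM ?(ltW c0)//; last by rewrite mulr_ge0// mulr_ge0// invr_ge0 ltW.
set L := limn _; have -> // : c * (2 * (c^-1 * L)) = 2 * L by field; rewrite gt_eqF.
Qed.

Lemma solution_sobolev_sup (b : R) : 0 <= b ->
  (ereal_sup [set (t `^ (b / alpha))%:E * sobolev_norm (5 / 2 - alpha + b) (solution t)
     | t in `]0%R, T[] < +oo)%E.
Proof.
move=> b0; have [C C0 HC] := gain_bound b0.
have cC : cvgn (series (fun k => C * H k)) by case: (series_scale C cH).
apply: (@le_lt_trans _ _ ((2 * limn (series (fun k => C * H k))) `^ 2^-1)%:E); last exact: ltry.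
apply: ge_ereal_sup => _ [t /= tT <-].
have {}tT : 0 < t <= T by move: tT; rewrite in_itv/= => /andP[-> /ltW ->].
apply: (le_trans (solution_norm_le b0 tT)); rewrite lee_fin.
have g0 k : 0 <= gain b t k * H k by exact: mulr_ge0.
have h1 := limn_series_ge0 g0 (@gain_series b t b0).
have h2 : limn (series (fun k => gain b t k * H k)) <= limn (series (fun k => C * H k)).
  apply: (le_trans (ler_norm _)); apply: normal_series_le => // k.
  by rewrite ger0_norm//; exact: ler_wpM2r.
by apply: ge0_ler_powR; rewrite ?nnegrE ?mulr_ge0//; [exact: le_trans h2|lra].
Qed.

Lemma solution_sobolev_limit (b : R) : 0 < T -> 0 < b ->
  ((t `^ (b / alpha))%:E * sobolev_norm (5 / 2 - alpha + b) (solution t))%E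
     @[t --> 0^'+] --> 0%E.
Proof.
move=> T0 b0; have [C C0 HC] := gain_bound (ltW b0).
have cC : cvgn (series (fun k => C * H k)) by case: (series_scale C cH).
pose N t := (2 * limn (series (fun k => gain b t k * H k))) `^ 2^-1.
have lN : N t @[t --> 0^'+] --> (0 : R).
  apply: (@sqrt_tannery R R (0 : R)^'+ _ (fun t k => gain b t k * H k) (fun k => C * H k)).
  - by apply: nearW => t k; rewrite mulr_ge0//= ler_wpM2r.
  - exact: cC.
  - move=> k; rewrite -[X in _ --> X](mul0r (H k)); apply: cvgMl.
    pose c := 2 `^ (s + b) * k%:R `^ (2 * b).
    have l : c * t `^ (2 * b / alpha) @[t --> (0 : R)^'+] --> c * 0.
      by apply: cvgMr; apply: powR_cvg0; rewrite divr_gt0// mulr_gt0.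
    rewrite mulr0 in l; apply: (squeeze_cvgr _ (cvg_cst _) l); apply: nearW => t.
    rewrite gain_ge0 /= /gain /c powRM ?powR_ge0// -powRrM -!mulrA ler_wpM2l ?powR_ge0//.
    rewrite ler_wpM2l ?powR_ge0// (_ : alpha^-1 * (2 * b) = 2 * (b / alpha)); last by ring.
    by rewrite ler_piMr ?powR_ge0// expR_le1 oppr_le0 !mulr_ge0 ?powR_ge0// ltW.
apply: (@squeeze_cvge _ _ _ _ (fun=> 0%E) _ (fun t => (N t)%:E)); last 2 first.
- exact: cvg_cst.
- by apply: cvg_EFin => //; apply: nearW.
near=> t; have tT : 0 < t <= T.
  apply/andP; split; near: t; [exact: nbhs_right_gt|exact: nbhs_right_le].
by rewrite (solution_norm_le (ltW b0) tT) andbT mule_ge0// ?lee_fin ?powR_ge0// poweR_ge0.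
Unshelve. all: by end_near. Qed.

Let P_continuous k : continuous (P ^~ k).
Proof.
case: k => [|k]; first by move=> t; exact: cvg_cst.
by apply: (@is_derive_continuous R) => t; exact: (proj1 ode k.+1 t).
Qed.

Let Q_continuous k : continuous (Q ^~ k).
Proof.
case: k => [|k]; first by move=> t; exact: cvg_cst.
by apply: (@is_derive_continuous R) => t; exact: (proj2 ode k.+1 t).
Qed.

Let E (k : nat) t := (1 + k%:R ^+ 2) `^ (s + alpha / 2) * (P t k ^+ 2 + Q t k ^+ 2).

Let E_ge0 k t : 0 <= E k t.
Proof. by rewrite mulr_ge0 ?powR_ge0// addr_ge0// sqr_ge0. Qed.

Let E_continuous k : continuous (E k).
Proof.
apply: continuous_cmulf; apply: continuous_addf; rewrite /GRing.exp /=.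
  by apply: continuous_mulf; exact: P_continuous.
by apply: continuous_mulf; exact: Q_continuous.
Qed.

(** The exponential is weakened to the profile 1 / (1 + (k^alpha t)^2), using w^(2 alpha) = (k^alpha
    t)^2. The factor k^alpha due to the additional alpha/2 derivatives is the Jacobian of the time
    k^alpha t, so the integral is an arctangent, at most pi/2 uniformly in k. *)
Let E_bound : exists2 C : R, 0 <= C & forall k t, 0 <= t <= T ->
  E k t <= C * H k * (k%:R `^ alpha / (1 + (k%:R `^ alpha * t) ^+ 2)).
Proof.
have [C C0 HC] := @powR_expRN_bound R (2 * alpha) (mulr_ge0 (ler0n _ 2) (ltW a0)).
pose C' := 1 + C / mu `^ (2 * alpha).
have C'0 : 0 <= C' by rewrite addr_ge0// divr_ge0 ?powR_ge0.
exists (2 `^ (s + alpha / 2) * C'); first by rewrite mulr_ge0 ?powR_ge0.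
move=> [|k] t tT; first by rewrite /E /P /Q /= expr0n /= addr0 !(mulr0, mul0r).
have t0 : 0 <= t by case/andP: tT.
have al2 : 0 <= alpha / 2 by rewrite divr_ge0// ltW.
have h1 := weight_le al2 (ltn0Sn k); have h2 := mode_sqr_le tT (ltn0Sn k).
rewrite (_ : 2 * (alpha / 2) = alpha) in h1; last by field.
set w := k.+1%:R * t `^ (alpha^-1) in h2.
have w0 : 0 <= w by rewrite mulr_ge0 ?powR_ge0.
set e := expR _ in h2; set K := k.+1%:R `^ alpha in h1 *.
have wa : w `^ (2 * alpha) = (K * t) ^+ 2.
  rewrite /w powRM ?powR_ge0// -powRrM (_ : alpha^-1 * (2 * alpha) = 2%:R); last first.
    by field; rewrite gt_eqF.
  by rewrite powR_mulrn// exprMn; congr (_ * _); rewrite mulrC powRrM powR_mulrn ?powR_ge0.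
have he : e * (1 + (K * t) ^+ 2) <= C'.
  have e1 : e <= 1 by rewrite expR_le1 oppr_le0 mulr_ge0// ltW.
  rewrite mulrDr mulr1 lerD// -wa ler_pdivlMr ?powR_gt0//.
  have := HC _ (mulr_ge0 (ltW mu0) w0); rewrite (powRM (2 * alpha) (ltW mu0) w0) -/e.
  by rewrite -mulrA mulrC [w `^ _ * e]mulrC.
have den : 0 < 1 + (K * t) ^+ 2 by rewrite ltr_pwDl// sqr_ge0.
have {}he : e <= C' / (1 + (K * t) ^+ 2) by rewrite ler_pdivlMr.
apply: (@le_trans _ _ (2 `^ (s + alpha / 2) * (k.+1%:R `^ s ^+ 2 * K) *
   (A k.+1 ^+ 2 * (C' / (1 + (K * t) ^+ 2))))).
  rewrite /E; apply: ler_pM => //; first by rewrite addr_ge0// sqr_ge0.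
  by apply: (le_trans h2); rewrite ler_wpM2l// sqr_ge0.
rewrite le_eqVlt; apply/orP; left; apply/eqP; rewrite /H exprMn.
by field; rewrite gt_eqF.
Qed.

Let E_integral : exists2 C : R, 0 <= C & forall k,
  (\int[leb]_(t in `[0%R, T[) (E k t)%:E <= (C * H k)%:E)%E.
Proof.
have [C C0 HC] := E_bound; exists (C * (pi / 2)); first by rewrite mulr_ge0// divr_ge0// ltW.
move=> k; have mE : measurable_fun `[0%R, T] (fun t => (E k t)%:E).
  by apply/measurable_EFinP; apply: measurable_funTS; exact: continuous_measurable_fun.
apply: (@le_trans _ _ (\int[leb]_(t in `[0%R, T]) (E k t)%:E)%E).
  apply: ge0_subset_integral => //.
  - by move=> t _; rewrite lee_fin.
  - by move=> t /=; rewrite !in_itv/= => /andP[-> /ltW ->].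
pose K : R := k%:R `^ alpha; pose g t := C * H k * (K / (1 + (K * t) ^+ 2)).
have den t : 0 < 1 + (K * t) ^+ 2 by rewrite ltr_pwDl// sqr_ge0.
have cg : continuous g.
  apply: continuous_cmulf; apply: continuous_cmulf => t.
  apply: cvgV; first by rewrite gt_eqF.
  have cK : continuous (fun t => K * t) by apply: continuous_cmulf => x; exact: cvg_id.
  by apply: cvgD; [exact: cvg_cst|exact: (continuous_mulf cK cK)].
have gi := @continuous_itv_integrable R g 0 T cg.
apply: (@le_trans _ _ (\int[leb]_(t in `[0%R, T]) (g t)%:E)%E).
  apply: ge0_le_integral => //.
  - by move=> t _; rewrite lee_fin.
  - by apply/measurable_EFinP; apply: measurable_funTS; exact: continuous_measurable_fun.
  - by move=> t /=; rewrite in_itv/= => tT; rewrite lee_fin; exact: HC.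
have [T0|T0] := leP 0 T; last first.
  rewrite set_itv_ge ?integral_set0 ?lee_fin ?mulr_ge0 ?divr_ge0 ?(ltW pi0)//.
  by rewrite bnd_simp -ltNge.
have dG t : is_derive t (1 : R) (fun t => C * H k * atan (K * t)) (g t).
  apply: is_derive_cmulf; have h := is_derive_cmul K t.
  have := @is_derive1_comp _ atan (fun t => K * t) t _ _ (is_derive1_atan _) h.
  by rewrite mulrC.
have := Rintegral_FTC T0 dG cg; rewrite /Rintegral mulr0 atan0 mulr0 subr0 => FTC.
rewrite -(@fineK _ (\int[leb]_(x in `[0%R, T]) (g x)%:E)%E); last exact: integrable_fin_num gi.
rewrite FTC lee_fin mulrAC ler_wpM2r// ler_wpM2l//.
exact: ltW (atan_ltpi2 _).
Qed.

Lemma solution_square_integrable :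
  square_integrable_sobolev T (5 / 2 - alpha / 2) solution.
Proof.
have [C C0 HC] := E_integral.
have es : 5 / 2 - alpha / 2 = s + alpha / 2 by rewrite /s; field.
have mE k : measurable_fun `[0%R, T[ (fun t => (E k t)%:E).
  by apply/measurable_EFinP; apply: measurable_funTS; exact: continuous_measurable_fun.
have mS (f : nat -> nat) : measurable_fun `[0%R, T[ (fun t => \sum_(k <oo) (E (f k) t)%:E)%E.
  by apply: ge0_emeasurable_sum => //= k t _ _; rewrite lee_fin.
have [cC lC] := series_scale C cH.
have I : (\int[leb]_(t in `[0%R, T[) (sobolev_norm (s + alpha / 2) (solution t) `^ 2) =
    \int[leb]_(t in `[0%R, T[) (\sum_(k <oo) (E k t)%:E + \sum_(k <oo) (E k.+1 t)%:E))%E.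
  apply: eq_integral.
  move=> t; rewrite inE/= in_itv/= => /andP[t0 tT].
  have t0T : 0 <= t <= T by rewrite t0 ltW.
  rewrite sobolev_normE; last exact: L2_circle_integrable (solution_L2 t0T).
  rewrite -poweRrM mulVf// poweRe1; last first.
    by rewrite adde_ge0// nneseries_ge0// => k _ _; rewrite lee_fin sobolev_energy_ge0.
  congr (_ + _)%E; apply: eq_eseriesr => k _; congr _%:E.
    by rewrite /sobolev_energy solution_fourier_energy.
  by rewrite /sobolev_energy solution_fourier_energy.
have E0 f t : (0 <= \sum_(k <oo) (E (f k) t)%:E)%E.
  by apply: nneseries_ge0 => k _ _; rewrite lee_fin.
rewrite /square_integrable_sobolev es I ge0_integralD; last 5 first.
- exact: measurable_itv.
- by move=> t _; exact: (E0 id).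
- exact: (mS id).
- by move=> t _; exact: (E0 S).
- exact: (mS S).
have fin f : (\int[leb]_(t in `[0%R, T[) (\sum_(k <oo) (E (f k) t)%:E) =
    \sum_(k <oo) \int[leb]_(t in `[0%R, T[) (E (f k) t)%:E)%E.
  apply: integral_nneseries; first exact: measurable_itv.
    by move=> k; exact: mE.
  by move=> k t _; rewrite lee_fin.
have I0 k : (0 <= \int[leb]_(t in `[0%R, T[) (E k t)%:E)%E.
  by apply: integral_ge0 => t _; rewrite lee_fin.
rewrite (fin id) (fin S).
have CH0 k : 0 <= C * H k by rewrite mulr_ge0.
have I1 : (\sum_(k <oo) \int[leb]_(t in `[0%R, T[) (E k t)%:E < +oo)%E.
  apply: (@le_lt_trans _ _ (\sum_(k <oo) (C * H k)%:E)%E); first exact: lee_nneseries.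
  by rewrite nneseries_EFin// ltry.
rewrite lte_add_pinfty//; apply: le_lt_trans I1.
rewrite [leRHS]nneseries_recl// -(nneseries_addn 1 I0) (eq_eseriesr (f := fun k =>
  \int[leb]_(t in `[0%R, T[) (E k.+1 t)%:E) (g := fun k => \int[leb]_(t in `[0%R, T[) (E (k + 1)%N t)%:E))%E.
  exact: leeDr.
by move=> k _; rewrite addn1.
Qed.

Let weight0_le t (k : nat) : 0 <= t <= T ->
  (1 + k%:R ^+ 2) `^ s * (P t k ^+ 2 + Q t k ^+ 2) <= 2 `^ s * H k.
Proof.
move=> tT; case: k => [|k]; first by rewrite /P /Q /= expr0n /= addr0 !mulr0.
have h1 := @weight_le 0 k.+1 (lexx _) (ltn0Sn k); have h2 := mode_sqr_le tT (ltn0Sn k).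
rewrite mulr0 powRr0 mulr1 addr0 in h1.
rewrite /H exprMn mulrA; apply: ler_pM => //; first by rewrite addr_ge0// sqr_ge0.
apply: (le_trans h2); rewrite ler_piMr ?sqr_ge0// expR_le1 oppr_le0.
by rewrite !mulr_ge0 ?powR_ge0// ltW.
Qed.

(** Each mode is continuous in time. Since (x - y)^2 <= 2 x^2 + 2 y^2, the energies of the
    difference are at most 4 2^s [H], and Tannery's theorem gives continuity in norm at every t0,
    including 0. *)
Lemma solution_continuous : continuous_sobolev T (5 / 2 - alpha) solution.
Proof.
move=> t0 /andP[t00 t0T]; have t0T' : 0 <= t0 <= T by rewrite t00 ltW.
have L0 := solution_L2 t0T'; have i0 := L2_circle_integrable L0.
split.
  split=> //; have [ch _] := series_scale (2 `^ s) cH.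
  apply: le_lt_trans (ltry _); apply: (sobolev_norm_le i0 _ ch) => k.
  by rewrite /sobolev_energy solution_fourier_energy//; exact: weight0_le.
pose h t (k : nat) := (1 + k%:R ^+ 2) `^ s * ((P t k - P t0 k) ^+ 2 + (Q t k - Q t0 k) ^+ 2).
have h0 t k : 0 <= h t k by rewrite mulr_ge0 ?powR_ge0// addr_ge0// sqr_ge0.
have hle t k : 0 <= t <= T -> h t k <= 4 * 2 `^ s * H k.
  move=> tT; have e1 := weight0_le k tT; have e2 := weight0_le k t0T'.
  rewrite /h; have w0 : 0 <= (1 + k%:R ^+ 2 : R) `^ s by exact: powR_ge0.
  set w := _ `^ s in e1 e2 w0 *.
  have q1 := sqr_ge0 (P t k + P t0 k); have q2 := sqr_ge0 (Q t k + Q t0 k).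
  have := mulr_ge0 w0 q1; have := mulr_ge0 w0 q2; lra.
have [c4 _] := series_scale (4 * 2 `^ s) cH.
have near_T : \forall t \near within `[0, T[%classic (nbhs t0), 0 <= t <= T.
  by rewrite near_withinE; apply: nearW => t /=; rewrite in_itv/= => /andP[-> /ltW ->].
pose N t := (2 * limn (series (h t))) `^ 2^-1.
have lN : N t @[t --> within `[0, T[%classic (nbhs t0)] --> (0 : R).
  apply: (@sqrt_tannery R R _ _ h (fun k => 4 * 2 `^ s * H k)) => //.
    by near=> t => k; rewrite h0 hle//; near: t.
  move=> k; apply: cvg_within_filter.
  have c1 : continuous (P ^~ k) by exact: P_continuous.
  have c2 : continuous (Q ^~ k) by exact: Q_continuous.
  have : continuous (h ^~ k).
    apply: continuous_cmulf; apply: continuous_addf; apply: continuous_mulf;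
      apply: continuous_addf => //; by move=> x; exact: cvg_cst.
  have hc : h t0 k = 0 by rewrite /h !subrr expr0n /= addr0 mulr0.
  by move=> /(_ t0); rewrite /continuous_at hc.
apply: (@squeeze_cvge _ _ _ _ (fun=> 0%E) _ (fun t => (N t)%:E)); last 2 first.
- exact: cvg_cst.
- by apply: cvg_EFin => //; apply: nearW.
near=> t; have tT : 0 <= t <= T by near: t.
have i1 := L2_circle_integrable (solution_L2 tT).
rewrite poweR_ge0 /=; have di : circle_integrable (fun x => solution t x - solution t0 x).
  rewrite (_ : (fun x => _) = (fun x => solution t x + -1 * solution t0 x)).
    by apply: circle_integrableD => //; exact: circle_integrableZ.
  by apply/funext => x; rewrite mulN1r.
apply: (sobolev_norm_le di) => [k|].
  rewrite /sobolev_energy /fourier_energy; have [-> ->] := fourier_energyB k i1 i0.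
  have [-> ->] := solution_coefs k tT; have [-> ->] := solution_coefs k t0T'.
  rewrite le_eqVlt; apply/orP; left; apply/eqP; rewrite /h; congr (_ * _).
  by move: (pi : R) pi0 => c c0; field; rewrite gt_eqF.
apply: (normal_series_cvg _ c4) => k; rewrite ger0_norm//; exact: hle.
Unshelve. all: by end_near. Qed.

Let PQ_le t k : 0 <= t <= T -> `|P t k| + `|Q t k| <= Z + 1.
Proof.
move=> tT; case: k => [|k]; first by rewrite /P /Q /= normr0 addr0 addr_ge0.
exact: le_trans (pq_le_A k.+1 tT) (A_bound (ltn0Sn k)).
Qed.

Let Sp (k : nat) t := \sum_(1 <= l < k) l%:R * (k - l)%:R *
  (P t l * Q t (k - l)%N + Q t l * P t (k - l)%N).

Let Sq (k : nat) t := \sum_(1 <= l < k) l%:R * (k - l)%:R *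
  (P t l * P t (k - l)%N - Q t l * Q t (k - l)%N).

Let mode_pos f t k : (0 < k)%N -> mode f t k = f k t.
Proof. by case: k. Qed.

Let dP k t : is_derive t (1 : R) (P ^~ k) (- (mu * k%:R `^ alpha) * P t k - Sp k t).
Proof.
case: k => [|k].
  have S0 : Sp 0 t = 0 by rewrite /Sp big_geq.
  rewrite S0 mulr0 subr0; exact: is_derive_cst.
have := proj1 ode k.+1 t; rewrite /Sp [X in _ - X](eq_big_nat _ _ (F2 := fun l => l%:R * (k.+1 - l)%:R *
  (P t l * Q t (k.+1 - l)%N + Q t l * P t (k.+1 - l)%N)) ) // => l /andP[l0 lk].
by rewrite /P /Q !mode_pos ?subn_gt0.
Qed.

Let dQ k t : is_derive t (1 : R) (Q ^~ k) (- (mu * k%:R `^ alpha) * Q t k + Sq k t).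
Proof.
case: k => [|k].
  have S0 : Sq 0 t = 0 by rewrite /Sq big_geq.
  rewrite S0 mulr0 addr0; exact: is_derive_cst.
have := proj2 ode k.+1 t; rewrite /Sq [X in _ + X](eq_big_nat _ _ (F2 := fun l => l%:R * (k.+1 - l)%:R *
  (P t l * P t (k.+1 - l)%N - Q t l * Q t (k.+1 - l)%N)) ) // => l /andP[l0 lk].
by rewrite /P /Q !mode_pos ?subn_gt0.
Qed.

(** Fewer than k terms, each at most k^2 c. Such a crude power is enough because it meets the
    rapidly decreasing coefficients of a test function; the same k^3 also bounds k^alpha, as alpha
    <= 5/2. *)
Let conv_le (k : nat) (h : nat -> R) (c : R) : (forall l, `|h l| <= c) ->
  `|\sum_(1 <= l < k) l%:R * (k - l)%:R * h l| <= k%:R ^+ 3 * c.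
Proof.
move=> hc; have c0 : 0 <= c := le_trans (normr_ge0 _) (hc 0%N).
apply: (le_trans (ler_norm_sum _ _ _)).
apply: (@le_trans _ _ (\sum_(1 <= l < k) k%:R ^+ 2 * c)).
  apply: ler_sum_nat => l /andP[_ lk]; rewrite normrM; apply: ler_pM => //.
  have l1 : l%:R <= k%:R :> R by rewrite ler_nat ltnW.
  have l2 : (k - l)%:R <= k%:R :> R by rewrite ler_nat leq_subr.
  by rewrite ger0_norm ?mulr_ge0// expr2; apply: ler_pM.
rewrite sumr_const_nat -[_ *+ (k - 1)]mulr_natl (_ : k%:R ^+ 3 * c = k%:R * (k%:R ^+ 2 * c)); last by ring.
apply: ler_wpM2r.
  by rewrite mulr_ge0// exprn_ge0.
by rewrite ler_nat leq_subr.
Qed.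

Let kalpha_le (k : nat) : k%:R `^ alpha <= (k%:R : R) ^+ 3.
Proof.
case: k => [|k]; first by rewrite powR0 ?gt_eqF// expr0n.
rewrite -powR_mulrn// ler_powR ?ler1n//; case/andP: alpha1 => _; lra.
Qed.

(** * The weak formulation, tested against a smooth periodic function *)

Section WeakFormulation.
Variables phi psi : R -> R.
Hypothesis phi_smooth : smooth_periodic phi.
Hypothesis psi_L2 : L2 psi.
Hypothesis phi_psi : is_Lambda alpha phi psi.

Let a := acoef phi.
Let b := bcoef phi.
(** [f k] and [G k] are the contributions of frequency k to the integrand [F] and to the pairing of
    the solution with phi. By the equations of the modes, [f k] is the derivative of - [G k]. *)
Let f k t := 2 * pi * (a k * (Sp k t + mu * k%:R `^ alpha * P t k) +
  b k * (Sq k t - mu * k%:R `^ alpha * Q t k)).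
Let G k t := 2 * pi * (a k * P t k - b k * Q t k).

Let phi_i : circle_integrable phi.
Proof. exact: continuous_circle_integrable (smooth_periodic_continuous phi_smooth). Qed.

Let phi_summ (n : nat) : abs_summable (fun k => k%:R ^+ n * fcos phi k) /\
  abs_summable (fun k => k%:R ^+ n * fsin phi k).
Proof.
have [M HM] := smooth_periodic_decay n.+2 phi_smooth.
split; apply: (summable_inv_sqr (M := M)) => k; have [h1 h2] := HM k.
  by rewrite normrM ger0_norm ?exprn_ge0// mulrA -exprD.
by rewrite normrM ger0_norm ?exprn_ge0// mulrA -exprD.
Qed.

Let phi_summ0 : abs_summable (fun k => fcos phi k%:Z) /\ abs_summable (fun k => fsin phi k%:Z).
Proof. by have := phi_summ 0; under eq_fun do rewrite expr0 mul1r; under [in X in _ /\ X]eq_fun do rewrite expr0 mul1r. Qed.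

Let psi_summ : abs_summable (fun k => fcos psi k%:Z) /\ abs_summable (fun k => fsin psi k%:Z).
Proof.
have [h1 h2] := phi_summ 3; split.
  apply: (abs_summable_le _ h1) => k; have [-> _] := Lambda_fourier_coef k phi_psi.
  by rewrite !normrM ler_wpM2r// ger0_norm ?powR_ge0// ger0_norm ?exprn_ge0.
apply: (abs_summable_le _ h2) => k; have [_ ->] := Lambda_fourier_coef k phi_psi.
by rewrite !normrM ler_wpM2r// ger0_norm ?powR_ge0// ger0_norm ?exprn_ge0.
Qed.

Let ab_le k : `|a k| <= pi^-1 * `|fcos phi k| /\ `|b k| <= pi^-1 * `|fsin phi k|.
Proof.
rewrite /a /b /acoef /bcoef !normrM; split; last by rewrite ger0_norm// invr_ge0 ltW.
rewrite ler_wpM2r// ger0_norm.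
  case: k => [|k]//; rewrite lef_pV2 ?posrE ?mulr_gt0//.
  by rewrite ler_peMl ?(ltW pi0)// ler1n.
by case: k => [|k]; rewrite invr_ge0 ltW// mulr_gt0.
Qed.

(** The bound must hold up to t = 0, where the Gevrey factor gives no decay in k. Only the uniform
    bound Z + 1 on the modes is used, and summability comes from the coefficients of phi. *)
Let f_bound : exists2 m : nat -> R, cvgn (series m) &
  forall k t, 0 <= t <= T -> `|f k t| <= m k.
Proof.
pose Y := Z + 1; have Y0 : 0 <= Y by rewrite addr_ge0.
pose C := 2 * Y ^+ 2 + mu * Y.
have C0 : 0 <= C by rewrite addr_ge0// mulr_ge0 ?exprn_ge0// ltW.
have [h1 h2] := phi_summ 3.
have [c _] := series_scale (2 * C) (abs_summableD h1 h2).
exists (fun k => 2 * C * (`|k%:R ^+ 3 * fcos phi k| + `|k%:R ^+ 3 * fsin phi k|)) => // k t tT.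
have PY l : `|P t l| <= Y by apply: le_trans (PQ_le l tT); rewrite lerDl.
have QY l : `|Q t l| <= Y by apply: le_trans (PQ_le l tT); rewrite lerDr.
have YY l m (u v : nat -> R) : (forall l, `|u l| <= Y) -> (forall l, `|v l| <= Y) ->
    `|u l * v m| <= Y ^+ 2 by move=> hu hv; rewrite normrM expr2 ler_pM.
have k3 : 0 <= k%:R ^+ 3 :> R by rewrite exprn_ge0.
have muY (x : R) : `|x| <= Y -> `|mu * k%:R `^ alpha * x| <= k%:R ^+ 3 * (mu * Y).
  move=> hx; rewrite -mulrA mulrCA normrM ger0_norm ?powR_ge0//.
  apply: ler_pM; [exact: powR_ge0|exact: normr_ge0|exact: kalpha_le|].
  by rewrite normrM (gtr0_norm mu0) ler_pM2l.
have b1 : `|Sp k t + mu * k%:R `^ alpha * P t k| <= k%:R ^+ 3 * C.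
  apply: (le_trans (ler_normD _ _)); rewrite mulrDr lerD ?muY//.
  apply: conv_le => l; apply: (le_trans (ler_normD _ _)); rewrite mulr_natl mulr2n.
  by apply: lerD; [exact: (YY _ _ (P t) (Q t))|exact: (YY _ _ (Q t) (P t))].
have b2 : `|Sq k t - mu * k%:R `^ alpha * Q t k| <= k%:R ^+ 3 * C.
  apply: (le_trans (ler_normB _ _)); rewrite mulrDr lerD ?muY//.
  apply: conv_le => l; apply: (le_trans (ler_normB _ _)); rewrite mulr_natl mulr2n.
  by apply: lerD; [exact: (YY _ _ (P t) (P t))|exact: (YY _ _ (Q t) (Q t))].
have [a1' a2'] := ab_le k.
rewrite /f normrM gtr0_norm ?mulr_gt0//.
have pi1 : 0 <= 2 * pi :> R by rewrite mulr_ge0// ltW.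
apply: (@le_trans _ _ (2 * pi * (pi^-1 * `|fcos phi k| * (k%:R ^+ 3 * C) +
    pi^-1 * `|fsin phi k| * (k%:R ^+ 3 * C)))).
  rewrite ler_wpM2l//; apply: (le_trans (ler_normD _ _)).
  by rewrite [`|a k * _|]normrM [`|b k * _|]normrM; apply: lerD; apply: ler_pM.
rewrite [`|_ * fcos phi k|]normrM [`|_ * fsin phi k|]normrM (ger0_norm k3) le_eqVlt; apply/orP; left; apply/eqP.
by move: (pi : R) pi0 => c' c0; field; rewrite gt_eqF.
Qed.

Let f_continuous k : continuous (f k).
Proof.
have cP l : continuous (P ^~ l) by exact: P_continuous.
have cQ l : continuous (Q ^~ l) by exact: Q_continuous.
apply: continuous_cmulf; apply: continuous_addf; apply: continuous_cmulf.
  apply: continuous_addf; last exact: continuous_cmulf.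
  apply: continuous_sum_nat => l _; apply: continuous_cmulf.
  by apply: continuous_addf; exact: continuous_mulf.
apply: continuous_addf; last by apply: continuous_oppf; exact: continuous_cmulf.
apply: continuous_sum_nat => l _; apply: continuous_cmulf.
by apply: continuous_addf; [|apply: continuous_oppf]; exact: continuous_mulf.
Qed.

Let f_integral k t : 0 <= t -> \int[leb]_(r in `[0, t]) f k r = - (G k t - G k 0).
Proof.
move=> t0; have dG r : is_derive r (1 : R) (fun r => - G k r) (f k r).
  have h : is_derive r (1 : R) (fun r => - (2 * pi * a k) * P r k + 2 * pi * b k * Q r k)
      (- (2 * pi * a k) * (- (mu * k%:R `^ alpha) * P r k - Sp k r) +
       2 * pi * b k * (- (mu * k%:R `^ alpha) * Q r k + Sq k r)).
    by apply: is_deriveD; apply: is_derive_cmulf.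
  rewrite (_ : (fun r => - G k r) = (fun r => - (2 * pi * a k) * P r k + 2 * pi * b k * Q r k)); last first.
    by apply/funext => x; rewrite /G; ring.
  by apply: is_derive_eq h _; rewrite /f; ring.
have cf : continuous (f k) by exact: f_continuous.
by rewrite (Rintegral_FTC t0 dG cf) opprB addrC opprK.
Qed.

Let F r := circle_integral (fun x => solution_J r x * solution_x r x * phi x)
  + mu * circle_integral (fun x => solution r x * psi x).

(** Parseval's formula is used twice with the test function as the regular factor: phi against J B_x
    and psi against the solution. The product formulas then express everything through the modes. *)
Let F_series r : 0 < r <= T -> F r = limn (series (f ^~ r)).
Proof.
move=> rT; have r0T : 0 <= r <= T by case/andP: rT => /ltW -> ->.
have [s1 s2] := phi_summ0; have [s3 s4] := psi_summ.
have Ji := L2_circle_integrable (solution_J_L2 rT).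
have xi := L2_circle_integrable (solution_x_L2 rT).
have JDi := L2_mul_circle_integrable (solution_J_L2 rT) (solution_x_L2 rT).
have Bi := L2_circle_integrable (solution_L2 r0T).
have l1 := fourier_pairing phi_i JDi s1 s2.
have l2 := fourier_pairing (L2_circle_integrable psi_L2) Bi s3 s4.
have l3 := cvgD l1 (@cvgMr _ _ _ _ _ mu _ l2).
have FE : F r = circle_integral (fun x => phi x * (solution_J r x * solution_x r x)) +
    mu * circle_integral (fun x => psi x * solution r x).
  by congr (_ + _ * _); congr circle_integral; apply/funext => x; rewrite mulrC.
rewrite -FE in l3; apply/esym/cvg_lim => //.
pose S := series (f ^~ r); rewrite -/S.
rewrite (_ : S = (fun n => series (fun k => acoef phi k * fcos (fun x => solution_J r x * solution_x r x) k +
    bcoef phi k * fsin (fun x => solution_J r x * solution_x r x) k) n +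
   mu * series (fun k => acoef psi k * fcos (solution r) k + bcoef psi k * fsin (solution r) k) n)); first exact: l3.
apply/funext => n; rewrite /S /series /= mulr_sumr -big_split /=; apply: eq_bigr => k _.
have [sP sQ] := summ1 rT.
rewrite (product_cos_coef Ji xi (fun k => proj1 (solution_J_coefs k rT)) (fun k => proj2 (solution_J_coefs k rT))
  (fun k => proj1 (solution_x_coefs k rT)) (fun k => proj2 (solution_x_coefs k rT)) sP sQ).
rewrite (product_sin_coef Ji xi (fun k => proj1 (solution_J_coefs k rT)) (fun k => proj2 (solution_J_coefs k rT))
  (fun k => proj1 (solution_x_coefs k rT)) (fun k => proj2 (solution_x_coefs k rT)) sP sQ).
have [-> ->] := solution_coefs k r0T; rewrite -/(Sp k r) -/(Sq k r).
have -> : acoef psi k = k%:R `^ alpha * a k.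
  by rewrite /a /acoef (proj1 (Lambda_fourier_coef k phi_psi)) mulrCA.
have -> : bcoef psi k = k%:R `^ alpha * b k.
  by rewrite /b /bcoef (proj2 (Lambda_fourier_coef k phi_psi)) mulrCA.
by rewrite /f -/(a k) -/(b k); ring.
Qed.

(** The sum over k of the fundamental theorem of calculus applied to - [G k]; [f_bound] allows the
    series of the [f k] to be integrated term by term. *)
Lemma solution_weak t : 0 <= t <= T -> leb.-integrable `[0, t] (EFin \o F) /\
  circle_integral (fun x => solution t x * phi x) =
  circle_integral (fun x => B0 x * phi x) - \int[leb]_(r in `[0, t]) F r.
Proof.
move=> tT; have [t0 tT'] := andP tT; have [m cm fm] := f_bound.
have oneI : leb.-integrable `[0, t] (EFin \o (fun=> 1 : R)).
  by apply: continuous_itv_integrable => x; exact: cvg_cst.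
have mf k : measurable_fun `[0, t] (f k).
  apply: measurable_funTS; apply: continuous_measurable_fun; exact: f_continuous.
have fle k x : `[0, t]%classic x -> `|f k x| <= m k * 1.
  move=> /=; rewrite in_itv/= mulr1 => /andP[x0 xt]; apply: fm.
  by rewrite x0 (le_trans xt).
have mD : measurable (`[0, t]%classic : set (measurableTypeR R)) by exact: measurable_itv.
have mD' : measurable (`]0, t]%classic : set (measurableTypeR R)) by exact: measurable_itv.
have [Si Sl] := Rintegral_series mD mf oneI fle cm.
set S := (fun x => limn (series (f ^~ x))) in Si Sl.
have FS x : x \in `]0, t]%classic -> F x = S x.
  rewrite inE/= in_itv/= => /andP[x0 xt]; apply: F_series.
  by rewrite x0 (le_trans xt).
have sub : (`]0, t] `<=` `[0, t])%classic.
  by move=> x /=; rewrite !in_itv/= => /andP[/ltW -> ->].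
have Si' := integrableS mD mD' sub Si.
(* [F] is identified with its series only for positive times, since at time 0 the series of J and
   B_x need not converge. The endpoint is a null set and is restored afterwards. *)
have Fi' : leb.-integrable `]0, t] (EFin \o F).
  by apply: (eq_integrable _ _ _ _ Si') => // x xt; rewrite /= FS.
have Fi := integrable_obnd_cbnd Fi'; split => //.
have IF : \int[leb]_(r in `[0, t]) F r = \int[leb]_(r in `[0, t]) S r.
  rewrite -(Rintegral_itv_obnd_cbnd Fi') -(Rintegral_itv_obnd_cbnd Si').
  exact: eq_Rintegral.
have [s1 s2] := phi_summ0.
have pair r : 0 <= r <= T -> series (G ^~ r) @ \oo --> circle_integral (fun x => solution r x * phi x).
  move=> rT; have Bi := L2_circle_integrable (solution_L2 rT).
  have := fourier_pairing phi_i Bi s1 s2.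
  rewrite (_ : (fun x => phi x * solution r x) = (fun x => solution r x * phi x)); last first.
    by apply/funext => x; rewrite mulrC.
  rewrite (_ : (fun k => _ + _) = G ^~ r)//; apply/funext => k.
  by have [-> ->] := solution_coefs k rT; rewrite /G /a /b; ring.
have l1 := pair t tT; have := pair 0; rewrite lexx (le_trans t0 tT') => /(_ isT) l2.
have sol0 : solution 0 = B0 by rewrite /solution lexx.
rewrite sol0 in l2; have l3 := cvgN (cvgB l1 l2).
have : series (fun k => \int[leb]_(x in `[0, t]) f k x) @ \oo -->
    - (circle_integral (fun x => solution t x * phi x) - circle_integral (fun x => B0 x * phi x)).
  set S' := series _.
  rewrite (_ : S' = (fun n => - (series (G ^~ t) n - series (G ^~ 0) n))); first exact: l3.
  apply/funext => n; rewrite /S' /series /= -sumrB -sumrN; apply: eq_bigr => k _.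
  exact: f_integral.
by move=> /(cvg_unique (@norm_hausdorff _ R) Sl); rewrite IF => ->; ring.
Qed.

End WeakFormulation.

Lemma solution_weak_solution : weak_solution mu alpha T B0 solution.
Proof.
split.
- move=> t /andP[t0 tT]; have t0T : 0 <= t <= T by rewrite t0 ltW.
  split; first exact: solution_L2.
  rewrite /zero_mean; have [+ _] := solution_coefs 0 t0T; rewrite /P /= mulr0 => <-.
  by congr circle_integral; apply/funext => x; rewrite mulr0z mul0r cos0 mulr1.
- by apply: aeW => x; rewrite /solution lexx.
exists solution_J, solution_x; split.
  apply: aeW => t /andP[t0 tT]; have t0T : 0 < t <= T by rewrite t0 ltW.
  split; [exact: solution_J_L2|exact: solution_x_L2|exact: solution_Lambda|
    exact: solution_weak_derivative|exact: solution_hilbert].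
move=> phi psi sphi psi2 Lphi F t /andP[t0 tT].
by apply: solution_weak => //; rewrite t0 ltW.
Qed.



End Existence.

(** * Uniqueness *)

Section Volterra.
Context {R : realType}.
Local Notation leb := (@lebesgue_measure R).

(** Iterating the equation bounds the primitive by S (c t)^n / n! for every n, where S is the
    integral of |g|. The argument works with primitives because g is only integrable and satisfies
    the equation almost everywhere. *)
Lemma volterra_zero (g : R -> R) (c t1 : R) : 0 <= c ->
  leb.-integrable `[0, t1] (EFin \o g) ->
  {ae leb, forall r, 0 < r <= t1 -> g r = - c * \int[leb]_(x in `[0, r]) g x} ->
  forall t, 0 <= t <= t1 -> \int[leb]_(x in `[0, t]) g x = 0.
Proof.
move=> c0 gi gD.
have mI t : measurable (`[0, t]%classic : set (measurableTypeR R)) by exact: measurable_itv.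
have git t : t <= t1 -> leb.-integrable `[0, t] (EFin \o g).
  move=> tt; apply: (integrableS (mI t1) (mI t) _ gi) => x /=.
  by rewrite !in_itv/= => /andP[-> /le_trans ->].
have gin t : t <= t1 -> leb.-integrable `[0, t] (EFin \o (fun x => `|g x|)).
  by move=> /git /integrable_norm.
pose S := \int[leb]_(x in `[0, t1]) `|g x|.
have S0 : 0 <= S by apply: Rintegral_ge0.
have norm_le t : t <= t1 -> `|\int[leb]_(x in `[0, t]) g x| <= \int[leb]_(x in `[0, t]) `|g x|.
  by move=> tt; apply: le_normr_Rintegral => //; exact: git.
have bound (n : nat) t : 0 <= t <= t1 ->
    `|\int[leb]_(x in `[0, t]) g x| <= S * ((c * t) ^+ n / n`!%:R).
  elim: n t => [|n IHn] t /andP[t0 tt1]; apply: (le_trans (norm_le _ tt1)).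
    rewrite expr0 fact0 invr1 !mulr1 /S /Rintegral fine_le//.
    - exact: integrable_fin_num (gin _ tt1).
    - exact: integrable_fin_num (gin _ (lexx _)).
    apply: ge0_subset_integral => //.
      by have /measurable_int := gin _ (lexx t1).
    by move=> x /=; rewrite !in_itv/= => /andP[-> /le_trans ->].
  pose h r : R := S * c * ((c * r) ^+ n / n`!%:R).
  pose H r : R := S * ((c * r) ^+ n.+1 / n.+1`!%:R).
  have dH r : is_derive r (1 : R) H (h r).
    have d := @is_deriveX _ _ _ n.+1 r 1 _ (is_derive_cmul c r).
    have {}d := is_derive_cmulf (S / n.+1`!%:R) d.
    rewrite (_ : H = (fun r => S / n.+1`!%:R * ((fun r => c * r) ^+ n.+1) r)); last first.
      by apply/funext => x; rewrite /H exprfctE; ring.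
    apply: is_derive_eq d _; rewrite /h factS natrM /GRing.scale /=.
    by field; rewrite nat1r !pnatr_eq0 -lt0n fact_gt0.
  have ch : continuous h.
    have cX m : continuous (fun r => (c * r) ^+ m).
      elim: m => [|m IHm].
        by under eq_fun do rewrite expr0; move=> x; exact: cvg_cst.
      under eq_fun do rewrite exprS; apply: continuous_mulf => //.
      by apply: continuous_cmulf => x; exact: cvg_id.
    by apply: continuous_cmulf => x; apply: cvgMl; exact: cX.
  have Hh : \int[leb]_(r in `[0, t]) h r = H t.
    by rewrite (Rintegral_FTC t0 dH ch) {2}/H mulr0 expr0n /= mul0r mulr0 subr0.
  have hi := @continuous_itv_integrable R h 0 t ch.
  rewrite -[leRHS]/(H t) -Hh /Rintegral fine_le//.
  - exact: integrable_fin_num (gin _ tt1).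
  - exact: integrable_fin_num hi.
  apply: ae_ge0_le_integral => //.
  - by have /measurable_int := gin _ tt1.
  - move=> x /=; rewrite in_itv/= => /andP[x0 xt]; rewrite lee_fin /h !mulr_ge0//.
    by rewrite exprn_ge0// mulr_ge0.
  - by have /measurable_int := hi.
  have : {ae leb, forall x : R, x != 0} by exact: ae_neq.
  apply: filterS2 gD => x gx xn0; rewrite /= in_itv/= => /andP[x0 xt].
  have x1 : x <= t1 by exact: le_trans tt1.
  rewrite lee_fin gx ?x1 ?andbT ?lt_neqAle 1?eq_sym ?xn0//.
  rewrite normrM normrN (ger0_norm c0) /h [S * c]mulrC -mulrA ler_wpM2l//.
  by apply: IHn; rewrite x0.
move=> t tt; apply/eqP; rewrite -normr_le0.
have l : S * ((c * t) ^+ n / n`!%:R) @[n --> \oo] --> S * (0 : R).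
  by apply: cvgMr; exact: cvg_series_cvg_0 (is_cvg_series_exp_coeff (c * t)).
rewrite mulr0 in l; apply: (cvgr_to_ge l); apply: nearW => n; exact: bound.
Qed.

End Volterra.

(** * Cosines and sines as test functions *)

Section TrigTest.
Context {R : realType}.
Implicit Types (f g : R -> R).

Definition trig_test (a b : R) (k : nat) (x : R) : R := a * cos (k%:R * x) + b * sin (k%:R * x).

Lemma is_derive_trig_test (a b : R) (k : nat) (x : R) :
  is_derive x (1 : R) (trig_test a b k) (trig_test (k%:R * b) (- (k%:R * a)) k x).
Proof.
have h := is_deriveD (is_derive_cmulf a (is_derive_cosZ k%:R x)) (is_derive_cmulf b (is_derive_sinZ k%:R x)).
by apply: is_derive_eq h _; rewrite /trig_test; ring.
Qed.

Lemma trig_test_continuous (a b : R) (k : nat) : continuous (trig_test a b k).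
Proof. by apply: (@is_derive_continuous R) => x; exact: is_derive_trig_test. Qed.

Lemma trig_test_pairing f (a b : R) (k : nat) : circle_integrable f ->
  circle_integral (fun x => f x * trig_test a b k x) = a * fcos f k + b * fsin f k.
Proof.
move=> fi; have fc := circle_integrableM fi (@continuous_cosZ R k%:~R).
have fs := circle_integrableM fi (@continuous_sinZ R k%:~R).
rewrite /fcos /fsin -!circle_integralZ// -circle_integralD; [|exact: circle_integrableZ..].
by congr circle_integral; apply/funext => x; rewrite /trig_test; ring.
Qed.

Lemma trig_test_coefs (a b : R) (k n : nat) : n != k ->
  fcos (trig_test a b k) n = 0 /\ fsin (trig_test a b k) n = 0.
Proof.
move=> nk; have ci := continuous_circle_integrable (@continuous_cosZ R n%:~R).
have si := continuous_circle_integrable (@continuous_sinZ R n%:~R).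
rewrite /fcos /fsin.
under [in X in _ = _ /\ X = _]eq_fun do rewrite mulrC.
under [in X in X = _ /\ _]eq_fun do rewrite mulrC.
rewrite !trig_test_pairing// fcos_cos fsin_cos fcos_sin fsin_sin.
have z1 : (n%:Z - k%:Z == 0) = false by apply/negbTE; lia.
have z2 : (n%:Z + k%:Z == 0) = false by apply/negbTE; lia.
by rewrite z1 z2 !(addr0, subr0, mulr0).
Qed.

Lemma trig_test_Lambda (alpha a b : R) (k : nat) :
  is_Lambda alpha (trig_test a b k) (fun x => k%:R `^ alpha * trig_test a b k x).
Proof.
have ti := continuous_circle_integrable (@trig_test_continuous a b k).
apply: fourier_coef_Lambda => // [|n]; first exact: circle_integrableZ.
have fc := circle_integrableM ti (@continuous_cosZ R n%:~R).
have fs := circle_integrableM ti (@continuous_sinZ R n%:~R).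
have [e1 e2] : fcos (fun x => k%:R `^ alpha * trig_test a b k x) n = k%:R `^ alpha * fcos (trig_test a b k) n
    /\ fsin (fun x => k%:R `^ alpha * trig_test a b k x) n = k%:R `^ alpha * fsin (trig_test a b k) n.
  rewrite /fcos /fsin -!circle_integralZ//.
  by split; congr circle_integral; apply/funext => x; rewrite mulrA.
rewrite e1 e2; have [->//|nk] := eqVneq n k.
by have [-> ->] := trig_test_coefs a b nk; rewrite !mulr0.
Qed.

Lemma L2_trig_test (c a b : R) (k : nat) : L2 (fun x => c * trig_test a b k x).
Proof.
have cc : continuous (fun x => c * trig_test a b k x).
  by apply: continuous_cmulf; exact: trig_test_continuous.
split.
- by move=> x; rewrite /trig_test periodic_cosZ periodic_sinZ.
- exact: continuous_measurable_fun.
exact: (continuous_circle_integrable (continuous_mulf cc cc)).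
Qed.

Lemma Lambda1_opp_coefs f g (k : nat) : circle_integrable g ->
  is_Lambda 1 f (fun x => - g x) ->
  fcos g k = - (k%:R * fcos f k) /\ fsin g k = - (k%:R * fsin f k).
Proof.
move=> gi /(Lambda_fourier_coef k); rewrite powRr1//.
by have [-> ->] := fourier_oppE k gi => -[<- <-]; rewrite !opprK.
Qed.

Lemma weak_derivative_coefs f g (k : nat) : circle_integrable f -> circle_integrable g ->
  is_weak_derivative f g ->
  fcos g k = k%:R * fsin f k /\ fsin g k = - (k%:R * fcos f k).
Proof.
move=> fi gi w.
have H a b : a * fcos g k + b * fsin g k = - (k%:R * b * fcos f k - k%:R * a * fsin f k).
  rewrite -trig_test_pairing// (w _ (smooth_periodic_trig k a b)) -mulNr -trig_test_pairing//.
  congr (- circle_integral _); apply/funext => x; congr (_ * _); rewrite derive1E.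
  by have := is_derive_trig_test a b k x => /@derive_val.
by have := H 1 0; have := H 0 1; split; lra.
Qed.

End TrigTest.

(** * The integrated system satisfied by the modes of any weak solution *)

Section WeakModes.
Context {R : realType}.
Local Notation leb := (@lebesgue_measure R).

Definition cos_mode (f : R -> R) (k : nat) : R := (2 * pi)^-1 * fcos f k.
Definition sin_mode (f : R -> R) (k : nat) : R := - ((2 * pi)^-1 * fsin f k).

Definition cos_conv (f : R -> R) (k : nat) : R := \sum_(1 <= l < k) l%:R * (k - l)%:R *
  (cos_mode f l * sin_mode f (k - l)%N + sin_mode f l * cos_mode f (k - l)%N).
Definition sin_conv (f : R -> R) (k : nat) : R := \sum_(1 <= l < k) l%:R * (k - l)%:R *
  (cos_mode f l * cos_mode f (k - l)%N - sin_mode f l * sin_mode f (k - l)%N).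

Lemma fourier_energy_mode f k : fourier_energy f k = cos_mode f k ^+ 2 + sin_mode f k ^+ 2.
Proof.
rewrite /fourier_energy /cos_mode /sin_mode.
by move: (pi : R) (@pi_gt0 R) => c c0; field; rewrite gt_eqF.
Qed.

(** Three derivatives beyond s >= 0 make k^3 |b_k| bounded, so k b_k decays like k^(-2) and is
    summable. This is what the product formulas require of J and B_x. *)
Lemma sobolev3_summable f (s : R) : 0 <= s -> circle_integrable f ->
  (sobolev_norm (s + 3) f < +oo)%E ->
  abs_summable (fun k => k%:R * cos_mode f k) /\ abs_summable (fun k => k%:R * sin_mode f k).
Proof.
move=> s0 fi /(sobolev_norm_lty fi) ce.
pose L := limn (series (sobolev_energy (s + 3) f)).
have H k : k%:R ^+ 6 * (cos_mode f k ^+ 2 + sin_mode f k ^+ 2) <= L.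
  have : sobolev_energy (s + 3) f k <= L.
    apply: le_trans (partial_sum_le_series k.+1 (@sobolev_energy_ge0 _ _ _) ce).
    rewrite /series /= big_nat_recr//= lerDr; apply: sumr_ge0 => i _; exact: sobolev_energy_ge0.
  apply: le_trans; rewrite /sobolev_energy fourier_energy_mode ler_wpM2r ?addr_ge0 ?sqr_ge0//.
  have k2 : 0 <= k%:R ^+ 2 :> R by exact: sqr_ge0.
  have k21 : 1 <= 1 + k%:R ^+ 2 :> R by rewrite lerDl.
  apply: (@le_trans _ _ ((1 + k%:R ^+ 2) ^+ 3)).
    by rewrite (exprM _ 2 3) lerXn2r ?nnegrE ?addr_ge0// lerDr.
  by rewrite -(@powR_mulrn _ (1 + k%:R ^+ 2) 3) ?addr_ge0//; apply: ler_powR => //; rewrite lerDr.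
have B (k : nat) (u v : R) : k%:R ^+ 6 * (u ^+ 2 + v ^+ 2) <= L -> k%:R ^+ 2 * `|k%:R * u| <= L + 1.
  move=> h; have k0 : 0 <= k%:R :> R by [].
  rewrite normrM (ger0_norm k0) mulrA -exprSr.
  have h2 : (k%:R ^+ 3 * `|u|) ^+ 2 <= L.
    rewrite exprMn real_normK ?num_real// -exprM; apply: le_trans h.
    by rewrite ler_wpM2l ?exprn_ge0// lerDl sqr_ge0.
  move: h2; set z := _ * `|u|; have := sqr_ge0 (z - 1); nra.
split; apply: (summable_inv_sqr (M := L + 1)) => k; first exact: B (H k).
by apply: (B k _ (cos_mode f k)); rewrite addrC; exact: H.
Qed.

Variables (mu alpha T : R) (B0 : R -> R) (B : R -> R -> R).
Hypothesis alpha1 : 1 < alpha <= 5 / 2.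
Hypothesis HB0 : L2 B0.
Hypothesis weakB : weak_solution mu alpha T B0 B.
Hypothesis supB : (ereal_sup [set (t `^ (3 / alpha))%:E * sobolev_norm (5 / 2 - alpha + 3) (B t)
   | t in `]0%R, T[] < +oo)%E.

Lemma weak_solution_L2 t : 0 <= t < T -> L2 (B t).
Proof. by case: weakB => + _ _ => /(_ t) h tT; case: (h tT). Qed.

Let modes_summable t : 0 < t < T -> abs_summable (fun k => k%:R * cos_mode (B t) k) /\
  abs_summable (fun k => k%:R * sin_mode (B t) k).
Proof.
move=> /andP[t0 tT]; have Bi : circle_integrable (B t).
  by apply: L2_circle_integrable; apply: weak_solution_L2; rewrite (ltW t0).
apply: (@sobolev3_summable _ (5 / 2 - alpha)) => //.
  by case/andP: alpha1 => _ h; lra.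
have tp : 0 < t `^ (3 / alpha) by exact: powR_gt0.
have : ((t `^ (3 / alpha))%:E * sobolev_norm (5 / 2 - alpha + 3) (B t) < +oo)%E.
  apply: le_lt_trans supB; apply: ereal_sup_ubound; exists t => //=.
  by rewrite in_itv/= t0.
have : (0 <= sobolev_norm (5 / 2 - alpha + 3) (B t))%E by exact: poweR_ge0.
case: (sobolev_norm _ _) => [r| |]// _; first by move=> _; exact: ltry.
by rewrite gt0_muley ?lte_fin.
Qed.

(** J and B_x enter only through their coefficients, which those of B determine. The product
    formulas therefore turn the weak formulation tested with a cos(k x) + b sin(k x) into a closed
    integrated system for the modes, valid for almost every time in the integrand. *)
Lemma weak_solution_modes (a b : R) (k : nat) : exists F : R -> R,
  {ae leb, forall r, 0 < r < T -> F r =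
     a * (2 * pi * cos_conv (B r) k + mu * k%:R `^ alpha * fcos (B r) k) +
     b * (2 * pi * sin_conv (B r) k + mu * k%:R `^ alpha * fsin (B r) k)} /\
  forall t, 0 <= t < T -> leb.-integrable `[0, t] (EFin \o F) /\
    a * fcos (B t) k + b * fsin (B t) k =
    a * fcos B0 k + b * fsin B0 k - \int[leb]_(r in `[0, t]) F r.
Proof.
case: weakB => _ _ [J [Bx [aeJ]]].
move=> /(_ _ _ (smooth_periodic_trig k a b) (L2_trig_test (k%:R `^ alpha) a b k)
  (@trig_test_Lambda _ alpha a b k)) /=.
set F := (fun r : R => _) => HF; exists F; split; last first.
  move=> t tT; have [Fi E] := HF t tT; split => //.
  have Bi := L2_circle_integrable (weak_solution_L2 tT).
  have B0i := L2_circle_integrable HB0.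
  by rewrite -!trig_test_pairing.
apply: filterS aeJ => r h rT; have [LJ Lx LB wB _] := h rT.
have r0T : 0 <= r < T by case/andP: rT => /ltW -> ->.
have Bi := L2_circle_integrable (weak_solution_L2 r0T).
have Ji := L2_circle_integrable LJ; have xi := L2_circle_integrable Lx.
have JDi := L2_mul_circle_integrable LJ Lx.
have pi0 : 2 * pi != 0 :> R by rewrite mulf_neq0// gt_eqF ?pi_gt0.
have cE (j : nat) : fcos (B r) j = 2 * pi * cos_mode (B r) j by rewrite /cos_mode mulVKf.
have sE (j : nat) : fsin (B r) j = - (2 * pi * sin_mode (B r) j) by rewrite /sin_mode mulrN opprK mulVKf.
have Jc (j : nat) : fcos (J r) j = - (2 * pi) * (j%:R * cos_mode (B r) j).
  by rewrite (proj1 (Lambda1_opp_coefs j Ji LB)) cE; ring.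
have Js (j : nat) : fsin (J r) j = 2 * pi * (j%:R * sin_mode (B r) j).
  by rewrite (proj2 (Lambda1_opp_coefs j Ji LB)) sE; ring.
have Dc (j : nat) : fcos (Bx r) j = - (2 * pi) * (j%:R * sin_mode (B r) j).
  by rewrite (proj1 (weak_derivative_coefs j Bi xi wB)) sE; ring.
have Ds (j : nat) : fsin (Bx r) j = - (2 * pi) * (j%:R * cos_mode (B r) j).
  by rewrite (proj2 (weak_derivative_coefs j Bi xi wB)) cE; ring.
have [sp sq] := modes_summable rT.
rewrite /F trig_test_pairing//.
rewrite (product_cos_coef Ji xi Jc Js Dc Ds sp sq) (product_sin_coef Ji xi Jc Js Dc Ds sp sq).
have -> : circle_integral (fun x => B r x * (k%:R `^ alpha * trig_test a b k x)) =
    k%:R `^ alpha * (a * fcos (B r) k + b * fsin (B r) k).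
  rewrite -trig_test_pairing// -circle_integralZ; last first.
    exact: circle_integrableM Bi (@trig_test_continuous R a b k).
  by congr circle_integral; apply/funext => x; ring.
by rewrite -/(cos_conv (B r) k) -/(sin_conv (B r) k); ring.
Qed.

End WeakModes.

(** * Comparison of two weak solutions *)

Section Uniqueness.
Context {R : realType}.
Local Notation leb := (@lebesgue_measure R).
Variables (mu alpha T : R) (B0 : R -> R).
Hypothesis mu0 : 0 <= mu.
Hypothesis alpha1 : 1 < alpha <= 5 / 2.
Hypothesis HB0 : L2 B0.

Let sup_condition (B : R -> R -> R) :=
  (ereal_sup [set (t `^ (3 / alpha))%:E * sobolev_norm (5 / 2 - alpha + 3) (B t)
    | t in `]0%R, T[] < +oo)%E.

(** The Volterra unknown is F1 - F2 rather than the difference of the coefficients. By induction the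
    convolutions agree, so F1 - F2 is mu k^alpha times that difference, and the integrated
    identities make the difference equal to minus the integral of F1 - F2. *)
Lemma weak_solution_coefs_unique (B1 B2 : R -> R -> R) :
  weak_solution mu alpha T B0 B1 -> weak_solution mu alpha T B0 B2 ->
  sup_condition B1 -> sup_condition B2 ->
  forall (k : nat) t, 0 <= t < T ->
    fcos (B1 t) k = fcos (B2 t) k /\ fsin (B1 t) k = fsin (B2 t) k.
Proof.
move=> w1 w2 s1 s2; elim/ltn_ind => k IHk.
suff H a b t : 0 <= t < T -> a * fcos (B1 t) k + b * fsin (B1 t) k =
    a * fcos (B2 t) k + b * fsin (B2 t) k.
  by move=> t tT; have := H 1 0 t tT; have := H 0 1 t tT; split; lra.
have [F1 [ae1 E1]] := weak_solution_modes alpha1 HB0 w1 s1 a b k.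
have [F2 [ae2 E2]] := weak_solution_modes alpha1 HB0 w2 s2 a b k.
move=> tT; have [i1 e1] := E1 t tT; have [i2 e2] := E2 t tT.
have mI r : measurable (`[0, r]%classic : set (measurableTypeR R)) by exact: measurable_itv.
have intB r : 0 <= r < T -> \int[leb]_(x in `[0, r]) (F1 x - F2 x) =
    - ((a * fcos (B1 r) k + b * fsin (B1 r) k) - (a * fcos (B2 r) k + b * fsin (B2 r) k)).
  move=> rT; have [j1 f1] := E1 r rT; have [j2 f2] := E2 r rT.
  by rewrite RintegralB// f1 f2; ring.
have gi : leb.-integrable `[0, t] (EFin \o (fun x => F1 x - F2 x)).
  by have := integrableB (mI t) i1 i2; apply: eq_integrable => // x _; rewrite /= EFinB.
have c0 : 0 <= mu * k%:R `^ alpha by rewrite mulr_ge0 ?powR_ge0.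
have [t0 tT'] := andP tT.
have : \int[leb]_(x in `[0, t]) (F1 x - F2 x) = 0.
  apply: (volterra_zero c0 gi); last by rewrite t0 lexx.
  apply: filterS2 ae1 ae2 => r h1 h2 /andP[r0 rt].
  have rT : 0 < r < T by rewrite r0 (le_lt_trans rt).
  have rT' : 0 <= r < T by rewrite (ltW r0) (le_lt_trans rt).
  rewrite intB// h1// h2//.
  have same (l : nat) : (l < k)%N -> cos_mode (B1 r) l = cos_mode (B2 r) l /\
      sin_mode (B1 r) l = sin_mode (B2 r) l.
    by move=> lk; rewrite /cos_mode /sin_mode; have [-> ->] := IHk l lk r rT'.
  have -> : cos_conv (B1 r) k = cos_conv (B2 r) k.
    apply: eq_big_nat => l /andP[l0 lk]; have [-> ->] := same l lk.
    by have [|-> ->//] := same (k - l)%N; rewrite ltn_subrL l0 (leq_ltn_trans _ lk).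
  have -> : sin_conv (B1 r) k = sin_conv (B2 r) k.
    apply: eq_big_nat => l /andP[l0 lk]; have [-> ->] := same l lk.
    by have [|-> ->//] := same (k - l)%N; rewrite ltn_subrL l0 (leq_ltn_trans _ lk).
  ring.
by rewrite intB// => /eqP; rewrite oppr_eq0 subr_eq0 => /eqP.
Qed.

Lemma weak_solution_unique (B1 B2 : R -> R -> R) :
  weak_solution mu alpha T B0 B1 -> weak_solution mu alpha T B0 B2 ->
  sup_condition B1 -> sup_condition B2 ->
  forall t, 0 <= t < T -> {ae leb, forall x, B1 t x = B2 t x}.
Proof.
move=> w1 w2 s1 s2 t tT.
have L1 := weak_solution_L2 w1 tT; have L2' := weak_solution_L2 w2 tT.
have i1 := L2_circle_integrable L1; have i2 := L2_circle_integrable L2'.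
have coefs := weak_solution_coefs_unique w1 w2 s1 s2.
pose d x := B1 t x - B2 t x.
have di : circle_integrable d.
  rewrite (_ : d = (fun x => B1 t x + -1 * B2 t x)).
    by apply: circle_integrableD => //; exact: circle_integrableZ.
  by apply/funext => x; rewrite mulN1r.
have d0 (k : nat) : fcos d k = 0 /\ fsin d k = 0.
  have [-> ->] := fourier_energyB k i1 i2; have [-> ->] := coefs k t tT.
  by rewrite !subrr.
have d0' (j : int) : fcos d j = 0 /\ fsin d j = 0.
  case: j => k; first exact: d0.
  by rewrite NegzE fcosN fsinN//; have [-> ->] := d0 k.+1; rewrite oppr0.
apply: ae_circ_periodic; [by case: L1|by case: L2'|].
apply: filterS (fourier_unique di (fun j => proj1 (d0' j)) (fun j => proj2 (d0' j))) => x h cx.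
by apply/eqP; rewrite -subr_eq0; apply/eqP; exact: h.
Qed.

End Uniqueness.

Theorem theorem1p3 (R : realType) (mu alpha : R) (B0 : R -> R)
    (hmu : 0 < mu) (halpha : 1 < alpha <= 5 / 2)
    (hB0 : sobolev (5 / 2 - alpha) B0) (hmean : zero_mean B0) :
  exists2 T : R, 0 < T &
  let P (B : R -> R -> R) :=
    [/\ weak_solution mu alpha T B0 B,
        continuous_sobolev T (5 / 2 - alpha) B,
        square_integrable_sobolev T (5 / 2 - alpha / 2) B,
        forall beta : R, 0 <= beta ->
          (ereal_sup [set (t `^ (beta / alpha))%:E *
                          sobolev_norm (5 / 2 - alpha + beta) (B t)
                     | t in `]0%R, T[] < +oo)%E &
        forall beta : R, 0 < beta ->
          ((t `^ (beta / alpha))%:E *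
             sobolev_norm (5 / 2 - alpha + beta) (B t))%E
          @[t --> 0^'+] --> 0%E] in
  exists2 B : R -> R -> R, P B &
    forall B' : R -> R -> R, P B' ->
      forall t : R, 0 <= t < T ->
        {ae lebesgue_measure, forall x : R, B' t x = B t x}.
Proof.
have [L2B0 nB0] := hB0; have B0i := L2_circle_integrable L2B0.
have a1 : 1 < alpha by case/andP: halpha.
have pi0 : 2 * pi != 0 :> R by rewrite mulf_neq0// gt_eqF ?pi_gt0.
pose y k := `|cos_mode B0 k| + `|sin_mode B0 k|.
have y0 k : 0 <= y k by exact: addr_ge0.
have ce := sobolev_norm_lty B0i nB0.
(* The factor 2 comes from (|p| + |q|)^2 <= 2 (p^2 + q^2), the amplitudes being measured by |p| +
   |q|. *)
have yZ N : \sum_(1 <= k < N) (k%:R `^ (5 / 2 - alpha) * y k) ^+ 2 <=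
    2 * limn (series (sobolev_energy (5 / 2 - alpha) B0)).
  apply: (@le_trans _ _ (2 * \sum_(0 <= k < N) sobolev_energy (5 / 2 - alpha) B0 k)); last first.
    by rewrite ler_wpM2l//; apply: partial_sum_le_series => // k; exact: sobolev_energy_ge0.
  case: N => [|N]; first by rewrite !big_geq// mulr0.
  rewrite [X in _ <= _ * X]big_ltn// mulrDr mulr_sumr -[leLHS]add0r lerD//.
    by rewrite mulr_ge0// sobolev_energy_ge0.
  apply: ler_sum_nat => k /andP[k0 _].
  have k1 : 0 < k%:R :> R by rewrite ltr0n.
  have w : k%:R `^ (5 / 2 - alpha) ^+ 2 <= (1 + k%:R ^+ 2) `^ (5 / 2 - alpha).
    rewrite -powR_mulrn ?powR_ge0// powRAC powR_mulrn ?(ltW k1)//.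
    apply: le_powR_gt0; [by case/andP: halpha => _ h; lra|exact: exprn_gt0|by rewrite lerDr].
  rewrite /sobolev_energy fourier_energy_mode exprMn [leRHS]mulrCA.
  apply: ler_pM; [exact: sqr_ge0|exact: sqr_ge0|exact: w|rewrite /y].
  rewrite -(real_normK (num_real (cos_mode B0 k))) -(real_normK (num_real (sin_mode B0 k))).
  by have := sqr_ge0 (`|cos_mode B0 k| - `|sin_mode B0 k|); nra.
have [T [A [Z [T0 A0 AZ bound]]]] := modes_bound hmu a1 y0 yZ.
have [p [q [p0 q0 dp dq]]] := modes_exist (fun k => mu * k%:R `^ alpha) (cos_mode B0) (sin_mode B0).
have ode : modes_ode mu alpha p q by split.
have pqA (k : nat) t : (0 < k)%N -> 0 <= t <= T -> `|p k t| + `|q k t| <= A k * gevrey mu alpha t k.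
  by apply: bound => // l; rewrite p0 q0.
have p_init (k : nat) : fcos B0 k = 2 * pi * p k 0 by rewrite p0 /cos_mode mulVKf.
have q_init (k : nat) : fsin B0 k = - (2 * pi * q k 0).
  by rewrite q0 /sin_mode mulrN opprK mulVKf.
exists T => //= ; exists (solution p q B0).
  split.
  - exact: (solution_weak_solution hmu halpha A0 AZ ode pqA hB0 hmean p_init q_init).
  - exact: (solution_continuous hmu halpha A0 AZ ode pqA hB0 hmean p_init q_init).
  - exact: (solution_square_integrable hmu halpha A0 AZ ode pqA hB0 hmean p_init q_init).
  - exact: (solution_sobolev_sup hmu halpha A0 AZ pqA hB0 hmean p_init q_init).
  - by move=> b; exact: (solution_sobolev_limit hmu halpha A0 AZ pqA hB0 hmean p_init q_init T0).
move=> B' [w' _ _ s' _] t tT.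
(* The bound with beta = 3 gives summability of k b_k at each positive time for the competing
   solution. *)
apply: (weak_solution_unique (ltW hmu) halpha L2B0 w' _ (s' 3 _)) => //.
  exact: (solution_weak_solution hmu halpha A0 AZ ode pqA hB0 hmean p_init q_init).
exact: (solution_sobolev_sup hmu halpha A0 AZ pqA hB0 hmean p_init q_init).
Qed.
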